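(* Let $Z=(Z_n)_{n\ge0}$ be a supercritical Galton–Watson process with $Z_0=1$ whose offspring law $(p_j)_{j\ge0}$ is of Schröder type and of type $(d,\mu)$, and let $(c_n)$, $W$, $w$ be as described in the context. Then for every sequence of integers $k_n$ with $k_n\equiv\mu \pmod d$, $k_n\to\infty$ and $k_n=o(c_n)$, as $n\to\infty$, $$\mathbf P(Z_n=k_n)=\frac{d}{m^{n-a_n}c_{a_n}}\,w\Big(\frac{k_n}{m^{n-a_n}c_{a_n}}\Big)\big(1+o(1)\big)$$ and $$\mathbf P(0<Z_n\le k_n)=\mathbf P\Big(0<W<\frac{k_n}{m^{n-a_n}c_{a_n}}\Big)\big(1+o(1)\big),$$ where for fixed $n$, $a_n:=\min\{\ell\ge1:\ c_\ell\ge k_n\}$.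
   Context: A Galton–Watson process $Z$ has offspring generating function $f(s)=\sum_{j\ge0}p_js^j$, $0\le s\le 1$, assumed non-degenerate ($p_j<1$ for all $j$) and supercritical: $m:=f'(1)\in(1,\infty)$. $Z_0=1$. The offspring law is of Schröder type if $p_0+p_1>0$ and of Böttcher type if $p_0+p_1=0$. It is of type $(d,\mu)$ if $d\ge1$ is the greatest common divisor of $\{j-\ell:\ j\ne\ell,\ p_jp_\ell>0\}$ and $\mu\ge0$ is the minimal $j$ with $p_j>0$. $(c_n)_{n\ge0}$ is a fixed sequence of positive constants such that $c_n^{-1}Z_n\to W$ almost surely for a non-degenerate random variable $W$, and satisfying: $c_0=1$, $c_n<c_{n+1}\le m c_n$ for $n\ge0$, $c_n=m^nL(m^n)$ with $L$ slowly varying at infinity, and $c_n=m^n$ whenever $\mathbf E Z_1\log Z_1<\infty$. The law of $W$ restricted to $(0,\infty)$ has a positive continuous density, denoted $w$. *)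

(* Defs.v *)
From HB Require Import structures.
From mathcomp Require Import all_boot all_order all_algebra.
From mathcomp Require Import all_classical all_reals all_analysis.
Set Implicit Arguments. Unset Strict Implicit. Unset Printing Implicit Defensive.
Import Order.TTheory GRing.Theory Num.Theory.
Import numFieldNormedType.Exports.
Local Open Scope classical_set_scope.
Local Open Scope ring_scope.

Fixpoint conv_pow {R : realType} (p : nat -> R) (i : nat) (j : nat) : R :=
  match i with
  | 0 => (j == 0)%:R
  | i'.+1 => \sum_(l < j.+1) p l * conv_pow p i' (j - l)
  end.

Definition offspring_law {R : realType} (p : nat -> R) : Prop :=
  (forall j, 0 <= p j) /\ series p @ \oo --> (1 : R).

Definition offspring_mean {R : realType} (p : nat -> R) (m : R) : Prop :=
  series (fun j => j%:R * p j) @ \oo --> m.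

Definition span_gcd {R : realType} (p : nat -> R) (d : nat) : Prop :=
  let cd e := forall j l, j <> l -> 0 < p j * p l -> (e %| (j - l)%N)%N in
  (1 <= d)%N /\ cd d /\ (forall e, cd e -> (e %| d)%N).

Definition min_support {R : realType} (p : nat -> R) (mu : nat) : Prop :=
  0 < p mu /\ (forall j, (j < mu)%N -> p j = 0).

(* Galton-Watson process with offspring law p and Z_0 = 1, given through its
   finite-dimensional laws (Markov chain with transition P(i,j) = p^{*i}_j). *)
Definition GW_process {R : realType} d (T : measurableType d)
  (P : probability T R) (p : nat -> R) (Z : nat -> T -> nat) : Prop :=
  (forall n k, measurable [set t | Z n t = k]) /\
  P [set t | Z 0%N t = 1%N] = 1%E /\
  (forall (n : nat) (x : nat -> nat),
     P [set t | forall i, (i <= n.+1)%N -> Z i t = x i] =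
     (P [set t | forall i, (i <= n)%N -> Z i t = x i] *
      (conv_pow p (x n) (x n.+1))%:E)%E).

Definition slowly_varying {R : realType} (L : R -> R) : Prop :=
  measurable_fun setT L /\
  (\forall x \near +oo, 0 < L x) /\
  (forall lam : R, 0 < lam -> (fun x => L (lam * x) / L x) @ +oo --> (1 : R)).

Definition is_first_exceed {R : realType} (c : nat -> R) (k : R) (a : nat) : Prop :=
  (1 <= a)%N /\ k <= c a /\ (forall l, (1 <= l)%N -> k <= c l -> (a <= l)%N).

Definition asymp_eq {R : realType} (x y : nat -> R) : Prop :=
  exists e : nat -> R, e @ \oo --> (0 : R) /\
    \forall n \near \oo, x n = y n * (1 + e n).

(* Main.v *)
Require Import Defs.
From HB Require Import structures.
From mathcomp Require Import all_boot all_order all_algebra.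
From mathcomp Require Import all_classical all_reals all_analysis.
From mathcomp Require Import measurable_realfun complex ring lra zify.

(** Let f be the offspring generating function, f_n its iterates, a = a_n (so that c_a is of the
    order of k = k_n) and r = n - a.  Splitting at generation r,
      P(Z_(r+a) = k) = sum_j P(Z_r = j) P_j(Z_a = k),
    where P_j refers to j initial individuals.  With g_r = prod_(1 <= i < r) f'(f_i(0)), the
    quotients P(Z_r = j) / g_r are nondecreasing in r, the sums sum_(j >= 1) P(Z_r = j) s^j / g_r
    are bounded in r for s < 1, and c_a P_j(Z_a = k) decays geometrically in j.  Hence
    c_a P(Z_(r+a) = k) / g_r differs by o(1), uniformly in a, k and r >= R, from its value at a
    fixed large R, for which the local limit theorem with one ancestor applies.  Letting a tend to
    infinity, the same comparison passes to the density w, so that no convolution power of w is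
    needed.  The distribution function is treated in the same way.

    Both the bound k P(Z_a = k) <= C for k <= c_a and the local limit theorem come from Fourier
    inversion of z f_a'(z) on the circle of radius rho = exp(- v / c_a): if the argument of z is of
    order 1 / c_b with b <= a, then |f_b(z)| <= s_0 < 1 and
      |f_a'(z)| <= f_b'(rho) f_(a-b)'(s_0) = O(c_b lambda^(a-b)),   lambda < 1,
    which is summable against the length 1 / c_b of that range of arguments.  It follows that
    k P(Z_a = k) rho^k is equicontinuous in k / c_a; averaging it over short windows and using
    Z_n / c_n -> W yields the local limit theorem without inverting the transform of W.  The
    estimates are made for truncated generating functions, which are polynomials, and the
    truncation is removed last. *)

Set Implicit Arguments. Unset Strict Implicit. Unset Printing Implicit Defensive.
Import Order.TTheory GRing.Theory Num.Theory.
Import numFieldNormedType.Exports.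
Local Open Scope classical_set_scope.
Local Open Scope ring_scope.

(* Needed because [lra] is slow in large contexts. *)
Ltac forget_after x :=
  lazymatch goal with h : _ |- _ =>
    tryif constr_eq h x then intros else (first [clear h | revert h]; forget_after x)
  end.

(** * Polynomials with nonnegative coefficients *)

(** The factor k in front of P(Z_a = k) is forced. On the arguments of order 1 / c_b, f_a itself
    approaches the extinction probability only at a rate lambda^(a-b), while the length 1 / c_b may
    be as large as m^(a-b) / c_a; the product is summable only if m lambda < 1, which need not hold.
    Differentiation brings in c_b, which cancels the length. The circle must lie inside the unit
    disc: f_a'(1) = m^a may exceed c_a by an unbounded factor when E Z_1 log Z_1 is infinite,
    whereas rho f_a'(rho) <= c_a / v always holds, and for k <= c_a the weight rho^k costs only e^v.
    For the same reason f' cannot be expanded at 1 with an error term; it is merely bounded below by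
    some M < m near 1, and the loss (m / M)^(a-b) must be absorbed by the contraction rate. Division
    by g_r rather than by a power of its limiting ratio makes the comparison of generations
    monotone, so that no rate of convergence is needed. *)

Definition nneg_poly {R : realFieldType} (P : {poly R}) := forall i, 0 <= P`_i.

(** Divided difference (P(x) - P(y)) / (x - y), written as a polynomial in x and y with nonnegative
    coefficients: it is monotone in both arguments and makes sense on the diagonal, where it is P'.
    Convexity is used through it, without calculus. *)
Definition chord {R : realFieldType} (P : {poly R}) (x y : R) : R :=
  \sum_(i < size P) P`_i * \sum_(j < i) x ^+ (i.-1 - j) * y ^+ j.

Section NonnegPoly.
Context {R : realFieldType}.
Implicit Types (P Q : {poly R}) (x y : R).

Lemma nneg_polyC c : 0 <= c -> nneg_poly (c%:P : {poly R}).
Proof. by move=> c0 i; rewrite coefC; case: ifP. Qed.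

Lemma nneg_polyX : nneg_poly ('X : {poly R}).
Proof. by move=> i; rewrite coefX ler0n. Qed.

Lemma nneg_polyM P Q : nneg_poly P -> nneg_poly Q -> nneg_poly (P * Q).
Proof.
move=> P0 Q0 i; rewrite coefM; apply: sumr_ge0 => j _; exact: mulr_ge0.
Qed.

Lemma nneg_poly_exp P n : nneg_poly P -> nneg_poly (P ^+ n).
Proof.
move=> P0; elim: n => [|n IH]; first by rewrite expr0; exact: (nneg_polyC ler01).
by rewrite exprS; exact: nneg_polyM.
Qed.

Lemma nneg_poly_comp P Q : nneg_poly P -> nneg_poly Q -> nneg_poly (P \Po Q).
Proof.
move=> P0 Q0 i; rewrite coef_comp_poly; apply: sumr_ge0 => j _.
by rewrite mulr_ge0 // nneg_poly_exp.
Qed.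

Lemma nneg_poly_deriv P : nneg_poly P -> nneg_poly P^`().
Proof. by move=> P0 i; rewrite coef_deriv mulrn_wge0. Qed.

Lemma nneg_horner P x : nneg_poly P -> 0 <= x -> 0 <= P.[x].
Proof.
move=> P0 x0; rewrite horner_coef; apply: sumr_ge0 => i _.
by rewrite mulr_ge0 ?exprn_ge0.
Qed.

Lemma nneg_horner_le P x y : nneg_poly P -> 0 <= x -> x <= y -> P.[x] <= P.[y].
Proof.
move=> P0 x0 xy; rewrite !horner_coef; apply: ler_sum => i _.
by rewrite ler_wpM2l // lerXn2r ?nnegrE // (le_trans x0).
Qed.

Lemma horner_chord P x y : P.[x] - P.[y] = (x - y) * chord P x y.
Proof.
rewrite !horner_coef -sumrB mulr_sumr; apply: eq_bigr => i _.
by rewrite -mulrBr subrXX mulrCA.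
Qed.

Lemma chord_ge0 P x y : nneg_poly P -> 0 <= x -> 0 <= y -> 0 <= chord P x y.
Proof.
move=> P0 x0 y0; apply: sumr_ge0 => i _; rewrite mulr_ge0 //.
by apply: sumr_ge0 => j _; rewrite mulr_ge0 ?exprn_ge0.
Qed.

Lemma chord_le P x y x' y' : nneg_poly P -> 0 <= x -> 0 <= y ->
  x <= x' -> y <= y' -> chord P x y <= chord P x' y'.
Proof.
move=> P0 x0 y0 xx' yy'; apply: ler_sum => i _; rewrite ler_wpM2l //.
have x'0 := le_trans x0 xx'; have y'0 := le_trans y0 yy'.
by apply: ler_sum => j _; rewrite ler_pM ?exprn_ge0 // lerXn2r ?nnegrE.
Qed.

Lemma horner_deriv_coef P x :
  P^`().[x] = \sum_(i < size P) P`_i * (i%:R * x ^+ i.-1).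
Proof.
rewrite -[in LHS](coefK P) poly_def (raddf_sum (@deriv R)) horner_sum.
apply: eq_bigr => i _ /=.
by rewrite derivZ hornerZ derivXn hornerMn hornerXn mulr_natl.
Qed.

Lemma chord_diag P x : chord P x x = P^`().[x].
Proof.
rewrite horner_deriv_coef; apply: eq_bigr => i _; congr (_ * _).
rewrite (eq_bigr (fun=> x ^+ i.-1)); last first.
  by move=> j _; rewrite -exprD subnK // -ltnS prednK // (leq_ltn_trans _ (ltn_ord j)).
by rewrite sumr_const card_ord mulr_natl.
Qed.

Lemma horner_sub_le P x y : nneg_poly P -> 0 <= y -> y <= x ->
  P.[x] - P.[y] <= (x - y) * P^`().[x].
Proof.
move=> P0 y0 yx; rewrite horner_chord -chord_diag ler_wpM2l ?subr_ge0 //.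
by apply: chord_le => //; exact: le_trans yx.
Qed.

Lemma horner_sub_ge P x y : nneg_poly P -> 0 <= y -> y <= x ->
  (x - y) * P^`().[y] <= P.[x] - P.[y].
Proof.
move=> P0 y0 yx; rewrite horner_chord -chord_diag ler_wpM2l ?subr_ge0 //.
by apply: chord_le => //; exact: le_trans yx.
Qed.

Lemma coef0_exp P i : (P ^+ i)`_0 = P`_0 ^+ i.
Proof. by rewrite -!horner_coef0 horner_exp. Qed.

(** One of the i factors supplies the exponent j > 0 and all others their constant term; these i
    choices are distinct contributions. *)
Lemma coef_exp_ge P i j : nneg_poly P -> (0 < j)%N ->
  (i%:R * P`_0 ^+ i.-1) * P`_j <= (P ^+ i)`_j.
Proof.
move=> P0 j0; elim: i => [|i IH]; first by rewrite !mul0r expr0; exact: nneg_polyC.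
rewrite exprS coefM (bigD1 ord0) //= subn0 (bigD1 ord_max) /=; last first.
  by rewrite -val_eqE /= -lt0n.
rewrite subnn coef0_exp addrA -[leLHS]addr0 lerD //; last first.
  by apply: sumr_ge0 => l _; rewrite mulr_ge0 // nneg_poly_exp.
apply: le_trans (lerD (ler_wpM2l (P0 0%N) IH) (lexx _)).
case: i {IH} => [|i] /=; first by rewrite ?mul0r ?mulr0 ?add0r ?expr0 ?mulr1 ?mul1r lexx.
rewrite -[i.+2%:R]natr1 exprS le_eqVlt; apply/orP; left; apply/eqP; ring.
Qed.

(** Coefficients of z (P^i)' = i (z P') P^(i-1). This transfers a bound on l P_l to the powers of
    P. *)
Lemma coef_exp_deriv P i k :
  k%:R * (P ^+ i)`_k =
  i%:R * \sum_(l < k.+1) (l%:R * P`_l) * (P ^+ i.-1)`_(k - l).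
Proof.
have coefXd (Q : {poly R}) n : ('X * Q^`())`_n = n%:R * Q`_n.
  by rewrite coefXM; case: n => [|n]; rewrite ?mul0r // coef_deriv mulr_natl.
rewrite -coefXd deriv_exp mulrnAr coefMn mulrA coefM mulr_natl.
by congr (_ *+ _); apply: eq_bigr => l _; rewrite coefXd.
Qed.

(** The factors of a product of degree at most k have degree at most k themselves, so only the
    truncation of P at degree k enters. *)
Lemma coef_exp_sum_le P i k : nneg_poly P ->
  \sum_(l < k.+1) (P ^+ i)`_l <= (\sum_(l < k.+1) P`_l) ^+ i.
Proof.
move=> P0; elim: i => [|i IH].
  rewrite !expr0 big_ord_recl coefC eqxx /= big1 ?addr0 // => l _.
  by rewrite coefC.
rewrite !exprS; apply: (@le_trans _ _
    ((\sum_(l < k.+1) P`_l) * (\sum_(l < k.+1) (P ^+ i)`_l))); last first.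
  by rewrite ler_wpM2l // sumr_ge0.
have Pi0 := nneg_poly_exp i P0.
rewrite mulr_suml (eq_bigr (fun l : 'I_k.+1 =>
    \sum_(j < k.+1 | (j <= l)%N) P`_j * (P ^+ i)`_(l - j))); last first.
  move=> l _; rewrite coefM (big_ord_widen k.+1 (fun j => P`_j * (P ^+ i)`_(l - j))) //.
rewrite (exchange_big_dep xpredT) //=; apply: ler_sum => j _.
rewrite -mulr_sumr ler_wpM2l //.
rewrite -(big_mkord (fun l => (j <= l)%N) (fun l => (P ^+ i)`_(l - j))).
rewrite -(big_mkord xpredT (fun l => (P ^+ i)`_l)).
rewrite (big_cat_nat (n := j)) //=; last exact: ltnW.
rewrite big1_seq ?add0r; last first.
  by move=> l /andP[jl]; rewrite mem_index_iota => /andP[_]; rewrite ltnNge jl.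
rewrite big_nat_cond (eq_bigl (fun l => (j <= l < k.+1)%N)); last first.
  by move=> l; rewrite andbAC andbb.
rewrite -big_nat -{1}[j : nat]add0n big_addn.
rewrite (eq_bigr (fun l => (P ^+ i)`_l)); last by move=> l _; rewrite addnK.
rewrite [leRHS](big_cat_nat (n := (k.+1 - j)%N)) //=; last exact: leq_subr.
by rewrite lerDl sumr_ge0.
Qed.
End NonnegPoly.

(** * Fourier inversion on a circle *)

Section Trig.
Context {R : realType}.
Implicit Types (t x y r : R).
Local Notation normc := (@ComplexField.Normc.normc R).

Lemma sin_le_id x : 0 <= x -> sin x <= x.
Proof.
rewrite le_eqVlt => /predU1P[<-|x0]; first by rewrite sin0.
have [z _] := @MVT R (@sin R) (@cos R) 0 x x0 (fun y _ => is_derive_sin y)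
  (continuous_subspaceT (@continuous_sin R)).
rewrite sin0 !subr0 => ->.
by rewrite ler_piMl ?cos_le1 // ltW.
Qed.

Lemma sqr_sin_le x : sin x ^+ 2 <= x ^+ 2.
Proof.
wlog x0 : x / 0 <= x.
  move=> H; have [/H//|/ltW x0] := leP 0 x.
  by rewrite -[leLHS]sqrrN -sinN -[leRHS]sqrrN H // oppr_ge0.
have [x1|x1] := leP x 1; last first.
  apply: (@le_trans _ _ 1); last by rewrite expr_ge1 // ltW.
  by rewrite sin2cos2 gerBl sqr_ge0.
rewrite lerXn2r ?nnegrE ?sin_le_id //; apply: sin_ge0_pi.
by rewrite x0 (le_trans x1) // (le_trans _ (@pi_ge2 R)) // ler1n.
Qed.

Lemma cos_sin_half x : cos x = 1 - 2 * sin (x / 2) ^+ 2.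
Proof.
rewrite {1}(splitr x) cosD -!expr2 cos2sin2; ring.
Qed.

(** max(0, cos x) <= (1 + cos x) / 2 = 1 - sin(x/2)^2. Giving up a factor 2 against 1 - cos x makes
    the bound uniform in the radius, also where cos x < 0 and a small r raises the left-hand
    side. *)
Lemma exp_mul_cos_le r n x : 0 <= r <= 1 -> r ^+ n * cos x <= 1 - sin (x / 2) ^+ 2.
Proof.
move=> /andP[r0 r1]; have rn0 : 0 <= r ^+ n by rewrite exprn_ge0.
have rn1 : r ^+ n <= 1 by rewrite exprn_ile1.
have s0 := sqr_ge0 (sin (x / 2)).
have s1 : sin (x / 2) ^+ 2 <= 1 by rewrite sin2cos2 gerBl sqr_ge0.
rewrite cos_sin_half; nra.
Qed.

Lemma dirichlet_kernel (M : nat) x :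
  sin (x / 2) * (1 + 2 * \sum_(i < M) cos (i.+1%:R * x)) = sin (x * (M.*2.+1)%:R / 2).
Proof.
elim: M => [|M IH]; first by rewrite big_ord0 mulr0 addr0 !mulr1.
have -> : x * (M.+1.*2.+1)%:R / 2 = M.+1%:R * x + x / 2.
  by rewrite doubleS -!natr1 -mul2n natrM; field.
have E : x * (M.*2.+1)%:R / 2 = M.+1%:R * x - x / 2.
  by rewrite -!natr1 -mul2n natrM; field.
rewrite E in IH.
rewrite big_ord_recr /= sinD; rewrite sinB in IH; lra.
Qed.

(** With N = M.*2.+1 the right-hand side of [dirichlet_kernel] is sin (pi e) = 0, whereas sin (x /
    2) is nonzero because 0 < e < N. *)
Lemma dirichlet_kernel_eq0 (M e : nat) : (0 < e < M.*2.+1)%N ->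
  1 + 2 * \sum_(i < M) cos (i.+1%:R * (2 * pi * e%:R / (M.*2.+1)%:R)) = 0 :> R.
Proof.
move=> /andP[e0 eN]; set x := 2 * pi * _ / _.
have N0 : 0 < (M.*2.+1)%:R :> R by rewrite ltr0n.
have sx : sin (x / 2) != 0.
  have -> : x / 2 = pi * (e%:R / (M.*2.+1)%:R).
    by rewrite /x -[_ / _ / 2]mulrAC; field; rewrite lt0r_neq0.
  rewrite lt0r_neq0 //; apply: sin_gt0_pi; rewrite mulr_gt0 ?pi_gt0 ?divr_gt0 ?ltr0n //=.
  by rewrite gtr_pMr ?pi_gt0 // ltr_pdivrMr // mul1r ltr_nat.
apply: (mulfI sx); rewrite mulr0 dirichlet_kernel /x.
have -> : 2 * pi * e%:R / (M.*2.+1)%:R * (M.*2.+1)%:R / 2 = pi * e%:R :> R.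
  by field; rewrite lt0r_neq0.
rewrite mulr_natr.
have [H _] : sin (pi *+ e : R) = 0 /\ True.
  split=> //; elim: (e) => [|j IH]; first by rewrite mulr0n sin0.
  by rewrite mulrS addrC sinDpi IH oppr0.
exact: H.
Qed.

Lemma sum_indicator_le (M : nat) (Y : R) : 0 <= Y ->
  \sum_(i < M) (i.+1%:R <= Y)%R%:R <= Y.
Proof.
move=> Y0; elim: M => [|M IH]; first by rewrite big_ord0.
rewrite big_ord_recr /=; case: (boolP (M.+1%:R <= Y)) => H; rewrite ?addr0 //.
apply: le_trans H; rewrite -[leRHS]natr1 lerD2r.
rewrite -[M in leRHS]card_ord -sumr_const; apply: ler_sum => i _.
by case: (_ <= Y); rewrite ?ler01 ?lexx.
Qed.

Definition cosum (a : nat -> R) n t := \sum_(k < n) a k * cos (t * k%:R).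
Definition sisum (a : nat -> R) n t := \sum_(k < n) a k * sin (t * k%:R).

Lemma cosum_shift (a : nat -> R) n t s :
  \sum_(k < n) a k * cos (t * (k%:R - s)) =
  cos (t * s) * cosum a n t + sin (t * s) * sisum a n t.
Proof.
rewrite !mulr_sumr -big_split; apply: eq_bigr => k _ /=.
by rewrite mulrBr cosB; ring.
Qed.

Lemma cauchy_schwarz2 (a b x y : R) :
  `|a * x + b * y| <= Num.sqrt (a ^+ 2 + b ^+ 2) * Num.sqrt (x ^+ 2 + y ^+ 2).
Proof.
rewrite -sqrtrM ?addr_ge0 ?sqr_ge0 // -sqrtr_sqr ler_wsqrtr //.
have := sqr_ge0 (a * y - b * x); nra.
Qed.

Lemma cosum_shift_le (a : nat -> R) n t s :
  `|\sum_(k < n) a k * cos (t * (k%:R - s))| <=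
  Num.sqrt (cosum a n t ^+ 2 + sisum a n t ^+ 2).
Proof.
rewrite cosum_shift (le_trans (cauchy_schwarz2 _ _ _ _)) //.
by rewrite cos2Dsin2 sqrtr1 mul1r.
Qed.

(** The shift from s to s' is a rotation by the angle t (s - s'), along a chord of length 2 |sin (t
    (s - s') / 2)|. The bound |t| |s - s'| serves small t, the bound 2 the rest. *)
Lemma cosum_shift_sub_le (a : nat -> R) n t s s' :
  `|\sum_(k < n) a k * cos (t * (k%:R - s)) - \sum_(k < n) a k * cos (t * (k%:R - s'))| <=
  Num.min 2 (`|t| * `|s - s'|) * Num.sqrt (cosum a n t ^+ 2 + sisum a n t ^+ 2).
Proof.
rewrite !cosum_shift.
have -> : forall X Y, cos (t * s) * X + sin (t * s) * Y -
   (cos (t * s') * X + sin (t * s') * Y) =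
   (cos (t * s) - cos (t * s')) * X + (sin (t * s) - sin (t * s')) * Y by move=> X Y; ring.
apply: le_trans (cauchy_schwarz2 _ _ _ _) _.
rewrite ler_wpM2r ?sqrtr_ge0 //.
have -> : (cos (t * s) - cos (t * s')) ^+ 2 + (sin (t * s) - sin (t * s')) ^+ 2
   = 4 * sin (t * (s - s') / 2) ^+ 2.
  have -> : 4 * sin (t * (s - s') / 2) ^+ 2 = 2 - 2 * cos (t * (s - s')).
    by rewrite [in RHS]cos_sin_half; ring.
  by rewrite mulrBr cosB !sqrrB; have := cos2Dsin2 (t * s); have := cos2Dsin2 (t * s'); lra.
rewrite le_min; apply/andP; split.
  rewrite -[leRHS]ger0_norm // -sqrtr_sqr ler_wsqrtr //.
  by rewrite sin2cos2; have := sqr_ge0 (cos (t * (s - s') / 2)); lra.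
rewrite -normrM -sqrtr_sqr ler_wsqrtr //.
by have := sqr_sin_le (t * (s - s') / 2); rewrite expr_div_n; lra.
Qed.
End Trig.

(** * Evaluation of real polynomials on a circle and discrete Fourier inversion *)

Section ComplexEval.
Context {R : realType}.
Implicit Types (t x y r : R) (P : {poly R}).
Local Notation normc := (@ComplexField.Normc.normc R).

Definition cis t : R[i] := Complex (cos t) (sin t).

Definition ceval P (z : R[i]) : R[i] := (map_poly (real_complex R) P).[z].

Definition polar r t : R[i] := (r%:C)%C * cis t.

Lemma cis_exp t n : cis t ^+ n = cis (t * n%:R).
Proof.
elim: n => [|n IH]; first by rewrite mulr0 /cis cos0 sin0.
rewrite exprS IH -natr1 mulrDr mulr1 [t * _ + t]addrC /cis cosD sinD.
by congr Complex; rewrite addrC.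
Qed.

Lemma normc_realM (a : R) z : 0 <= a -> normc (a%:C%C * z) = a * normc z.
Proof.
move=> a0; rewrite ComplexField.Normc.normcM; congr (_ * _) => /=.
by rewrite expr0n addr0 sqrtr_sqr ger0_norm.
Qed.

Lemma normc_ge0 z : 0 <= normc z.
Proof. by case: z => a b; exact: sqrtr_ge0. Qed.

Lemma normc_polar r t : 0 <= r -> normc (polar r t) = r.
Proof. by move=> r0; rewrite normc_realM //= cos2Dsin2 sqrtr1 mulr1. Qed.

Lemma normc_exp z n : normc (z ^+ n) = normc z ^+ n.
Proof.
elim: n => [|n IH]; first by rewrite !expr0 ComplexField.Normc.normc1.
by rewrite !exprS ComplexField.Normc.normcM IH.
Qed.

Lemma normc_sum (I : Type) (s : seq I) (F : I -> R[i]) :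
  normc (\sum_(i <- s) F i) <= \sum_(i <- s) normc (F i).
Proof.
elim/big_rec2: _ => [|i y x _ IH]; first by rewrite ComplexField.Normc.normc0.
by rewrite (le_trans (le_normcD _ _)) // lerD2l.
Qed.

Lemma ceval_coef P z : ceval P z = \sum_(i < size P) (P`_i)%:C%C * z ^+ i.
Proof.
rewrite /ceval horner_coef size_map_poly; apply: eq_bigr => i _.
by rewrite coef_map.
Qed.

Lemma normc_ceval_le P z : nneg_poly P -> normc (ceval P z) <= P.[normc z].
Proof.
move=> P0; rewrite ceval_coef (le_trans (normc_sum _ _)) // horner_coef.
by apply: ler_sum => i _; rewrite normc_realM // normc_exp.
Qed.

Lemma ceval_comp P Q z : ceval (P \Po Q) z = ceval P (ceval Q z).
Proof. by rewrite /ceval map_comp_poly horner_comp. Qed.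

Lemma cevalM P Q z : ceval (P * Q) z = ceval P z * ceval Q z.
Proof. by rewrite /ceval rmorphM hornerM. Qed.

Lemma ceval_polar P r t : ceval P (polar r t) =
  Complex (cosum (fun k => P`_k * r ^+ k) (size P) t)
          (sisum (fun k => P`_k * r ^+ k) (size P) t).
Proof.
rewrite ceval_coef /cosum /sisum.
have -> : \sum_(i < size P) (P`_i)%:C%C * polar r t ^+ i =
  \sum_(i < size P) Complex (P`_i * r ^+ i * cos (t * i%:R)) (P`_i * r ^+ i * sin (t * i%:R)).
  apply: eq_bigr => i _; rewrite /polar exprMn cis_exp -rmorphXn mulrA -rmorphM /cis.
  by apply/eqP; rewrite eq_complex /= !mul0r subr0 addr0 !eqxx.
elim/big_rec3: _ => // i x y z _ ->.
by apply/eqP; rewrite eq_complex /= !eqxx.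
Qed.

(** |P(z)|^2 is the double sum of P_j P_k r^(j+k) cos((j - k) t), and [exp_mul_cos_le] applies to
    each term. The loss against P(1)^2 is what later detects the span d and the spread of Z_b. *)
Lemma normc_ceval_sqr_le P r t : nneg_poly P -> 0 <= r <= 1 ->
  normc (ceval P (polar r t)) ^+ 2 <=
  P.[1] ^+ 2 - \sum_(j < size P) \sum_(k < size P)
     P`_j * P`_k * sin ((j%:R - k%:R) * (t / 2)) ^+ 2.
Proof.
move=> P0 r01; rewrite ceval_polar /= sqr_sqrtr ?addr_ge0 ?sqr_ge0 //.
have -> : P.[1] = \sum_(j < size P) P`_j.
  by rewrite horner_coef; apply: eq_bigr => i _; rewrite expr1n mulr1.
rewrite !expr2 !mulr_suml -big_split -sumrB; apply: ler_sum => j _ /=.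
rewrite !mulr_sumr -big_split -sumrB; apply: ler_sum => k _ /=.
have := @exp_mul_cos_le R r (j + k) (t * (j%:R - k%:R)) r01.
rewrite mulrBr cosB exprD -mulrBr [t * (_ - _) / 2]mulrAC [t / 2 * _]mulrC => H.
have := ler_wpM2l (mulr_ge0 (P0 j) (P0 k)) H.
by rewrite mulrBr mulr1 => /(le_trans _); apply; rewrite le_eqVlt; apply/orP; left; apply/eqP; ring.
Qed.

(* The real part of [cis (- (t * l)) * z * P^`().[z]] at [z = polar r t]. *)
Definition shifted_cosum P r l t :=
  \sum_(k < size P) (k%:R * P`_k * r ^+ k) * cos (t * (k%:R - l%:R)).

Lemma normc_Xderiv P r t : 0 <= r ->
  Num.sqrt (cosum (fun k => k%:R * P`_k * r ^+ k) (size P) t ^+ 2 +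
            sisum (fun k => k%:R * P`_k * r ^+ k) (size P) t ^+ 2) =
  r * normc (ceval P^`() (polar r t)).
Proof.
move=> r0.
have coefXd n : ('X * P^`())`_n = n%:R * P`_n.
  by rewrite coefXM; case: n => [|n]; rewrite ?mul0r // coef_deriv mulr_natl.
have E : ceval ('X * P^`())%R (polar r t) =
    Complex (cosum (fun k => k%:R * P`_k * r ^+ k) (size P) t)
            (sisum (fun k => k%:R * P`_k * r ^+ k) (size P) t).
  rewrite ceval_polar.
  have sz : (size ('X * P^`())%R <= size P)%N.
    apply/leq_sizeP => j Pj; rewrite coefXd nth_default ?mulr0 //.
  congr Complex; rewrite /cosum /sisum.
    rewrite (big_ord_widen _ (fun k => ('X * P^`())`_k * r ^+ k * cos (t * k%:R)) sz) big_mkcond.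
    apply: eq_bigr => k _; case: ltnP => H; first by rewrite coefXd.
    by rewrite -coefXd nth_default // !mul0r.
  rewrite (big_ord_widen _ (fun k => ('X * P^`())`_k * r ^+ k * sin (t * k%:R)) sz) big_mkcond.
  apply: eq_bigr => k _; case: ltnP => H; first by rewrite coefXd.
  by rewrite -coefXd nth_default // !mul0r.
have <- : normc (ceval ('X * P^`())%R (polar r t)) = r * normc (ceval P^`() (polar r t)).
  rewrite cevalM ComplexField.Normc.normcM; congr (_ * _).
  by rewrite /ceval map_polyX hornerX normc_polar.
by rewrite E.
Qed.

Lemma shifted_cosum_le P r l t : 0 <= r ->
  `|shifted_cosum P r l t| <= r * normc (ceval P^`() (polar r t)).
Proof.
move=> r0; rewrite -normc_Xderiv //.
exact: (@cosum_shift_le _ (fun k => k%:R * P`_k * r ^+ k)).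
Qed.

Lemma shifted_cosum_sub_le P r l l' t : 0 <= r ->
  `|shifted_cosum P r l t - shifted_cosum P r l' t| <=
  Num.min 2 (`|t| * `|l%:R - l'%:R|) * (r * normc (ceval P^`() (polar r t))).
Proof.
move=> r0; rewrite -normc_Xderiv //.
exact: (@cosum_shift_sub_le _ (fun k => k%:R * P`_k * r ^+ k)).
Qed.

(* Discrete Fourier inversion: it is exact because more than [size P] points are sampled, and
   conjugate points are merged, so that only arguments in (0, pi / d] occur. *)
Lemma coef_fourier P r (d mu l M : nat) : (0 < d)%N ->
  (forall k, P`_k != 0 -> k = mu %[mod d]) -> l = mu %[mod d] ->
  (size P <= M.*2.+1)%N -> (l < M.*2.+1)%N ->
  (M.*2.+1)%:R * (l%:R * P`_l * r ^+ l) =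
  shifted_cosum P r l 0 +
  2 * \sum_(i < M) shifted_cosum P r l (2 * pi * i.+1%:R / (d%:R * (M.*2.+1)%:R)).
Proof.
move=> d0 Pmu lmu sP lM; set N := M.*2.+1.
have -> : shifted_cosum P r l 0 + 2 * \sum_(i < M)
      shifted_cosum P r l (2 * pi * i.+1%:R / (d%:R * N%:R)) =
  \sum_(k < size P) (k%:R * P`_k * r ^+ k) * (1 + 2 * \sum_(i < M)
     cos ((2 * pi * i.+1%:R / (d%:R * N%:R)) * (k%:R - l%:R))).
  rewrite exchange_big mulr_sumr -big_split; apply: eq_bigr => k _ /=.
  by rewrite mul0r cos0 mulrDr !mulr1 -mulr_sumr; ring.
have K k : (k < N)%N -> k != l -> P`_k != 0 ->
   1 + 2 * \sum_(i < M) cos ((2 * pi * i.+1%:R / (d%:R * N%:R)) * (k%:R - l%:R)) = 0 :> R.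
  move=> kN kl /Pmu kmu.
  (* Truncated subtraction: one of the summands is 0 and the other is |k - l|. *)
  pose e := (((k - l) + (l - k)) %/ d)%N.
  have dv : (d %| (k - l) + (l - k))%N.
    have [kl'|lk'] := leqP k l.
      by rewrite (eqP kl') add0n -eqn_mod_dvd // lmu kmu.
    rewrite [(l - k)%N](eqP (ltnW lk')) addn0 -eqn_mod_dvd ?(ltnW lk') //.
    by rewrite lmu kmu.
  have eE : (e * d = (k - l) + (l - k))%N by rewrite /e divnK.
  have aE : `|k%:R - l%:R| = e%:R * d%:R :> R.
    rewrite -natrM eE; have [kl'|lk'] := leqP k l.
      rewrite (eqP kl') add0n natrB // distrC ger0_norm // subr_ge0 ler_nat //.
    by rewrite [(l - k)%N](eqP (ltnW lk')) addn0 natrB ?(ltnW lk') // ger0_norm // subr_ge0 ler_nat ltnW.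
  have e0 : (0 < e)%N.
    rewrite lt0n; apply/eqP => e0; move: eE; rewrite e0 mul0n => /esym/eqP.
    rewrite addn_eq0 !subn_eq0 -eqn_leq; exact/negP.
  have eN : (e < N)%N.
    apply: (@leq_ltn_trans (e * d)%N); first exact: leq_pmulr.
    by rewrite eE; lia.
  have eM : (0 < e < M.*2.+1)%N by rewrite e0.
  apply: (etrans _ (@dirichlet_kernel_eq0 R M e eM)).
  congr (1 + 2 * _); apply: eq_bigr => i _.
  rewrite -[LHS]cos_norm normrM aE ger0_norm ?divr_ge0 ?mulr_ge0 ?pi_ge0 ?ler0n //.
  congr cos; rewrite /N; field.
  by rewrite nat1r !pnatr_eq0 /= -lt0n.
have [lP|Pl] := ltnP l (size P); last first.
  rewrite [P`_l]nth_default // mulr0 mul0r mulr0 big1 // => k _.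
  have [->|Pk] := eqVneq P`_k 0; first by rewrite mulr0 !mul0r.
  rewrite (K k) ?mulr0 // ?(leq_trans (ltn_ord k)) //.
  by rewrite neq_ltn (leq_trans (ltn_ord k) Pl).
rewrite (bigD1 (Ordinal lP)) //= [X in _ + X]big1 ?addr0; last first.
  move=> k kl. have [->|Pk] := eqVneq P`_k 0; first by rewrite mulr0 !mul0r.
  by rewrite (K k) ?mulr0 // (leq_trans (ltn_ord k)).
rewrite subrr mulrC; congr (_ * _).
rewrite (eq_bigr (fun=> 1)); last by move=> i _; rewrite mulr0 cos0.
by rewrite sumr_const card_ord /N -mul2n -natr1 natrM addrC.
Qed.

(** The sample points are multiples of a step 1 / c, so at most c X_b of them are at most X_b. A
    Riemann sum is thus bounded by the integral of a decreasing step function, without error term,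
    whatever M is. *)
Lemma sum_steps_le (phi : R -> R) (d M n : nat) (m X : nat -> R) :
  (0 < d)%N -> (forall b, 0 <= m b) -> (forall b, 0 <= X b) ->
  (forall t, 0 < t -> t <= pi / d%:R -> phi t <= \sum_(b < n) m b * (t <= X b)%R%:R) ->
  \sum_(i < M) phi (2 * pi * i.+1%:R / (d%:R * (M.*2.+1)%:R)) <=
  (d%:R * (M.*2.+1)%:R) / (2 * pi) * \sum_(b < n) m b * X b.
Proof.
move=> d0 m0 X0 H.
have d0' : 0 < d%:R :> R by rewrite ltr0n.
have N0 : 0 < (M.*2.+1)%:R :> R by rewrite ltr0n.
have p0 := @pi_gt0 R.
set c := (d%:R * (M.*2.+1)%:R) / (2 * pi).
have c0 : 0 < c by rewrite divr_gt0 ?mulr_gt0.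
have aux1 (p D N x : R) : 0 < p -> 0 < D -> 0 < N ->
    2 * p * x / (D * N) = x / (D * N / (2 * p)).
  by move=> p_0 D_0 N_0; field; rewrite !lt0r_neq0.
have aux2 (p D N : R) : 0 < p -> 0 < D -> p / D * (D * N / (2 * p)) = N / 2.
  by move=> p_0 D_0; field; rewrite !lt0r_neq0.
have tE i : 2 * pi * i.+1%:R / (d%:R * (M.*2.+1)%:R) = i.+1%:R / c.
  exact: aux1.
apply: (@le_trans _ _ (\sum_(i < M) \sum_(b < n) m b * (i.+1%:R <= c * X b)%R%:R)).
  apply: ler_sum => i _; rewrite tE.
  apply: le_trans (H _ _ _) _.
  - by rewrite divr_gt0.
  - rewrite ler_pdivrMr // /c.
    have -> : pi / d%:R * (d%:R * (M.*2.+1)%:R / (2 * pi)) = (M.*2.+1)%:R / 2 :> R.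
      exact: aux2.
    rewrite ler_pdivlMr // -natrM ler_nat; have := ltn_ord i; lia.
  - by apply: ler_sum => b _; rewrite ler_pdivrMr // [X b * c]mulrC.
rewrite exchange_big mulr_sumr; apply: ler_sum => b _ /=.
rewrite -mulr_sumr [leRHS]mulrCA ler_wpM2l //.
by apply: sum_indicator_le; rewrite mulr_ge0 // ltW.
Qed.
End ComplexEval.

(** * Truncated generating functions and their iterates *)

Section RealSequences.
Context {R : realType}.
Implicit Types (u v : nat -> R) (l e : R).

Lemma cvgn_distP u l : u @ \oo --> l <->
  (forall e, 0 < e -> exists N, forall n, (N <= n)%N -> `|u n - l| < e).
Proof.
split=> [/cvgrPdist_lt ul e e0|H].
  by have [N _ HN] := ul e e0; exists N => n nN; rewrite distrC; exact: HN.
apply/cvgrPdist_lt => e /H[N HN]; exists N => // n nN.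
by rewrite distrC; exact: HN.
Qed.

Lemma cvgn_le u v l l' : u @ \oo --> l -> v @ \oo --> l' ->
  (exists N, forall n, (N <= n)%N -> u n <= v n) -> l <= l'.
Proof. by move=> ul vl [N HN]; apply: (ler_cvg_to ul vl); exists N. Qed.

Lemma cvgn_le_cst u l x : u @ \oo --> l ->
  (exists N, forall n, (N <= n)%N -> u n <= x) -> l <= x.
Proof. by move=> ul; apply: cvgn_le ul _; exact: cvg_cst. Qed.

Lemma cvgn_ge_cst u l x : u @ \oo --> l ->
  (exists N, forall n, (N <= n)%N -> x <= u n) -> x <= l.
Proof. by move=> ul; apply: cvgn_le ul; exact: cvg_cst. Qed.

Lemma cvgn_sum (I : Type) (s : seq I) (u : I -> nat -> R) (l : I -> R) :
  (forall i, u i @ \oo --> l i) ->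
  (fun n => \sum_(i <- s) u i n) @ \oo --> \sum_(i <- s) l i.
Proof.
move=> ul; elim: s => [|i s IH].
  rewrite big_nil (_ : (fun n => _) = fun=> 0) //; first exact: cvg_cst.
  by apply/funext => n; rewrite big_nil.
rewrite big_cons (_ : (fun n => _) = (fun n => u i n + \sum_(j <- s) u j n)).
  exact: cvgD (ul i) IH.
by apply/funext => n; rewrite big_cons.
Qed.

Lemma monotone_bounded_cvg u b : (forall n n', (n <= n')%N -> u n <= u n') ->
  (forall n, u n <= b) -> exists l, u @ \oo --> l.
Proof.
move=> mono bnd; have /cvg_ex[l ul] : cvgn u.
  apply: nondecreasing_is_cvgn => [//|].
  by exists b => _ [n _ <-].
by exists l.
Qed.

Lemma sum_geometric_le (rho : R) n : 0 <= rho < 1 ->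
  \sum_(i < n) rho ^+ i <= (1 - rho)^-1.
Proof.
move=> /andP[r0 r1]; have d0 : 0 < 1 - rho by rewrite subr_gt0.
rewrite -(@ler_pM2l _ (1 - rho)) // mulfV ?lt0r_neq0 //.
have -> : (1 - rho) * \sum_(i < n) rho ^+ i = 1 - rho ^+ n.
  have := subrXX 1 rho n; rewrite expr1n => ->; congr (_ * _).
  by apply: eq_bigr => i _; rewrite expr1n mul1r.
by rewrite gerBl exprn_ge0.
Qed.
End RealSequences.

Section TruncatedIterates.
Context {R : realType}.
Variable p : nat -> R.
Hypothesis pl : offspring_law p.
Implicit Types (K n r : nat) (x y s : R).

Definition trunc_gf K : {poly R} := \poly_(j < K) p j.

(** New generations are composed on the inside, so that the coefficients obey the same recursion as
    the law under one Markov step; [iter_gfSl] gives the decomposition at the first generation. *)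
Definition iter_gf K n : {poly R} := iter n (fun Q => Q \Po trunc_gf K) 'X.
Arguments iter_gf : simpl never.

Let p0 j : 0 <= p j. Proof. by case: pl. Qed.

Lemma iter_gfS K n : iter_gf K n.+1 = iter_gf K n \Po trunc_gf K.
Proof. by []. Qed.

Lemma iter_gfD K a b : iter_gf K (a + b) = iter_gf K a \Po iter_gf K b.
Proof.
elim: b => [|b IH]; first by rewrite addn0 comp_polyXr.
by rewrite addnS !iter_gfS IH comp_polyA.
Qed.

Lemma iter_gf1 K : iter_gf K 1 = trunc_gf K.
Proof. by rewrite iter_gfS comp_polyX. Qed.

Lemma iter_gfSl K n : iter_gf K n.+1 = trunc_gf K \Po iter_gf K n.
Proof. by rewrite -add1n iter_gfD iter_gf1. Qed.

Lemma nneg_trunc_gf K : nneg_poly (trunc_gf K).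
Proof. by move=> i; rewrite coef_poly; case: ifP. Qed.
#[local] Hint Resolve nneg_trunc_gf : core.

Lemma nneg_iter_gf K n : nneg_poly (iter_gf K n).
Proof.
elim: n => [|n IH]; first exact: nneg_polyX.
by rewrite iter_gfS; apply: nneg_poly_comp.
Qed.
#[local] Hint Resolve nneg_iter_gf : core.

Lemma sum_offspring_le1 K : \sum_(j < K) p j <= 1.
Proof.
case: pl => _ cv; rewrite -(big_mkord xpredT p) -/(series p K) -(cvg_lim _ cv) //.
apply: nondecreasing_cvgn_le; last by apply/cvg_ex; exists 1.
by apply/nondecreasing_seqP => n; rewrite /series /= big_nat_recr //= lerDl.
Qed.

Lemma trunc_gf_horner K x : (trunc_gf K).[x] = \sum_(j < K) p j * x ^+ j.
Proof. by rewrite horner_poly. Qed.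

Lemma trunc_gf_deriv K x : (trunc_gf K)^`().[x] = \sum_(j < K) p j * (x ^+ j.-1 *+ j).
Proof.
rewrite /trunc_gf poly_def (raddf_sum (@deriv R)) horner_sum; apply: eq_bigr => i _ /=.
by rewrite derivZ hornerZ derivXn hornerMn hornerXn.
Qed.

Lemma trunc_gf_le1 K x : 0 <= x <= 1 -> (trunc_gf K).[x] <= 1.
Proof.
move=> /andP[x0 x1]; rewrite trunc_gf_horner (le_trans _ (sum_offspring_le1 K)) //.
by apply: ler_sum => j _; rewrite ler_piMr // exprn_ile1.
Qed.

Lemma trunc_gf_mono K K' x : (K <= K')%N -> 0 <= x ->
  (trunc_gf K).[x] <= (trunc_gf K').[x].
Proof.
move=> KK' x0; rewrite !trunc_gf_horner (big_ord_widen K' (fun j => p j * x ^+ j) KK').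
rewrite big_mkcond; apply: ler_sum => j _; case: ifP => // _.
by rewrite mulr_ge0 ?exprn_ge0.
Qed.

Lemma trunc_gf_deriv_mono K K' x : (K <= K')%N -> 0 <= x ->
  (trunc_gf K)^`().[x] <= (trunc_gf K')^`().[x].
Proof.
move=> KK' x0; rewrite !trunc_gf_deriv.
rewrite (big_ord_widen K' (fun j => p j * (x ^+ j.-1 *+ j)) KK').
rewrite big_mkcond; apply: ler_sum => j _; case: ifP => // _.
by rewrite mulr_ge0 ?mulrn_wge0 ?exprn_ge0.
Qed.

Lemma iter_gf_ge0 K n x : 0 <= x -> 0 <= (iter_gf K n).[x].
Proof. exact: nneg_horner. Qed.

Lemma iter_gf_le1 K n x : 0 <= x <= 1 -> (iter_gf K n).[x] <= 1.
Proof.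
move=> /andP[x0 x1]; elim: n => [|n IH]; first by rewrite hornerX.
by rewrite iter_gfSl horner_comp trunc_gf_le1 // IH iter_gf_ge0.
Qed.

Lemma iter_gf_mono K K' n x : (K <= K')%N -> 0 <= x ->
  (iter_gf K n).[x] <= (iter_gf K' n).[x].
Proof.
move=> KK' x0; elim: n => [|n IH]; first by rewrite !hornerX.
rewrite !iter_gfSl !horner_comp (le_trans (trunc_gf_mono KK' _)) ?iter_gf_ge0 //.
by apply: nneg_horner_le => //; exact: iter_gf_ge0.
Qed.

Lemma iter_gf_deriv K n x :
  (iter_gf K n)^`().[x] = \prod_(i < n) (trunc_gf K)^`().[(iter_gf K i).[x]].
Proof.
elim: n => [|n IH]; first by rewrite big_ord0 derivX hornerC.
by rewrite big_ord_recr /= -IH iter_gfSl deriv_comp hornerM horner_comp mulrC.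
Qed.

(** A partial sum of the mean already exceeds M; the derivative of that fixed polynomial still
    exceeds M slightly to the left of 1, and a larger K only adds nonnegative terms. *)
Lemma deriv_trunc_gf_near1 m M s0 : offspring_mean p m -> M < m -> s0 < 1 ->
  exists s, [/\ s0 < s, 0 < s, s < 1 & exists K0, forall K, (K0 <= K)%N ->
    M < (trunc_gf K)^`().[s]].
Proof.
move=> pm Mm s01.
have [J HJ] : exists J, M < \sum_(j < J) j%:R * p j.
  have : \forall n \near \oo, M < series (fun j => j%:R * p j) n.
    exact: (cvgr_gt _ pm).
  by case=> J _ /(_ J (leqnn _)); rewrite /series /= big_mkord => ?; exists J.
set P := trunc_gf J.
have P1 : P^`().[1] = \sum_(j < J) j%:R * p j.
  rewrite trunc_gf_deriv; apply: eq_bigr => i _.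
  by rewrite expr1n mulrC.
have PP0 : 0 <= P^`()^`().[1].
  exact: nneg_horner (nneg_poly_deriv (nneg_poly_deriv (nneg_trunc_gf J))) ler01.
pose e := (P^`().[1] - M) / (P^`()^`().[1] + 1).
have e0 : 0 < e.
  by rewrite divr_gt0 // ?subr_gt0 ?P1 // ltr_wpDl.
have sm : Num.max s0 0 < 1 by rewrite gt_max s01 ltr01.
pose s := Num.max ((1 + Num.max s0 0) / 2) (1 - e).
have s_lt : Num.max s0 0 < s.
  by rewrite lt_max; apply/orP; left; move: sm; set z := Num.max s0 0 => ?; lra.
have s1 : s < 1.
  by rewrite gt_max; apply/andP; split; move: sm; set z := Num.max s0 0 => ?; lra.
move: (s_lt); rewrite gt_max => /andP[s0s ss0].
exists s; split=> //; exists J => K JK.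
apply: lt_le_trans (trunc_gf_deriv_mono JK (ltW ss0)).
have := horner_sub_le (nneg_poly_deriv (nneg_trunc_gf J)) (ltW ss0) (ltW s1).
rewrite -/P; have : (1 - s) * P^`()^`().[1] < P^`().[1] - M; last by lra.
have se : 1 - s <= e by rewrite lerBlDl -lerBlDr le_max lexx orbT.
apply: (@le_lt_trans _ _ (e * P^`()^`().[1])); first by rewrite ler_wpM2r.
by rewrite -[ltRHS](@mulfVK _ (P^`()^`().[1] + 1)) ?lt0r_neq0 ?ltr_wpDl // -/e mulrDr mulr1 ltrDl.
Qed.

(* Uniformity in the truncation level [K] allows all later estimates to be made on polynomials. *)
Definition contracts s kappa K0 := [/\ 0 < s, s < 1, 0 < kappa &
  forall K, (K0 <= K)%N -> (trunc_gf K).[s] <= s - kappa].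

(** Convexity: f(s) <= f(1) - (1 - s) f'(s) <= s - (1 - s) (f'(s) - 1), with f'(s) > 1 for s near 1.
    Thus [s] can be placed above any bound [s0] obtained before. *)
Lemma contracts_exists m s0 : offspring_mean p m -> 1 < m -> s0 < 1 ->
  exists s kappa K0, s0 < s /\ contracts s kappa K0.
Proof.
move=> pm m1 s01.
have [s [s0s ss0 s1 [K0 HK]]] := deriv_trunc_gf_near1 pm m1 s01.
exists s, (((trunc_gf K0)^`().[s] - 1) * (1 - s)), K0; split=> //; split=> //.
  by rewrite mulr_gt0 ?subr_gt0 // HK.
move=> K KK.
have := horner_sub_ge (nneg_trunc_gf K) (ltW ss0) (ltW s1).
have := trunc_gf_deriv_mono KK (ltW ss0).
have := @trunc_gf_le1 K 1; rewrite lexx ler01 => /(_ isT).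
have := HK _ (leqnn K0).
by nra.
Qed.

Section Contraction.
Variables (s kappa : R) (K0 : nat).
Hypothesis hs : contracts s kappa K0.
Let rho := 1 - kappa.

Let s0 : 0 < s. Proof. by case: hs. Qed.
Let s1 : s < 1. Proof. by case: hs. Qed.
Let kap0 : 0 < kappa. Proof. by case: hs. Qed.
Let hK K : (K0 <= K)%N -> (trunc_gf K).[s] <= s - kappa. Proof. by case: hs => ? ? ?; exact. Qed.

Lemma contracts_rate : 0 < rho /\ rho < 1.
Proof.
split; last by rewrite gtrBl.
have := hK (leqnn K0); have := nneg_horner (nneg_trunc_gf K0) (ltW s0).
by rewrite /rho; have := s1; lra.
Qed.

Lemma iter_gf_le_contract K n : (K0 <= K)%N -> (iter_gf K n).[s] <= s.
Proof.
move=> KK; elim: n => [|n IH]; first by rewrite hornerX.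
rewrite iter_gfSl horner_comp (le_trans (nneg_horner_le _ _ IH)) ?iter_gf_ge0 ?(ltW s0) //.
by rewrite (le_trans (hK KK)) // gerBl ltW.
Qed.

(** Let q be a fixed point of the truncated polynomial below s. As s - q <= 1, the chord from q to s
    has slope at most 1 - kappa. The iterates of s stay below s, those of 0 below q, and chords are
    monotone. *)
Lemma iter_gf_contract K n : (K0 <= K)%N ->
  (iter_gf K n).[s] - (iter_gf K n).[0] <= rho ^+ n.
Proof.
move=> KK; set f := trunc_gf K.
have [q /andP[q0 qs]] : exists2 q, 0 <= q <= s & root ('X - f) q.
  apply: poly_ivt; first exact: ltW.
  rewrite !hornerD !hornerN !hornerX sub0r oppr_le0 subr_ge0; apply/andP; split.
    by apply: nneg_horner => //; exact: nneg_trunc_gf.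
  by rewrite (le_trans (hK KK)) // gerBl ltW.
rewrite /root hornerD hornerN hornerX subr_eq0 => /eqP qE.
have qs' : q < s.
  rewrite lt_neqAle qs andbT; apply: contraTneq kap0 => qs'.
  by have := hK KK; rewrite -/f -{1}qs' -qE -qs' => H; rewrite -leNgt; lra.
have D : chord f s q <= rho.
  rewrite -(@ler_pM2l _ (s - q)) ?subr_gt0 // -horner_chord -qE /rho.
  have := hK KK; rewrite -/f => H.
  have : 0 <= kappa * (1 - (s - q)) by rewrite mulr_ge0 ?(ltW kap0) //; have := s1; lra.
  lra.
elim: n => [|n IH]; first by rewrite !hornerX subr0 expr0 ltW.
have xs := iter_gf_le_contract n KK.
have yq : (iter_gf K n).[0] <= q.
  elim: n {IH xs} => [|n IH]; first by rewrite hornerX.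
  by rewrite iter_gfSl horner_comp qE; apply: nneg_horner_le => //; rewrite iter_gf_ge0.
rewrite !iter_gfSl !horner_comp -/f horner_chord exprSr.
have xy0 : 0 <= (iter_gf K n).[s] - (iter_gf K n).[0].
  by rewrite subr_ge0 nneg_horner_le // ltW.
have x0 : 0 <= (iter_gf K n).[s] by rewrite iter_gf_ge0 // ltW.
have y0 : 0 <= (iter_gf K n).[0] by rewrite iter_gf_ge0.
apply: ler_pM => //.
  exact: chord_ge0 (nneg_trunc_gf K) x0 y0.
by apply: le_trans D; exact: chord_le (nneg_trunc_gf K) x0 y0 xs yq.
Qed.

(** By convexity (s - x) f_n'(x) <= f_n(s) - f_n(x), which is at most f_n(s) - f_n(0). *)
Lemma iter_gf_deriv_contract K n x : (K0 <= K)%N -> 0 <= x < s ->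
  (iter_gf K n)^`().[x] <= rho ^+ n / (s - x).
Proof.
move=> KK /andP[x0 xs]; rewrite ler_pdivlMr ?subr_gt0 // mulrC.
apply: le_trans (horner_sub_ge (nneg_iter_gf K n) x0 (ltW xs)) _.
apply: le_trans (iter_gf_contract n KK).
by rewrite lerD2l lerN2 nneg_horner_le.
Qed.
End Contraction.
End TruncatedIterates.
Arguments iter_gf {R} p K n : simpl never.

(** * Monotone comparison of generations *)

Section SurvivalSandwich.
Context {R : realType}.
Variables (p : nat -> R) (m s kappa : R) (K0 : nat).
Hypothesis pl : offspring_law p.
Hypothesis pm : offspring_mean p m.
Hypothesis m1 : 1 < m.
Hypothesis schroeder : 0 < p 0%N + p 1%N.
Hypothesis hs : contracts p s kappa K0.
Variable q : nat -> nat -> R.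
Hypothesis hq : forall n k, (fun K => (iter_gf p K n)`_k) @ \oo --> q n k.
Implicit Types (K n r j k : nat).

Let f K := trunc_gf p K.
Let F K n := iter_gf p K n.
Let p0 j : 0 <= p j. Proof. by case: pl. Qed.
Let f0 K : nneg_poly (f K). Proof. exact: nneg_trunc_gf. Qed.
Let F0 K n : nneg_poly (F K n). Proof. exact: nneg_iter_gf. Qed.
Let s0 : 0 < s. Proof. by case: hs. Qed.
Let s1 : s < 1. Proof. by case: hs. Qed.
Let F00 K n : 0 <= (F K n).[0]. Proof. exact: nneg_horner. Qed.
Let F0s K n : (F K n).[0] <= (F K n).[s].
Proof. by apply: nneg_horner_le => //; exact: ltW. Qed.

Lemma trunc_gf_deriv_ge K j x : 0 <= x -> (j < K)%N ->
  p j * (x ^+ j.-1 *+ j) <= (f K)^`().[x].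
Proof.
move=> x0 jK; rewrite trunc_gf_deriv (bigD1 (Ordinal jK)) //= lerDl.
by apply: sumr_ge0 => i _; rewrite mulr_ge0 // mulrn_wge0 // exprn_ge0.
Qed.

Lemma offspring_pos : exists2 j, (0 < j)%N & 0 < p j.
Proof.
apply: contrapT => H.
have pz j : (0 < j)%N -> p j = 0.
  move=> j0; apply/eqP; rewrite eq_le p0 andbT leNgt; apply/negP => pj.
  by apply: H; exists j.
have : m <= 0.
  apply: (cvgn_le_cst pm); exists 0%N => n _; rewrite /series /= big1_seq // => j _.
  by case: j => [|j]; rewrite ?mul0r // pz ?mulr0.
by have := m1; lra.
Qed.

(** If p_1 > 0 then f' >= p_1. Otherwise Schröder type gives p_0 > 0, hence f_i(0) >= p_0 for i >=
    1, and some term p_j x^j with j >= 1 bounds f' below. In the second case f'(0) = 0, so i = 0 has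
    to be excluded. *)
Lemma rate_lower : exists lam K1, [/\ 0 < lam &
  forall K i, (K1 <= K)%N -> (0 < i)%N -> lam <= (f K)^`().[(F K i).[0]]].
Proof.
have [j j0 pj] := offspring_pos.
have Fp K i : (0 < K)%N -> (0 < i)%N -> p 0%N <= (F K i).[0].
  move=> K_0; case: i => // i _; rewrite /F iter_gfSl horner_comp.
  apply: le_trans (nneg_horner_le (f0 K) (lexx 0) (F00 K i)).
  by rewrite /f horner_coef0 coef_poly K_0.
have [p1|p1] := ltP 0 (p 1%N).
  exists (p 1%N), 2%N; split=> // K i K2 _.
  by have := @trunc_gf_deriv_ge K 1%N _ (F00 K i) K2; rewrite expr0 mulr1.
have pp0 : 0 < p 0%N by have := schroeder; lra.
exists (p j * (p 0%N ^+ j.-1 *+ j)), j.+1; split.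
  by rewrite mulr_gt0 // pmulrn_lgt0 // exprn_gt0.
move=> K i jK i0; apply: le_trans (trunc_gf_deriv_ge (p0 0) jK) _.
apply: nneg_horner_le => //; first exact: nneg_poly_deriv.
by apply: Fp => //; exact: leq_ltn_trans jK.
Qed.

(* The rate of decay of the survival probabilities; the factor [i = 0] is left out
   since it vanishes when [p 1 = 0]. *)
Definition survival_rate K r := \prod_(1 <= i < r) (f K)^`().[(F K i).[0]].

Lemma survival_rateS K r : (0 < r)%N ->
  survival_rate K r.+1 = survival_rate K r * (f K)^`().[(F K r).[0]].
Proof. by move=> r0; rewrite /survival_rate big_nat_recr. Qed.

Lemma survival_rate1 K : survival_rate K 1 = 1.
Proof. by rewrite /survival_rate big_geq. Qed.

(** In f_(r+1) = f(f_r), this keeps the contribution where one child of the ancestor has j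
    descendants r generations later and all other children have none. *)
Lemma coef_iter_gfS_ge K r j : (0 < j)%N ->
  (f K)^`().[(F K r).[0]] * (F K r)`_j <= (F K r.+1)`_j.
Proof.
move=> j0; rewrite /F iter_gfSl coef_comp_poly horner_deriv_coef mulr_suml.
apply: ler_sum => i _; rewrite -mulrA ler_wpM2l ?f0 //.
by rewrite horner_coef0 coef_exp_ge // F0.
Qed.

(** Two convexity steps, from s to (1 + s) / 2 and from there to 1, bound f''(s) by f(1) <= 1 over
    the product of the two distances. The bound is uniform in K although f''(1) may be unbounded in
    K. *)
Lemma trunc_gf_deriv_lip K x y : 0 <= y -> y <= x -> x <= s ->
  (f K)^`().[x] - (f K)^`().[y] <= (x - y) * (((1 + s) / 2 - s) * (1 - (1 + s) / 2))^-1.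
Proof.
move=> y0 yx xs; have x0 := le_trans y0 yx.
have f'0 := nneg_poly_deriv (f0 K).
apply: le_trans (horner_sub_le f'0 y0 yx) _.
rewrite ler_wpM2l ?subr_ge0 //.
apply: le_trans (nneg_horner_le (nneg_poly_deriv f'0) x0 xs) _.
have s0' := s0; have s1' := s1.
have H1 : 0 < (1 + s) / 2 - s by lra.
have H2 : 0 < 1 - (1 + s) / 2 by lra.
rewrite invfM ler_pdivlMl // .
have Ha : ((1 + s) / 2 - s) * (f K)^`()^`().[s] <= (f K)^`().[(1 + s) / 2].
  apply: le_trans (horner_sub_ge f'0 (ltW s0) _) _; first by lra.
  by rewrite gerBl nneg_horner // ltW.
apply: le_trans Ha _; rewrite -[leRHS]mul1r ler_pdivlMr // mulrC.
apply: le_trans (horner_sub_ge (f0 K) _ _) _; [by lra|by lra|].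
rewrite lerBlDr (le_trans (trunc_gf_le1 pl K _)) ?ler01 ?lexx // lerDl nneg_horner //; lra.
Qed.

(** The sum over j >= 1 of the coefficients of f_r times s^j, divided by the survival rate; its
    limit in K is the [psi] below. *)
Definition gf_ratio K r := ((F K r).[s] - (F K r).[0]) / survival_rate K r.

Section Bounds.
Variables (lam : R) (K1 : nat).
Hypothesis lam0 : 0 < lam.
Hypothesis Hlam : forall K i, (K1 <= K)%N -> (0 < i)%N -> lam <= (f K)^`().[(F K i).[0]].

Lemma survival_rate_ge K r : (K1 <= K)%N -> lam ^+ r.-1 <= survival_rate K r.
Proof.
move=> KK; case: r => [|r]; first by rewrite /survival_rate big_geq.
elim: r => [|r IH]; first by rewrite survival_rate1.
rewrite survival_rateS //= exprSr; apply: ler_pM => //; rewrite ?exprn_ge0 ?(ltW lam0) //.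
exact: Hlam.
Qed.

Lemma survival_rate_gt0 K r : (K1 <= K)%N -> 0 < survival_rate K r.
Proof. by move=> KK; apply: lt_le_trans (survival_rate_ge r KK); rewrite exprn_gt0. Qed.

Lemma coef_ratio_mono K r r' j : (K1 <= K)%N -> (0 < j)%N -> (0 < r)%N -> (r <= r')%N ->
  (F K r)`_j / survival_rate K r <= (F K r')`_j / survival_rate K r'.
Proof.
move=> KK j0 r0; elim: r' => [|r' IH]; first by rewrite leqNgt r0.
rewrite leq_eqVlt ltnS => /predU1P[->//|rr']; apply: le_trans (IH rr') _.
have r'0 : (0 < r')%N by exact: leq_trans rr'.
rewrite survival_rateS // invfM mulrA ler_pdivlMr; last first.
  exact: lt_le_trans (Hlam _ _).
rewrite mulrAC ler_wpM2r //; first by rewrite invr_ge0 ltW // survival_rate_gt0.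
by rewrite mulrC coef_iter_gfS_ge.
Qed.

(** With x = f_r(s) and y = f_r(0), f(x) - f(y) <= (x - y) f'(x) and f'(x) <= f'(y) (1 + (L / lam)
    (x - y)). Since x - y <= rho^r, each step multiplies the ratio by at most 1 + (L / lam) rho^r,
    and the product of these factors stays bounded. *)
Lemma gf_ratio_bounded : exists B, forall K r, (K0 <= K)%N -> (K1 <= K)%N -> (0 < r)%N ->
  gf_ratio K r <= B.
Proof.
pose L := (((1 + s) / 2 - s) * (1 - (1 + s) / 2))^-1.
have L0 : 0 <= L.
  by rewrite invr_ge0 mulr_ge0 //; have := s1; lra.
pose rho := 1 - kappa.
have [r0 r1] := contracts_rate pl hs.
have rho01 : 0 <= rho < 1 by rewrite ltW.
exists (expR (L / lam * (1 - rho)^-1)) => K r KK KK1.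
have c0 : 0 <= L / lam by rewrite divr_ge0 // ltW.
case: r => // r _.
apply: (@le_trans _ _ (expR (L / lam * \sum_(i < r.+1) rho ^+ i))); last first.
  by rewrite ler_expR ler_wpM2l // sum_geometric_le.
elim: r => [|r IH].
  rewrite /gf_ratio survival_rate1 divr1.
  apply: (@le_trans _ _ 1).
    rewrite lerBlDr (le_trans (iter_gf_le1 pl K 1 _)) ?lerDl //.
    by rewrite (ltW s0) (ltW s1).
  by rewrite -expR0 ler_expR mulr_ge0 // sumr_ge0 // => i _; rewrite exprn_ge0 //; case/andP: rho01.
rewrite big_ord_recr /= mulrDr expRD.
set x := (F K r.+1).[s]; set y := (F K r.+1).[0].
have xy : y <= x by exact: F0s.
have xs : x <= s by apply: (iter_gf_le_contract pl hs).
have ly : lam <= (f K)^`().[y] by exact: Hlam.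
have ly0 : 0 < (f K)^`().[y] by exact: lt_le_trans ly.
have E : gf_ratio K r.+2 <= gf_ratio K r.+1 * (1 + L / lam * rho ^+ r.+1).
  rewrite /gf_ratio survival_rateS // invfM mulrA ler_pdivrMr //.
  rewrite -!mulrA [leRHS]mulrCA [leLHS]mulrC ler_wpM2l ?invr_ge0 ?(ltW (survival_rate_gt0 _ _)) //.
  have -> : (F K r.+2).[s] = (f K).[x] by rewrite /F iter_gfSl horner_comp.
  have -> : (F K r.+2).[0] = (f K).[y] by rewrite /F iter_gfSl horner_comp.
  apply: le_trans (horner_sub_le (f0 K) (F00 _ _) xy) _.
  rewrite ler_wpM2l ?subr_ge0 //.
  have := trunc_gf_deriv_lip K (F00 K r.+1) xy xs; rewrite -/L -/x -/y.
  have xyr : x - y <= rho ^+ r.+1 by exact: (iter_gf_contract pl hs).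
  have H2 : L * (x - y) <= L / lam * rho ^+ r.+1 * (f K)^`().[y].
    apply: (@le_trans _ _ (L / lam * rho ^+ r.+1 * lam)).
      by rewrite mulrAC divfK ?lt0r_neq0 // ler_wpM2l.
    by rewrite ler_wpM2l // mulr_ge0 // exprn_ge0 //; case/andP: rho01.
  by move=> H1; rewrite mulrDl mul1r; lra.
apply: le_trans E _; apply: ler_pM.
- rewrite mulr_ge0 ?subr_ge0 ?F0s // invr_ge0 ltW //; exact: survival_rate_gt0.
- by rewrite addr_ge0 // mulr_ge0 // exprn_ge0 //; case/andP: rho01.
- exact: IH.
- exact: expR_ge1Dx.
Qed.

(** Everything is a sum over the number j >= 1 of individuals at the splitting generation, with
    weights nondecreasing in r; the term j = 0 vanishes since k1 > 0. As the sums over k are at most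
    C s^j, the increments are dominated by those of [gf_ratio]. *)
Lemma trunc_sandwich K a k1 k2 C r r' :
  (K1 <= K)%N -> (0 < k1)%N -> 0 <= C ->
  (forall j, (0 < j)%N -> \sum_(k1 <= k < k2) (F K a ^+ j)`_k <= C * s ^+ j) ->
  (0 < r)%N -> (r <= r')%N ->
  let S r := \sum_(k1 <= k < k2) (F K (r + a))`_k in
  [/\ S r / survival_rate K r <= S r' / survival_rate K r',
   S r' / survival_rate K r' <= S r / survival_rate K r + C * (gf_ratio K r' - gf_ratio K r) &
   S r / survival_rate K r <= C * gf_ratio K r].
Proof.
move=> KK k10 C0 HC r0 rr' S.
pose T j := \sum_(k1 <= k < k2) (F K a ^+ j)`_k.
have T0 j : 0 <= T j by apply: sumr_ge0 => k _; exact: nneg_poly_exp.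
(* Common range of j for both generations; the successor makes it contain j = 0, which is then split
   off. *)
pose N := (maxn (size (F K r)) (size (F K r'))).+1.
pose h r j := (F K r)`_j / survival_rate K r.
have SE t : (size (F K t) <= N)%N ->
    S t / survival_rate K t = \sum_(1 <= j < N) h t j * T j.
  move=> sN; rewrite /S (eq_bigr (fun k => \sum_(0 <= j < N) (F K t)`_j * (F K a ^+ j)`_k)); last first.
    move=> k _; rewrite /F iter_gfD coef_comp_poly.
    rewrite (big_ord_widen N (fun j => (iter_gf p K t)`_j * (iter_gf p K a ^+ j)`_k) sN).
    rewrite big_mkord big_mkcond; apply: eq_bigr => i _; case: ltnP => // Hi.
    by rewrite nth_default // mul0r.
  rewrite exchange_big /= big_ltn // big1_seq ?add0r; last first.
    move=> k /andP[_]; rewrite mem_index_iota => /andP[kk _].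
    by rewrite expr0 coefC gtn_eqF ?mulr0 // (leq_trans k10).
  rewrite mulr_suml; apply: eq_bigr => j _.
  by rewrite -mulr_sumr /h mulrAC.
have GE t : (size (F K t) <= N)%N -> gf_ratio K t = \sum_(1 <= j < N) h t j * s ^+ j.
  move=> sN; rewrite /gf_ratio.
  have H x : (F K t).[x] = (F K t)`_0 + \sum_(1 <= j < N) (F K t)`_j * x ^+ j.
    rewrite horner_coef (big_ord_widen N (fun j => (F K t)`_j * x ^+ j) sN) big_mkcond.
    rewrite -(big_mkord xpredT (fun i => if (i < size (F K t))%N then (F K t)`_i * x ^+ i else 0)).
    rewrite big_ltn //; congr (_ + _).
      by case: ltnP => Hs; rewrite ?expr0 ?mulr1 // nth_default.
    apply: eq_bigr => i _; case: ltnP => // Hi.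
    by rewrite nth_default // mul0r.
  rewrite (H s) horner_coef0 addrC addKr mulr_suml.
  by apply: eq_bigr => j _; rewrite mulrAC.
have sr : (size (F K r) <= N)%N by rewrite leqW // leq_maxl.
have sr' : (size (F K r') <= N)%N by rewrite leqW // leq_maxr.
have r'0 : (0 < r')%N by exact: leq_trans rr'.
rewrite !SE // !GE //; split.
- rewrite !big_nat; apply: ler_sum => j /andP[j0 _].
  by rewrite ler_wpM2r // coef_ratio_mono.
- rewrite -lerBlDl -!sumrB mulr_sumr !big_nat; apply: ler_sum => j /andP[j0 _].
  rewrite -!mulrBl mulrCA ler_wpM2l ?subr_ge0 ?coef_ratio_mono //.
  exact: HC.
- rewrite mulr_sumr !big_nat; apply: ler_sum => j /andP[j0 _].
  rewrite mulrCA ler_wpM2l ?HC // divr_ge0 ?F0 // ltW //; exact: survival_rate_gt0.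
Qed.
End Bounds.

(** Each factor increases with K, and stays below 1 / (1 - s) because f_i(0) <= s for all large
    truncation levels. *)
Lemma survival_rate_cvg r : exists g : R, survival_rate ^~ r @ \oo --> g.
Proof.
case: r => [|r].
  by exists 1; rewrite /survival_rate; under eq_fun do rewrite big_geq //; exact: cvg_cst.
elim: r => [|r [g IH]].
  by exists 1; under eq_fun do rewrite survival_rate1; exact: cvg_cst.
have [l Hl] : exists l : R, (fun K => (f K)^`().[(F K r.+1).[0]]) @ \oo --> l.
  apply: (@monotone_bounded_cvg _ _ (1 / (1 - s))).
    move=> K K' KK; apply: le_trans (trunc_gf_deriv_mono pl KK (F00 _ _)) _.
    apply: nneg_horner_le => //; first exact: nneg_poly_deriv.
    exact: iter_gf_mono.
  move=> K; set K' := maxn K K0.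
  have KK : (K <= K')%N by exact: leq_maxl.
  apply: le_trans (trunc_gf_deriv_mono pl KK (F00 _ _)) _.
  have xs : (F K r.+1).[0] <= s.
    apply: le_trans (iter_gf_mono pl r.+1 KK (lexx 0)) _.
    apply: le_trans (F0s K' r.+1) _; apply: (iter_gf_le_contract pl hs); exact: leq_maxr.
  apply: le_trans (nneg_horner_le (nneg_poly_deriv (f0 K')) (F00 _ _) xs) _.
  rewrite ler_pdivlMr ?subr_gt0 // mulrC.
  apply: le_trans (horner_sub_ge (f0 K') (ltW s0) (ltW s1)) _.
  rewrite lerBlDr (le_trans (trunc_gf_le1 pl K' _)) ?ler01 ?lexx // lerDl nneg_horner //; exact: ltW.
exists (g * l); under eq_fun do rewrite survival_rateS //.
exact: cvgM.
Qed.

(** The inequalities of [trunc_sandwich] in the limit K -> infinity, with [psi] the limit of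
    [gf_ratio]. The decay of g follows from g_r psi_1 <= g_r psi_r <= (1 - kappa)^r and psi_1 >
    0. *)
Lemma survival_sandwich : exists (g psi : nat -> R) (B G : R),
  [/\ forall r, (0 < r)%N -> 0 < g r,
      forall r, (0 < r)%N -> psi r <= B,
      forall r, (0 < r)%N -> g r <= G * (1 - kappa) ^+ r,
      forall r r', (0 < r)%N -> (r <= r')%N -> psi r <= psi r' &
   forall a k1 k2 C, (0 < k1)%N -> 0 <= C ->
    (exists K1, forall K, (K1 <= K)%N -> forall j, (0 < j)%N ->
      \sum_(k1 <= k < k2) (F K a ^+ j)`_k <= C * s ^+ j) ->
    forall r r', (0 < r)%N -> (r <= r')%N ->
    let S r := \sum_(k1 <= k < k2) q (r + a) k in
    [/\ S r / g r <= S r' / g r', S r' / g r' <= S r / g r + C * (psi r' - psi r) &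
        S r / g r <= C * psi r]].
Proof.
have [lam [K1 [lam0 Hlam]]] := rate_lower.
have [B HB] := gf_ratio_bounded lam0 Hlam.
have /choice[g Hg] := survival_rate_cvg.
have g0 r : 0 < g r.
  apply: (@lt_le_trans _ _ (lam ^+ r.-1)); first by rewrite exprn_gt0.
  apply: (cvgn_ge_cst (Hg r)); exists K1 => K KK; exact: (survival_rate_ge lam0 Hlam).
have cvgF x r : 0 <= x <= 1 -> exists l : R, (fun K => (F K r).[x]) @ \oo --> l.
  move=> x01; apply: (@monotone_bounded_cvg _ _ 1) => [K K' KK|K].
    by apply: iter_gf_mono => //; case/andP: x01.
  exact: iter_gf_le1.
have cvgV r : (fun K => (survival_rate K r)^-1) @ \oo --> (g r)^-1.
  by apply: cvgV => //; rewrite lt0r_neq0.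
have /choice[psi Hpsi] r : exists l : R, gf_ratio ^~ r @ \oo --> l.
  have s01 : 0 <= s <= 1 by rewrite (ltW s0) (ltW s1).
  have z01 : 0 <= (0 : R) <= 1 by rewrite lexx ler01.
  have [a Ha] := cvgF s r s01; have [b Hb] := cvgF 0 r z01.
  exists ((a - b) / g r); apply: cvgM => //; exact: cvgB.
have psi0 : 0 < psi 1%N.
  have [j j0 pj] := offspring_pos.
  apply: (@lt_le_trans _ _ (p j * s ^+ j)); first by rewrite mulr_gt0 // exprn_gt0.
  apply: (cvgn_ge_cst (Hpsi 1%N)); exists j.+1 => K jK.
  rewrite /gf_ratio survival_rate1 divr1 /F iter_gf1 !trunc_gf_horner -sumrB.
  rewrite (bigD1 (Ordinal jK)) //= -[leLHS]addr0 lerD //.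
    by rewrite expr0n gtn_eqF // mulr0 subr0.
  apply: sumr_ge0 => i _; rewrite -mulrBr mulr_ge0 // subr_ge0 lerXn2r ?nnegrE //; exact: ltW.
have rho0 : 0 <= 1 - kappa by apply: ltW; case: (contracts_rate pl hs).
have psimono r r' : (0 < r)%N -> (r <= r')%N -> psi r <= psi r'.
  move=> r0 rr'; apply: (cvgn_le (Hpsi r) (Hpsi r')); exists K1 => K KK.
  (* Over an empty range of k and with C = 1, the second inequality of [trunc_sandwich] says that
     [gf_ratio] is nondecreasing in r. *)
  have hC j : (0 < j)%N -> \sum_(1 <= k < 1) (F K 1 ^+ j)`_k <= 1 * s ^+ j.
    by move=> _; rewrite big_geq // mul1r exprn_ge0 // ltW.
  have [H1 H2 _] := @trunc_sandwich lam K1 lam0 Hlam K 1 1%N 1%N 1 r r' KK isT ler01 hC r0 rr'.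
  by move: H2; rewrite !big_geq // !mul0r add0r mul1r subr_ge0.
exists g, psi, B, (psi 1%N)^-1; split=> //.
- move=> r r0; apply: (cvgn_le_cst (Hpsi r)); exists (maxn K0 K1) => K.
  by rewrite geq_max => /andP[? ?]; exact: HB.
- move=> r r0; rewrite mulrC ler_pdivlMr //.
  apply: (@le_trans _ _ (g r * psi r)); first by rewrite ler_pM2l // psimono.
  apply: (@cvgn_le_cst _ (fun K => survival_rate K r * gf_ratio K r)); first exact: cvgM.
  exists (maxn K0 K1) => K; rewrite geq_max => /andP[KK0 KK1].
  rewrite /gf_ratio mulrC divfK ?lt0r_neq0 ?(survival_rate_gt0 lam0 Hlam) //.
  exact: (iter_gf_contract pl hs).
- move=> a k1 k2 C k10 C0 [K2 HK2] r r' r0 rr' S.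
  have HS t : (fun K => (\sum_(k1 <= k < k2) (F K (t + a))`_k) / survival_rate K t) @ \oo
      --> S t / g t.
    by apply: cvgM => //; apply: cvgn_sum => k; exact: hq.
  have sw K : (maxn K1 K2 <= K)%N -> _ := fun KK =>
    @trunc_sandwich lam K1 lam0 Hlam K a k1 k2 C r r'
      (leq_trans (leq_maxl _ _) KK) k10 C0 (HK2 K (leq_trans (leq_maxr _ _) KK)) r0 rr'.
  split.
  + apply: (cvgn_le (HS r) (HS r')); exists (maxn K1 K2) => K KK; by have [] := sw K KK.
  + apply: (cvgn_le (HS r') _); last first.
      by exists (maxn K1 K2) => K KK; have [_ H _] := sw K KK; exact: H.
    apply: cvgD; first exact: HS.
    by apply: cvgM; [exact: cvg_cst|exact: cvgB].
  + apply: (cvgn_le (HS r) _); last first.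
      by exists (maxn K1 K2) => K KK; have [_ _ H] := sw K KK; exact: H.
    by apply: cvgM; [exact: cvg_cst|exact: Hpsi].
Qed.
End SurvivalSandwich.

(** * Removal of the truncation; residue classes modulo the span *)

Section TruncationLimit.
Context {R : realType}.
Variables (p : nat -> R) (q : nat -> nat -> R).
Hypothesis pl : offspring_law p.
Hypothesis q0 : forall k, q 0%N k = (k == 1%N)%:R.
Hypothesis q_ge0 : forall n k, 0 <= q n k.
Hypothesis qS : forall n k, series (fun j => q n j * conv_pow p j k) @ \oo --> q n.+1 k.
Implicit Types (K n j k : nat).

Let p0 j : 0 <= p j. Proof. by case: pl. Qed.

Lemma conv_pow_ge0 j k : 0 <= conv_pow p j k.
Proof.
elim: j k => [|j IH] k /=; first exact: ler0n.
by apply: sumr_ge0 => l _; rewrite mulr_ge0.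
Qed.

Lemma coef_trunc_gf_exp_le K j k : (trunc_gf p K ^+ j)`_k <= conv_pow p j k.
Proof.
elim: j k => [|j IH] k /=; first by rewrite expr0 coefC; case: eqP.
rewrite exprS coefM; apply: ler_sum => l _; apply: ler_pM => //.
- exact: (nneg_trunc_gf pl).
- exact: nneg_poly_exp (nneg_trunc_gf pl K) _.
- by rewrite coef_poly; case: ifP.
Qed.

Lemma coef_trunc_gf_exp K j k : (k < K)%N -> (trunc_gf p K ^+ j)`_k = conv_pow p j k.
Proof.
elim: j k => [|j IH] k kK /=; first by rewrite expr0 coefC; case: eqP.
rewrite exprS coefM; apply: eq_bigr => l _; rewrite coef_poly.
rewrite (leq_ltn_trans _ kK) -1?ltnS ?ltn_ord // IH //.
by apply: leq_ltn_trans kK; exact: leq_subr.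
Qed.

Lemma series_law_le n k N : \sum_(j < N) q n j * conv_pow p j k <= q n.+1 k.
Proof.
rewrite -(big_mkord xpredT (fun j => q n j * conv_pow p j k)).
have cv := @qS n k; rewrite -(cvg_lim _ cv) //.
apply: (@nondecreasing_cvgn_le _ (series (fun j => q n j * conv_pow p j k))).
  apply/nondecreasing_seqP => i; rewrite /series /= big_nat_recr //= lerDl.
  by rewrite mulr_ge0 // conv_pow_ge0.
by apply/cvg_ex; exists (q n.+1 k).
Qed.

Lemma coef_iter_gf_le K n k : (iter_gf p K n)`_k <= q n k.
Proof.
elim: n k => [|n IH] k; first by rewrite q0 coefX.
rewrite iter_gfS coef_comp_poly.
apply: le_trans (series_law_le n k (size (iter_gf p K n))).
apply: ler_sum => j _; apply: ler_pM => //.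
- exact: (nneg_iter_gf pl).
- exact: nneg_poly_exp (nneg_trunc_gf pl K) _.
- exact: coef_trunc_gf_exp_le.
Qed.

(** Finitely many values j of Z_n carry the law of the next generation at k up to e / 2; for these
    the coefficients at step n converge by induction, and the coefficient of z^k in f^j is exact
    once K > k. *)
Lemma coef_iter_gf_cvg n k : (fun K => (iter_gf p K n)`_k) @ \oo --> q n k.
Proof.
elim: n k => [|n IH] k.
  by rewrite q0; under eq_fun do rewrite coefX; exact: cvg_cst.
apply/cvgn_distP => e e0.
have e20 : 0 < e / 2 by rewrite divr_gt0.
have /cvgn_distP/(_ _ e20)[J /(_ J (leqnn _)) HJ] := @qS n k.
have : (fun K => \sum_(j < J) (iter_gf p K n)`_j * conv_pow p j k) @ \oo -->
    \sum_(j < J) q n j * conv_pow p j k.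
  by apply: cvgn_sum => j; apply: cvgM; [exact: IH|exact: cvg_cst].
move=> /cvgn_distP/(_ _ e20)[N HN]; exists (maxn N k.+1) => K.
rewrite geq_max => /andP[NK kK]; rewrite ler0_norm ?subr_le0 ?coef_iter_gf_le // opprB.
move: HJ; rewrite /series /= big_mkord distrC => /ltr_normlW HJ.
have := HN K NK; rewrite distrC => /ltr_normlW HK.
suff : \sum_(j < J) (iter_gf p K n)`_j * conv_pow p j k <= (iter_gf p K n.+1)`_k by lra.
rewrite iter_gfS coef_comp_poly.
under [leRHS]eq_bigr do rewrite coef_trunc_gf_exp //.
set P := iter_gf p K n.
have P0 : nneg_poly P by exact: nneg_iter_gf.
have [H|H] := leqP J (size P).
  rewrite (big_ord_widen (size P) (fun j => P`_j * conv_pow p j k) H) big_mkcond.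
  by apply: ler_sum => j _; case: ifP => // _; rewrite mulr_ge0 // conv_pow_ge0.
rewrite (big_ord_widen J (fun j => P`_j * conv_pow p j k) (ltnW H)) [leRHS]big_mkcond.
apply: ler_sum => j _; case: ltnP => // Hj.
by rewrite nth_default // mul0r.
Qed.

Section Span.
Variables (d mu : nat).
Hypothesis d_span : span_gcd p d.
Hypothesis mu_min : min_support p mu.
Hypothesis schroeder : 0 < p 0%N + p 1%N.

Lemma offspring_mod j : p j != 0 -> j = mu %[mod d].
Proof.
move=> pj; have [mu0 mu_lt] := mu_min; have [_ [dd _]] := d_span.
have pj0 : 0 < p j by rewrite lt_neqAle eq_sym pj p0.
have [->//|/eqP jmu] := eqVneq j mu.
have [jm|mj] := ltnP j mu; first by rewrite mu_lt ?eqxx in pj.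
apply/eqP; rewrite eqn_mod_dvd //; apply: dd => //; exact: mulr_gt0.
Qed.

Lemma min_support_le1 : (mu <= 1)%N.
Proof.
have [_ mu_lt] := mu_min; rewrite leqNgt; apply/negP => mu1.
by have := schroeder; rewrite !mu_lt ?addr0 ?ltxx // ltnW.
Qed.

Lemma trunc_gf_exp_mod K j k : (trunc_gf p K ^+ j)`_k != 0 -> k = j * mu %[mod d].
Proof.
elim: j k => [|j IH] k; first by rewrite expr0 coefC; case: (k =P 0%N) => [->|_]; rewrite ?eqxx.
rewrite exprS coefM => H.
have [l Hl] : exists l : 'I_k.+1, (trunc_gf p K)`_l * (trunc_gf p K ^+ j)`_(k - l) != 0.
  apply: contrapT => HH; move: H; rewrite big1 ?eqxx // => l _.
  by apply/eqP; apply: contrapT => /negP ?; apply: HH; exists l.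
move: Hl; rewrite mulf_eq0 negb_or coef_poly => /andP[].
case: ifP => _; last by rewrite eqxx.
move=> /offspring_mod lmu /IH klmu.
by rewrite -(subnKC (ltn_ord l : l <= k)%N) mulSn -modnDm lmu klmu modnDm.
Qed.

(** If j = mu modulo d, then j individuals have j mu = mu^2 children modulo d, and mu^2 = mu since
    mu is 0 or 1 by Schröder type. *)
Lemma iter_gf_mod K n k : (0 < n)%N -> (iter_gf p K n)`_k != 0 -> k = mu %[mod d].
Proof.
elim: n k => // n IH k _; case: n IH => [|n] IH.
  by rewrite iter_gf1 coef_poly; case: ifP => _; [exact: offspring_mod|rewrite eqxx].
rewrite iter_gfS coef_comp_poly => H.
have [j Hj] : exists j : 'I_(size (iter_gf p K n.+1)),
    (iter_gf p K n.+1)`_j * (trunc_gf p K ^+ j)`_k != 0.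
  apply: contrapT => HH; move: H; rewrite big1 ?eqxx // => l _.
  by apply/eqP; apply: contrapT => /negP ?; apply: HH; exists l.
move: Hj; rewrite mulf_eq0 negb_or => /andP[/IH -/(_ isT) jmu /trunc_gf_exp_mod ->].
have := min_support_le1; case: (mu) jmu => [|[|//]] jmu _; first by rewrite muln0.
by rewrite muln1.
Qed.

Lemma law_mod n k : (0 < n)%N -> k != mu %[mod d] -> q n k = 0.
Proof.
move=> n0 kmu; apply/eqP; rewrite eq_le q_ge0 andbT.
apply: (cvgn_le_cst (@coef_iter_gf_cvg n k)); exists 0%N => K _.
have [->//|/(iter_gf_mod n0) kmu'] := eqVneq (iter_gf p K n)`_k 0.
by rewrite kmu' eqxx in kmu.
Qed.
End Span.
End TruncationLimit.

(** * Decay of the iterates off the real axis *)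

Section OffAxis.
Context {R : realType}.
Local Notation normc := (@ComplexField.Normc.normc R).

Lemma sum_range_le (G : nat -> R) (n a b : nat) : (forall j, 0 <= G j) ->
  (forall j, (n <= j)%N -> G j = 0) -> \sum_(a <= j < b) G j <= \sum_(j < n) G j.
Proof.
move=> G0 Gn; rewrite -(big_mkord xpredT G).
have -> : \sum_(0 <= j < n) G j = \sum_(0 <= j < maxn n b) G j.
  rewrite [RHS](big_cat_nat (n := n)) //= ?leq_maxl // [X in _ + X]big1_seq ?addr0 //.
  by move=> j; rewrite mem_index_iota => /andP[_ /andP[nj _]]; exact: Gn.
have [ab|ba] := leqP a b; last by rewrite big_geq ?sumr_ge0 // ltnW.
rewrite [leRHS](big_cat_nat (n := b)) //= ?leq_maxr //.
rewrite [X in X + _](big_cat_nat (n := a)) //=.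
by rewrite -addrA addrCA lerDl addr_ge0 // sumr_ge0.
Qed.

Lemma normc_ceval_window (P : {poly R}) r t (a b a' b' : nat) : nneg_poly P -> 0 <= r <= 1 ->
  normc (ceval P (polar r t)) ^+ 2 <= P.[1] ^+ 2 -
    \sum_(a <= j < b) \sum_(a' <= k < b') P`_j * P`_k * sin ((j%:R - k%:R) * (t / 2)) ^+ 2.
Proof.
move=> P0 r01; apply: le_trans (normc_ceval_sqr_le t P0 r01) _.
have G0 j k : 0 <= P`_j * P`_k * sin ((j%:R - k%:R) * (t / 2)) ^+ 2.
  by rewrite mulr_ge0 ?sqr_ge0 // mulr_ge0.
rewrite lerD2l lerN2.
pose T j k := P`_j * P`_k * sin ((j%:R - k%:R) * (t / 2)) ^+ 2.
apply: (@le_trans _ _ (\sum_(a <= j < b) \sum_(k < size P) T j k)).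
  apply: ler_sum => j _; apply: (sum_range_le (G := T j)) => [k|k sk]; first exact: G0.
  by rewrite /T [P`_k]nth_default // mulr0 mul0r.
apply: (sum_range_le (G := fun j => \sum_(k < size P) T j k)) => [j|j sj].
  by apply: sumr_ge0 => k _; exact: G0.
by apply: big1 => k _; rewrite /T [P`_j]nth_default // !mul0r.
Qed.

Variables (p : nat -> R) (d : nat).
Hypothesis pl : offspring_law p.
Hypothesis p_lt1 : forall j, p j < 1.
Hypothesis d_span : span_gcd p d.
Let p0 j : 0 <= p j. Proof. by case: pl. Qed.

Lemma offspring_two : exists i j, i <> j /\ 0 < p i * p j.
Proof.
have [_ cv] := pl.
have [i pi] : exists i, 0 < p i.
  apply: contrapT => H.
  have pz j : p j = 0.
    by apply/eqP; rewrite eq_le p0 andbT leNgt; apply/negP => pj; apply: H; exists j.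
  have : 1 <= 0 :> R.
    by apply: (cvgn_le_cst cv); exists 0%N => n _; rewrite /series /= big1.
  by rewrite ler10.
apply: contrapT => H.
have pz j : j != i -> p j = 0.
  move=> ji; apply/eqP; rewrite eq_le p0 andbT leNgt; apply/negP => pj; apply: H.
  by exists j, i; split; [apply/eqP|rewrite mulr_gt0].
have : 1 <= p i.
  apply: (cvgn_le_cst cv); exists 0%N => n _; rewrite /series /=.
  rewrite (big_nat_widen _ _ (maxn n i.+1)) ?leq_maxl //.
  rewrite big_mkcond (bigD1_seq i) /= ?iota_uniq ?mem_index_iota ?leq_max ?leqnn ?orbT //.
  rewrite big1 ?addr0; first by case: ifP.
  by move=> j ji; rewrite pz // if_same.
by rewrite leNgt p_lt1.
Qed.

Let sin_form J x := \sum_(0 <= j < J) \sum_(0 <= k < J) p j * p k * sin ((j%:R - k%:R) * x) ^+ 2.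

Let sin_form_mono J J' x : (J <= J')%N -> sin_form J x <= sin_form J' x.
Proof.
move=> JJ'; have G0 j k : 0 <= p j * p k * sin ((j%:R - k%:R) * x) ^+ 2.
  by rewrite mulr_ge0 ?sqr_ge0 // mulr_ge0.
have mono (G : nat -> R) : (forall j, 0 <= G j) ->
    \sum_(0 <= j < J) G j <= \sum_(0 <= j < J') G j.
  by move=> G_0; rewrite [leRHS](big_cat_nat (n := J)) //= lerDl sumr_ge0.
apply: (@le_trans _ _ (\sum_(0 <= j < J) \sum_(0 <= k < J') p j * p k * sin ((j%:R - k%:R) * x) ^+ 2)).
  by apply: ler_sum => j _; exact: mono.
by apply: mono => j; apply: sumr_ge0.
Qed.

(* A quantitative form of Bezout: the least [e] satisfying such an inequality divides
   every difference of two points of the support, hence divides [d]. *)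
Lemma span_sin_le : exists J C, 0 < C /\ forall x, sin (d%:R * x) ^+ 2 <= C * sin_form J x.
Proof.
pose I e := `[< exists J C, 0 < C /\ forall x, sin (e%:R * x) ^+ 2 <= C * sin_form J x >].
have G0 J x : 0 <= sin_form J x.
  by apply: sumr_ge0 => j _; apply: sumr_ge0 => k _; rewrite mulr_ge0 ?sqr_ge0 // mulr_ge0.
have pairI i j : 0 < p i * p j -> I (i - j)%N.
  move=> pij; apply/asboolP; exists (maxn i j).+1, (p i * p j)^-1; split; first by rewrite invr_gt0.
  have : (i < (maxn i j).+1)%N /\ (j < (maxn i j).+1)%N by rewrite !ltnS leq_maxl leq_maxr.
  move: (maxn i j).+1 => J [iJ jJ] x; have [ij|ji] := leqP i j.
    by rewrite (eqP ij) mul0r sin0 expr0n mulr_ge0 // invr_ge0 ltW.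
  rewrite ler_pdivlMl // natrB ?(ltnW ji) //.
  rewrite /sin_form (bigD1_seq i) ?mem_index_iota ?iota_uniq //=.
  rewrite (bigD1_seq j) ?mem_index_iota ?iota_uniq //=.
  rewrite -addrA lerDl addr_ge0 //; first by apply: sumr_ge0 => k _; rewrite mulr_ge0 ?sqr_ge0 // mulr_ge0.
  by apply: sumr_ge0 => k _; apply: sumr_ge0 => l _; rewrite mulr_ge0 ?sqr_ge0 // mulr_ge0.
(* Closure under a - n b makes the remainder of a Euclidean division again an element, through |sin
   (n y)| <= n |sin y| and sin(u - w)^2 <= 2 sin(u)^2 + 2 sin(w)^2. *)
have subI a b n : I a -> I b -> (n * b <= a)%N -> I (a - n * b)%N.
  move=> /asboolP[J [C [C0 H]]] /asboolP[J' [C' [C'0 H']]] nba; apply/asboolP.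
  exists (maxn J J'), (2 * C + 2 * n%:R ^+ 2 * C'); split.
    by rewrite ltr_pwDl ?mulr_gt0 // mulr_ge0 ?mulr_ge0 ?sqr_ge0 // ltW.
  move=> x.
  have nsin (y : R) : sin (n%:R * y) ^+ 2 <= n%:R ^+ 2 * sin y ^+ 2.
    have nabs : `|sin (n%:R * y)| <= n%:R * `|sin y|.
      elim: (n) => [|k IH]; first by rewrite !mul0r sin0 normr0.
      rewrite -natr1 !mulrDl !mul1r sinD (le_trans (ler_normD _ _)) // lerD //.
        by rewrite normrM (le_trans _ IH) // ler_piMr // cos_max.
      by rewrite normrM ler_piMl // cos_max.
    rewrite -[sin (n%:R * y) ^+ 2]real_normK ?num_real // -[sin y ^+ 2]real_normK ?num_real // -exprMn.
    by rewrite lerXn2r ?nnegrE // mulr_ge0.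
  have sub2 (u w : R) : sin (u - w) ^+ 2 <= 2 * sin u ^+ 2 + 2 * sin w ^+ 2 :> R.
    rewrite sinB.
    have := sqr_ge0 (sin u * cos w + cos u * sin w).
    have : sin u ^+ 2 * cos w ^+ 2 <= sin u ^+ 2.
      by rewrite ler_piMr ?sqr_ge0 // cos2sin2 gerBl sqr_ge0.
    have : cos u ^+ 2 * sin w ^+ 2 <= sin w ^+ 2.
      by rewrite ler_piMl ?sqr_ge0 // cos2sin2 gerBl sqr_ge0.
    by rewrite !expr2; lra.
  rewrite natrB // natrM mulrBl -mulrA.
  apply: le_trans (sub2 _ _) _; rewrite [leRHS]mulrDl; apply: lerD.
    rewrite -mulrA ler_wpM2l //; apply: le_trans (H x) _.
    by rewrite ler_wpM2l ?(ltW C0) // sin_form_mono // leq_maxl.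
  rewrite -2!mulrA ler_wpM2l //; apply: (le_trans (nsin (b%:R * x))).
  rewrite ler_wpM2l ?sqr_ge0 //; apply: le_trans (H' x) _.
  by rewrite ler_wpM2l ?(ltW C'0) // sin_form_mono // leq_maxr.
have exI : exists e, (0 < e)%N && I e.
  have [i [j [ij pij]]] := offspring_two.
  have [ij'|ji] := ltnP i j.
    by exists (j - i)%N; rewrite subn_gt0 ij' pairI // mulrC.
  exists (i - j)%N; rewrite subn_gt0 pairI // andbT ltn_neqAle ji andbT.
  by apply/eqP => /esym.
have [e /andP[e0 Ie] emin] := ex_minnP exI.
have edvd a : I a -> (e %| a)%N.
  move=> Ia; rewrite /dvdn; apply: contrapT => /negP; rewrite -lt0n => r0.
  have : I (a %% e)%N.
    have -> : (a %% e = a - (a %/ e) * e)%N by rewrite {2}(divn_eq a e) addnC addnK.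
    by apply: subI => //; exact: leq_divM.
  move=> Ir; have := emin (a %% e)%N; rewrite r0 Ir => /(_ isT).
  by rewrite leqNgt ltn_pmod.
have [d0 [_ dmax]] := d_span.
have ed : (e %| d)%N.
  by apply: dmax => i j _ pij; apply: edvd; exact: pairI.
have : I d.
  move/asboolP: Ie => [J [C [C0 H]]]; apply/asboolP.
  have : I (d - 0 * e)%N; last by rewrite mul0n subn0 => /asboolP.
  rewrite mul0n subn0 -(divnK ed); elim: (d %/ e)%N => [|n IH].
    by apply/asboolP; exists 0%N, 1; split=> // x; rewrite !mul0r sin0 expr0n /= mul1r.
  apply/asboolP; move/asboolP: IH => [J' [C' [C'0 H']]].
  exists (maxn J J'), (2 * C + 2 * C'); split; first by rewrite addr_gt0 // mulr_gt0.
  move=> x; rewrite mulSn natrD mulrDl sinD mulrDl.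
  have : sin (e%:R * x) ^+ 2 <= C * sin_form (maxn J J') x.
    by apply: le_trans (H x) _; rewrite ler_wpM2l ?(ltW C0) // sin_form_mono // leq_maxl.
  have : sin ((n * e)%:R * x) ^+ 2 <= C' * sin_form (maxn J J') x.
    by apply: le_trans (H' x) _; rewrite ler_wpM2l ?(ltW C'0) // sin_form_mono // leq_maxr.
  set u := e%:R * x; set w := _ * x.
  have := sqr_ge0 (sin u * cos w - cos u * sin w).
  have : sin u ^+ 2 * cos w ^+ 2 <= sin u ^+ 2.
    by rewrite ler_piMr ?sqr_ge0 // cos2sin2 gerBl sqr_ge0.
  have : cos u ^+ 2 * sin w ^+ 2 <= sin w ^+ 2.
    by rewrite ler_piMl ?sqr_ge0 // cos2sin2 gerBl sqr_ge0.
  by rewrite !expr2; lra.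
by move/asboolP.
Qed.

Lemma le_of_sqr_le (x e : R) : 0 <= e <= 1 -> x ^+ 2 <= 1 - e -> x <= 1 - e / 2.
Proof.
move=> /andP[e0 e1] H; have [//|xe] := leP x (1 - e / 2).
have : (1 - e / 2) ^+ 2 < x ^+ 2 by rewrite ltrXn2r ?nnegrE //; lra.
have : (1 - e / 2) ^+ 2 = 1 - e + e ^+ 2 / 4 by field.
by have := sqr_ge0 e; lra.
Qed.

(** For tau <= t <= pi / d the angle d t / 2 lies in [d tau / 2, pi / 2], where the sine is bounded
    below; [span_sin_le] carries this over to the double sum in |f(z)|^2. The minimum in [x0] covers
    an empty range of t. *)
Lemma trunc_gf_off_axis tau : 0 < tau -> exists e K1, [/\ 0 < e & forall K r t, (K1 <= K)%N ->
  0 <= r <= 1 -> tau <= t -> t <= pi / d%:R -> normc (ceval (trunc_gf p K) (polar r t)) <= 1 - e].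
Proof.
move=> tau0; have [J [C [C0 HC]]] := span_sin_le.
have [d1 _] := d_span; have d0 : 0 < d%:R :> R by rewrite ltr0n.
pose x0 := Num.min (d%:R * (tau / 2)) (pi / 2).
have x00 : 0 < x0 by rewrite lt_min !mulr_gt0 ?invr_gt0 // pi_gt0.
have p2 : 0 < pi :> R by exact: pi_gt0.
have x0p : x0 <= pi / 2 by rewrite ge_min lexx orbT.
have s0 : 0 < sin x0 by apply: sin_gt0_pi; rewrite x00 /=; lra.
pose e := Num.min 1 (sin x0 ^+ 2 / C).
have e0 : 0 < e by rewrite lt_min ltr01 divr_gt0 // exprn_gt0.
exists (e / 2), J; split; first by rewrite divr_gt0.
move=> K r t JK r01 taut td.
apply: le_of_sqr_le; first by rewrite (ltW e0) ge_min lexx.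
apply: le_trans (@normc_ceval_window _ r t 0 J 0 J (nneg_trunc_gf pl K) r01) _.
have f1 : (trunc_gf p K).[1] ^+ 2 <= 1.
  rewrite expr_le1 // ?(trunc_gf_le1 pl) ?ler01 ?lexx //.
  exact: nneg_horner (nneg_trunc_gf pl K) ler01.
apply: lerB => //; apply: (@le_trans _ _ (sin x0 ^+ 2 / C)); first by rewrite ge_min lexx orbT.
rewrite ler_pdivrMr // mulrC.
have -> : \sum_(0 <= j < J) \sum_(0 <= k < J) (trunc_gf p K)`_j * (trunc_gf p K)`_k *
    sin ((j%:R - k%:R) * (t / 2)) ^+ 2 = sin_form J (t / 2).
  rewrite /sin_form !big_nat; apply: eq_bigr => j /andP[_ jJ].
  rewrite !big_nat; apply: eq_bigr => k /andP[_ kJ].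
  by rewrite !coef_poly (leq_trans jJ JK) (leq_trans kJ JK).
apply: le_trans (HC (t / 2)).
have y1 : x0 <= d%:R * (t / 2).
  by rewrite ge_min; apply/orP; left; rewrite ler_wpM2l // ?ler_wpM2r // ltW.
have y2 : d%:R * (t / 2) <= pi / 2.
  by rewrite mulrA ler_wpM2r // mulrC -ler_pdivlMr.
rewrite lerXn2r ?nnegrE ?(ltW s0) //.
  by apply: sin_ge0_pi; apply/andP; split; lra.
have [->//|ne] := eqVneq x0 (d%:R * (t / 2)).
rewrite ltW // ltr_sin ?in_itv /=; first by rewrite lt_neqAle ne.
  by apply/andP; split; lra.
by apply/andP; split; lra.
Qed.
End OffAxis.

(** * Geometric decay of the derivative off the real axis *)

Section KeyEstimate.
Context {R : realType}.
Local Notation normc := (@ComplexField.Normc.normc R).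
Variables (p : nat -> R) (m : R) (d mu : nat) (q : nat -> nat -> R) (c : nat -> R).
Hypothesis pl : offspring_law p.
Hypothesis p_lt1 : forall j, p j < 1.
Hypothesis pm : offspring_mean p m.
Hypothesis m1 : 1 < m.
Hypothesis schroeder : 0 < p 0%N + p 1%N.
Hypothesis d_span : span_gcd p d.
Hypothesis mu_min : min_support p mu.
Hypothesis hq : forall n k, (fun K => (iter_gf p K n)`_k) @ \oo --> q n k.
Hypothesis c0 : c 0%N = 1.
Hypothesis cS : forall n, c n < c n.+1 /\ c n.+1 <= m * c n.
Hypothesis tight : forall e, 0 < e -> exists2 X : R, 0 < X &
  forall n, exists N : nat, N%:R <= X * c n /\ 1 - e <= \sum_(0 <= k < N) q n k.
Hypothesis window : forall x y : R, 0 < x -> x < y -> exists e n0, 0 < e /\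
  forall n, (n0 <= n)%N -> exists N N' : nat,
    [/\ x * c n <= N%:R, N'%:R <= y * c n & e <= \sum_(N <= k < N') q n k].

Let p0 j : 0 <= p j. Proof. by case: pl. Qed.
Let F K n := iter_gf p K n.
Let F0 K n : nneg_poly (F K n). Proof. exact: nneg_iter_gf. Qed.

Lemma scale_ge1 n : 1 <= c n.
Proof.
elim: n => [|n IH]; first by rewrite c0.
by apply: (le_trans IH); apply: ltW; case: (cS n).
Qed.

Lemma scale_gt0 n : 0 < c n.
Proof. exact: lt_le_trans (scale_ge1 n). Qed.

Lemma scale_le n n' : (n <= n')%N -> c n <= c n'.
Proof.
elim: n' => [|n' IH]; first by rewrite leqn0 => /eqP ->.
rewrite leq_eqVlt ltnS => /predU1P[->//|/IH H].
by apply: (le_trans H); apply: ltW; case: (cS n').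
Qed.

Lemma scale_le_exp n b : (b <= n)%N -> c n <= m ^+ (n - b) * c b.
Proof.
move=> bn; rewrite -{1}(subnK bn); elim: (n - b)%N => [|i IH]; first by rewrite add0n expr0 mul1r.
rewrite addSn exprS -mulrA; case: (cS (i + b)) => _ H; apply: (le_trans H).
by rewrite ler_wpM2l // ltW // (lt_trans ltr01).
Qed.

Lemma window_sum_cvg n N N' e : e < \sum_(N <= k < N') q n k -> exists K1, forall K, (K1 <= K)%N ->
  e <= \sum_(N <= k < N') (F K n)`_k.
Proof.
move=> He; set S := \sum_(_ <= _ < _) _ in He.
have : (fun K => \sum_(N <= k < N') (F K n)`_k) @ \oo --> S by apply: cvgn_sum => k; exact: hq.
have e0 : 0 < S - e by rewrite subr_gt0.
move=> /cvgn_distP/(_ _ e0)[K1 HK]; exists K1 => K /HK.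
by rewrite distrC => /ltr_normlW; lra.
Qed.

(** For these t, t c_b lies between 4 and 4 m. With [k0] = 1 / (4 m), the law of Z_b charges two
    windows near c_b whose points differ by k0 c_b to 2 k0 c_b; then (j - k) t / 2 lies between 1 /
    (2 m) and 1, away from the zeros of the sine. *)
Lemma iter_gf_off_axis_large : exists b0 e, 0 < e /\ forall b, (b0 <= b)%N -> (0 < b)%N ->
  exists K1, forall K r t, (K1 <= K)%N -> 0 <= r <= 1 ->
  4 / c b < t -> t <= 4 / c b.-1 -> normc (ceval (F K b) (polar r t)) <= 1 - e.
Proof.
have m0 : 0 < m by exact: lt_trans m1.
pose k0 := (4 * m)^-1.
have k00 : 0 < k0 by rewrite invr_gt0 mulr_gt0.
have [e1 [n1 [e10 H1]]] := @window 1 (1 + k0 / 2) ltr01 ltac:(lra).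
have [e2 [n2 [e20 H2]]] := @window (1 + 3 * k0 / 2) (1 + 2 * k0) ltac:(lra) ltac:(lra).
pose si := sin (2 * m)^-1 ^+ 2 : R.
have s1 : 0 < (2 * m)^-1 :> R by rewrite invr_gt0 mulr_gt0.
have s2 : (2 * m)^-1 <= 1 / 2 :> R.
  by rewrite invf_ple ?posrE ?mulr_gt0 // ?divr_gt0 //; have := m1; lra.
have pi2 := @pi_ge2 R.
have sin0' : 0 < sin (2 * m)^-1 :> R by apply: sin_gt0_pi; apply/andP; split; lra.
have si0 : 0 < si by rewrite exprn_gt0.
pose e := Num.min 1 (e1 / 2 * (e2 / 2) * si).
have e0 : 0 < e by rewrite lt_min ltr01 !mulr_gt0 ?invr_gt0.
exists (maxn n1 n2), (e / 2); split; first by rewrite divr_gt0.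
move=> b; rewrite geq_max => /andP[/H1[N1 [N1' [x1 y1 S1]]] /H2[N2 [N2' [x2 y2 S2]]]] b_0.
have [K1 HK1] := @window_sum_cvg b N1 N1' (e1 / 2) ltac:(lra).
have [K2 HK2] := @window_sum_cvg b N2 N2' (e2 / 2) ltac:(lra).
exists (maxn K1 K2) => K r t; rewrite geq_max => /andP[/HK1{}HK1 /HK2{}HK2] r01 t1 t2.
have cb0 := scale_gt0 b.
have cb : c b <= m * c b.-1 by case: (b) b_0 => // b' _; case: (cS b').
have T1 : 4 < t * c b by rewrite -ltr_pdivrMr.
have T2 : t * c b <= 4 * m.
  have cb'0 := scale_gt0 b.-1.
  have t0 : 0 <= t by rewrite (le_trans _ (ltW t1)) // divr_ge0 // ltW.
  apply: (@le_trans _ _ (t * (m * c b.-1))); first by rewrite ler_wpM2l.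
  by rewrite mulrCA [leRHS]mulrC ler_wpM2l ?(ltW m0) // -ler_pdivlMr.
have tpos : 0 < t by rewrite (lt_trans _ t1) // divr_gt0.
apply: le_of_sqr_le; first by rewrite (ltW e0) ge_min lexx.
apply: le_trans (@normc_ceval_window _ _ r t N2 N2' N1 N1' (F0 K b) r01) _.
have f1 : (F K b).[1] ^+ 2 <= 1.
  rewrite expr_le1 // ?(iter_gf_le1 pl) ?ler01 ?lexx //; exact: nneg_horner.
apply: lerB => //; apply: (@le_trans _ _ (e1 / 2 * (e2 / 2) * si)).
  by rewrite ge_min lexx orbT.
apply: (@le_trans _ _ ((\sum_(N1 <= k < N1') (F K b)`_k) * (\sum_(N2 <= k < N2') (F K b)`_k) * si)).
  rewrite ler_wpM2r ?(ltW si0) //; apply: ler_pM => //; rewrite divr_ge0 // ltW //.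
rewrite mulrAC mulrC !mulr_suml !big_nat; apply: ler_sum => j /andP[j1 j2].
rewrite mulrC !mulr_suml !big_nat; apply: ler_sum => k /andP[k1 k2].
rewrite [leLHS](_ : _ = (F K b)`_j * (F K b)`_k * si); last by ring.
rewrite ler_wpM2l ?mulr_ge0 ?F0 //.
have jl : (1 + 3 * k0 / 2) * c b <= j%:R by rewrite (le_trans x2) // ler_nat.
have ju : j%:R <= (1 + 2 * k0) * c b by rewrite (le_trans _ y2) // ler_nat ltnW.
have kl : 1 * c b <= k%:R by rewrite (le_trans x1) // ler_nat.
have ku : k%:R <= (1 + k0 / 2) * c b by rewrite (le_trans _ y1) // ler_nat ltnW.
have dl : k0 * c b <= j%:R - k%:R by move: jl ku; forget_after m0; lra.
have du : j%:R - k%:R <= 2 * k0 * c b by move: ju kl; forget_after m0; lra.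
have km : k0 * (4 * m) = 1 by rewrite /k0 mulVf // mulf_neq0 // lt0r_neq0.
have m2 : (2 * m)^-1 = 2 * k0 by rewrite /k0; field; rewrite lt0r_neq0.
have zl : (2 * m)^-1 <= (j%:R - k%:R) * (t / 2).
  have h1 := ler_wpM2r (ltW tpos) dl.
  have h2 : k0 * 4 <= k0 * (t * c b) by rewrite ler_wpM2l // ltW.
  by rewrite m2; move: h1 h2; forget_after m0; lra.
have zu : (j%:R - k%:R) * (t / 2) <= 1.
  have h1 := ler_wpM2r (ltW tpos) du.
  have h2 : k0 * (t * c b) <= k0 * (4 * m) by rewrite ler_wpM2l // ltW.
  by move: h1 h2 km; forget_after m0; lra.
rewrite /si lerXn2r ?nnegrE ?(ltW sin0') //.
  by apply: sin_ge0_pi; move: zl zu s1 pi2; forget_after m0; apply/andP; split; lra.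
have [<-//|ne] := eqVneq (2 * m)^-1 ((j%:R - k%:R) * (t / 2)).
rewrite ltW // ltr_sin ?in_itv /=; first by rewrite lt_neqAle ne.
  by move: s1 s2 pi2; forget_after m0; apply/andP; split; lra.
by move: zl zu s1 pi2; forget_after m0; apply/andP; split; lra.
Qed.

(** For b below the threshold [b0], t is bounded away from 0, so that |f(z)| <= 1 - e' < s already
    after one generation, and f_(b-1) maps [0, s] into itself. *)
Lemma iter_gf_off_axis : exists s0, [/\ 0 <= s0, s0 < 1 & forall b, (0 < b)%N ->
  exists K1, forall K r t, (K1 <= K)%N -> 0 <= r <= 1 ->
  4 / c b < t -> t <= 4 / c b.-1 -> t <= pi / d%:R -> normc (ceval (F K b) (polar r t)) <= s0].
Proof.
have [b0 [e [e0 He]]] := iter_gf_off_axis_large.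
have tau0 : 0 < 4 / c b0 by rewrite divr_gt0 // scale_gt0.
have [e' [K' [e'0 He']]] := trunc_gf_off_axis pl p_lt1 d_span tau0.
have [s [kap [K0 [ss hs]]]] := contracts_exists pl pm m1 (s0 := 1 - e') ltac:(lra).
have [s_0 s_1 kap0 _] := hs.
exists (Num.max (1 - e) s); split.
- by rewrite le_max (ltW s_0) orbT.
- by rewrite gt_max s_1 andbT; lra.
move=> b b_0; have [b0b|bb0] := leqP b0 b.
  have [K1 HK1] := He b b0b b_0; exists K1 => K r t KK r01 t1 t2 _.
  by rewrite le_max HK1.
exists (maxn K' K0) => K r t; rewrite geq_max => /andP[KK' KK0] r01 t1 t2 t3.
rewrite le_max; apply/orP; right.
have -> : F K b = F K b.-1 \Po trunc_gf p K by case: (b) b_0.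
rewrite ceval_comp; apply: le_trans (normc_ceval_le _ (F0 _ _)) _.
have taut : 4 / c b0 <= t.
  apply: le_trans (ltW t1); rewrite ler_wpM2l // lef_pV2 ?posrE ?scale_gt0 //.
  exact: scale_le (ltnW bb0).
have H := He' K r t KK' r01 taut t3.
apply: le_trans (nneg_horner_le (F0 _ _) (normc_ge0 _) (le_trans H (ltW ss))) _.
exact: (iter_gf_le_contract pl hs).
Qed.

Lemma mul_expRN_le (x y : R) : 0 < y -> 0 <= x -> x * expR (- (x / y)) <= y.
Proof.
move=> y0 x0; rewrite expRN ler_pdivrMr ?expR_gt0 //.
have := expR_ge1Dx (x / y); have xy : x = y * (x / y) by field; rewrite lt0r_neq0.
move=> H; rewrite {1}xy ler_wpM2l ?(ltW y0) //; lra.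
Qed.

(** i r^i = i exp (- i v / c_a) <= c_a / v for each i, so total mass at most 1 suffices and no
    moment of Z_a enters. *)
Lemma iter_gf_deriv_radial_le K a v r : 0 < v -> r = expR (- (v / c a)) ->
  r * (F K a)^`().[r] <= c a / v.
Proof.
move=> v0 rE; have ca := scale_gt0 a.
have r0 : 0 < r by rewrite rE expR_gt0.
have r01 : 0 <= r <= 1.
  by rewrite (ltW r0) rE /= -expR0 ler_expR oppr_le0 divr_ge0 // ltW.
rewrite horner_deriv_coef mulr_sumr.
apply: (@le_trans _ _ (\sum_(i < size (F K a)) (F K a)`_i * (c a / v))); last first.
  rewrite -mulr_suml ler_piMl ?divr_ge0 ?(ltW ca) ?(ltW v0) //.
  apply: le_trans (iter_gf_le1 pl K a (x := 1) _); last by rewrite ler01 lexx.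
  by rewrite horner_coef; apply: ler_sum => i _; rewrite expr1n mulr1.
apply: ler_sum => i _; rewrite mulrCA ler_wpM2l ?F0 //.
case: i => -[|i] _ /=; first by rewrite mul0r mulr0 divr_ge0 // ltW.
rewrite mulrCA -exprS rE -expRM_natl mulrN.
apply: le_trans (@mul_expRN_le i.+1%:R (c a / v) _ _); rewrite ?divr_gt0 //.
by rewrite invf_div.
Qed.

(** On the range of arguments indexed by b, f_a' is f_(a-b)'(f_b) times f_b'. The first factor
    contributes rho^(a-b), the second is bounded by its value on the real axis, with a loss (m /
    M)^(a-b); [lam] is the product of the two rates. *)
Lemma key_bound : exists v C lam, [/\ 0 < v, 0 <= C, 0 <= lam < 1 & forall a, exists K1, forall K,
  (K1 <= K)%N -> let r := expR (- (v / c a)) in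
  (forall t, r * normc (ceval (F K a)^`() (polar r t)) <= C * c a) /\
  (forall t, 0 < t -> t <= pi / d%:R -> r * normc (ceval (F K a)^`() (polar r t)) <=
     \sum_(b < a.+1) C * c b * lam ^+ (a - b) * (t <= 4 * m / c b)%R%:R)].
Proof.
have [so [so0 so1 Hoff]] := iter_gf_off_axis.
have [s [kap [K0 [sos hs]]]] := contracts_exists pl pm m1 so1.
have [s_0 s_1 kap0 _] := hs.
have [rho0 rho1] := contracts_rate pl hs.
set rho := 1 - kap in rho0 rho1; have rhoE : rho = 1 - kap by [].
clearbody rho.
have m0 : 0 < m by exact: lt_trans m1.
(* M is below m, but so close that rho m / M = 2 rho / (1 + rho) < 1. *)
pose M := m * ((1 + rho) / 2).
have M0 : 0 < M by rewrite mulr_gt0 // divr_gt0 // addr_gt0.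
have Mm : M < m by rewrite gtr_pMr //; lra.
have [x [_ x0 x1 [K2 HK2]]] := deriv_trunc_gf_near1 pl pm Mm ltr01.
have x1' : 0 < 1 - x by rewrite subr_gt0.
(* Chosen so that (1 - 2 eta) (1 - eta) >= 1 - 4 eta = x. *)
pose eta := (1 - x) / 4.
have eta0 : 0 < eta by rewrite divr_gt0 // subr_gt0.
have [X X0 HX] := tight eta0.
(* Then r^N >= 1 - eta for every N <= X c_i with i <= a, where r = exp (- v / c_a). *)
pose v := eta / X.
have v0 : 0 < v by rewrite divr_gt0.
pose lam := rho * (m / M).
have lamE : lam = 2 * rho / (1 + rho).
  by rewrite /lam /M; field; rewrite !lt0r_neq0 // addr_gt0.
have lam0 : 0 <= lam by rewrite mulr_ge0 ?divr_ge0 // ltW.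
have lam1 : lam < 1 by rewrite lamE ltr_pdivrMr ?addr_gt0 //; lra.
pose C := v^-1 + (v * (s - so))^-1.
have sso : 0 < s - so by rewrite subr_gt0.
have C1 : v^-1 <= C by rewrite lerDl invr_ge0 mulr_ge0 // ltW.
have C2 : (v * (s - so))^-1 <= C by rewrite lerDr invr_ge0 ltW.
have C0 : 0 <= C by apply: le_trans C1; rewrite invr_ge0 ltW.
exists v, C, lam; split=> //; first by rewrite lam0.
move=> a; have ca := scale_gt0 a.
set r := expR (- (v / c a)).
have r0 : 0 < r by exact: expR_gt0.
have r01 : 0 <= r <= 1.
  by rewrite (ltW r0) /= -expR0 ler_expR oppr_le0 divr_ge0 // ltW.
have radial : exists K1, forall K i, (K1 <= K)%N -> (i <= a)%N -> x <= (F K i).[r].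
  have one i : exists K1, forall K, (K1 <= K)%N -> (i <= a)%N -> x <= (F K i).[r].
    have [N [NX HN]] := HX i.
    have [K1 HK1] := @window_sum_cvg i 0 N (1 - 2 * eta) ltac:(lra).
    exists K1 => K /HK1{}HK1 ia.
    have rN : 1 - eta <= r ^+ N.
      rewrite -expRM_natl; apply: le_trans (expR_ge1Dx _).
      rewrite lerD2l mulrN lerN2 mulrA ler_pdivrMr //.
      apply: (@le_trans _ _ (X * c i * v)); first by rewrite ler_wpM2r // ltW.
      have -> : X * c i * v = eta * c i by rewrite /v; field; rewrite lt0r_neq0.
      by rewrite ler_wpM2l ?(ltW eta0) // scale_le.
    have H : (\sum_(0 <= k < N) (F K i)`_k) * r ^+ N <= (F K i).[r].
      rewrite horner_coef mulr_suml.
      apply: (@le_trans _ _ (\sum_(0 <= k < N) (F K i)`_k * r ^+ k)).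
        rewrite !big_nat; apply: ler_sum => k /andP[_ kN].
        case/andP: r01 => _ r_1; apply: ler_wpM2l; first exact: F0.
        by apply: ler_wiXn2l => //; [exact: ltW|exact: ltnW].
      apply: (@sum_range_le _ (fun k => (F K i)`_k * r ^+ k)) => k.
        by rewrite mulr_ge0 ?exprn_ge0 ?F0 // ltW.
      by move=> Hk; rewrite nth_default // mul0r.
    apply: le_trans H.
    have H1 : (1 - 2 * eta) * (1 - eta) <= (\sum_(0 <= k < N) (F K i)`_k) * r ^+ N.
      have eta1 : eta <= 1 / 4 by move: x0; forget_after so; rewrite /eta; lra.
      by apply: ler_pM => //; move: eta1; forget_after so; lra.
    apply: le_trans H1; rewrite /eta.
    have H2 := mulr_ge0 (ltW x1') (ltW x1').
    by move: H2 x1'; forget_after so; lra.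
  have [Kf HKf] := choice one.
  exists (\max_(i < a.+1) Kf i) => K i KK ia; apply: (HKf i K _ ia); apply: leq_trans KK.
  exact: (leq_bigmax (Ordinal (ia : (i < a.+1)%N))).
have [K3 HK3] := radial.
have offK : exists K1, forall K b t, (K1 <= K)%N -> (0 < b)%N -> (b <= a)%N ->
    4 / c b < t -> t <= 4 / c b.-1 -> t <= pi / d%:R -> normc (ceval (F K b) (polar r t)) <= so.
  have one b : exists K1, forall K t, (K1 <= K)%N -> (0 < b)%N ->
      4 / c b < t -> t <= 4 / c b.-1 -> t <= pi / d%:R -> normc (ceval (F K b) (polar r t)) <= so.
    case: (posnP b) => [->|b0]; first by exists 0%N.
    have [K1 HK1] := Hoff b b0; exists K1 => K t KK _ t1 t2 t3; exact: HK1.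
  have [Kf HKf] := choice one.
  exists (\max_(i < a.+1) Kf i) => K b t KK b0 ba; apply: (HKf b K t _ b0); apply: leq_trans KK.
  exact: (leq_bigmax (Ordinal (ba : (b < a.+1)%N))).
have [K4 HK4] := offK.
exists (maxn (maxn K0 K2) (maxn K3 K4)) => K.
rewrite !geq_max => /andP[/andP[KK0 KK2] /andP[KK3 KK4]].
have rad := @iter_gf_deriv_radial_le K a v r v0 erefl.
have base t : r * normc (ceval (F K a)^`() (polar r t)) <= C * c a.
  apply: (@le_trans _ _ (r * (F K a)^`().[r])).
    rewrite ler_wpM2l ?(ltW r0) //.
    apply: le_trans (normc_ceval_le _ (nneg_poly_deriv (F0 _ _))) _.
    by rewrite normc_polar // ltW.
  by apply: le_trans rad _; rewrite mulrC ler_wpM2r // ltW.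
split=> // t t0 td.
have term_ge0 b : 0 <= C * c b * lam ^+ (a - b) * (t <= 4 * m / c b)%R%:R.
  by rewrite !mulr_ge0 ?exprn_ge0 // ltW // scale_gt0.
have pick b : (b <= a)%N -> t <= 4 * m / c b -> forall y, y <= C * c b * lam ^+ (a - b) ->
   y <= \sum_(b < a.+1) C * c b * lam ^+ (a - b) * (t <= 4 * m / c b)%R%:R.
  move=> ba tb y Hy; rewrite (bigD1 (Ordinal (ba : (b < a.+1)%N))) //= tb mulr1.
  by apply: (le_trans Hy); rewrite lerDl; apply: sumr_ge0 => i _; exact: term_ge0.
have [ta|ta] := leP t (4 / c a).
  apply: (pick a) => //; last by rewrite subnn expr0 mulr1.
  apply: (le_trans ta); rewrite ler_wpM2r ?invr_ge0 ?(ltW ca) //.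
  by rewrite ler_peMr // ltW.
have t4 : t <= 4.
  apply: (le_trans td); have [d0 _] := d_span.
  have d1 : 1 <= d%:R :> R by rewrite ler1n.
  rewrite ler_pdivrMr ?(lt_le_trans ltr01) //.
  have h := @pihalf_lt2 R; move: h d1; forget_after so; lra.
(* The least index with 4 / c_b < t; it is positive because t <= pi / d <= 4 = 4 / c_0. *)
have [b [b0 ba tb1 tb2]] : exists b, [/\ (0 < b)%N, (b <= a)%N, 4 / c b < t & t <= 4 / c b.-1].
  have exb : exists b, 4 / c b < t by exists a.
  have [b Hb bmin] := ex_minnP exb.
  have b0 : (0 < b)%N.
    rewrite lt0n; apply: contraTneq Hb => ->; rewrite c0 divr1 -leNgt //.
  exists b; split=> //; first exact: bmin.
  rewrite leNgt; apply/negP => /bmin; rewrite leqNgt ltn_predL b0 //.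
have cb := scale_gt0 b.
apply: (pick b) => //.
  apply: (le_trans tb2).
  have cb' : c b <= m * c b.-1 by case: (b) b0 => // b' _; case: (cS b').
  rewrite ler_pdivrMr ?scale_gt0 // mulrAC ler_pdivlMr //.
  by rewrite -mulrA ler_wpM2l.
have off := HK4 K b t KK4 b0 ba tb1 tb2 td.
have Fab : F K a = F K (a - b) \Po F K b by rewrite /F -iter_gfD subnK.
(* All real iterates f_i(r) with i <= a are at least x, so every factor of f_(a-b)'(f_b(r)) exceeds
   M; dividing the bound on f_a'(r) by this product bounds f_b'(r). *)
have low : M ^+ (a - b) <= (F K (a - b))^`().[(F K b).[r]].
  rewrite {1}/F iter_gf_deriv -[X in M ^+ X]card_ord -prodr_const /F.
  apply: ler_prod => i _; rewrite (ltW M0) /=.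
  rewrite -[(iter_gf p K i).[_] ]horner_comp -iter_gfD; apply: ltW.
  apply: lt_le_trans (HK2 K KK2) _.
  apply: nneg_horner_le (nneg_poly_deriv (nneg_trunc_gf pl K)) (ltW x0) _.
  have iba : (i + b <= a)%N by rewrite addnC -leq_subRL // ltnW // ltn_ord.
  exact: (HK3 K (i + b)%N KK3 iba).
have rFb : r * (F K b)^`().[r] <= c b * (m / M) ^+ (a - b) / v.
  have Fr0 : 0 <= r * (F K b)^`().[r].
    by rewrite mulr_ge0 ?(ltW r0) // nneg_horner ?(ltW r0) //; exact: nneg_poly_deriv.
  have H1 : M ^+ (a - b) * (r * (F K b)^`().[r]) <= c a / v.
    apply: le_trans rad.
    by rewrite Fab deriv_comp hornerM horner_comp [leRHS]mulrCA ler_wpM2r.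
  rewrite -(@ler_pM2l _ (M ^+ (a - b))) ?exprn_gt0 //; apply: (le_trans H1).
  rewrite expr_div_n [leRHS](_ : _ = m ^+ (a - b) * c b / v); last first.
    by field; rewrite expf_neq0 ?lt0r_neq0.
  by rewrite ler_wpM2r ?invr_ge0 ?(ltW v0) // scale_le_exp.
rewrite Fab deriv_comp cevalM ComplexField.Normc.normcM ceval_comp.
set A := normc _; set B := normc _.
have HA : A <= rho ^+ (a - b) / (s - so).
  apply: le_trans (normc_ceval_le _ (nneg_poly_deriv (F0 _ _))) _.
  apply: le_trans (nneg_horner_le (nneg_poly_deriv (F0 _ _)) (normc_ge0 _) off) _.
  by rewrite rhoE; apply: (iter_gf_deriv_contract pl hs) => //; rewrite so0.
have HB : r * B <= c b * (m / M) ^+ (a - b) / v.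
  apply: le_trans rFb; rewrite ler_wpM2l ?(ltW r0) //.
  apply: le_trans (normc_ceval_le _ (nneg_poly_deriv (F0 _ _))) _.
  by rewrite normc_polar // ltW.
rewrite mulrCA.
apply: (@le_trans _ _ (rho ^+ (a - b) / (s - so) * (c b * (m / M) ^+ (a - b) / v))).
  by apply: ler_pM => //; rewrite ?normc_ge0 // mulr_ge0 ?normc_ge0 // ltW.
have -> : lam ^+ (a - b) = rho ^+ (a - b) * (m / M) ^+ (a - b) by rewrite -exprMn.
have alg (z1 z2 z3 z4 z5 : R) : z1 * z2 * (z5 * z3 * z4) = (z4 * z2) * (z5 * (z1 * z3)) by ring.
rewrite [leLHS]alg -invfM.
rewrite -[leRHS]mulrA ler_wpM2r //.
by rewrite !mulr_ge0 ?exprn_ge0 ?divr_ge0 // ltW.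
Qed.
End KeyEstimate.

(** * Boundedness and equicontinuity of the weighted point masses *)

Section Smoothness.
Context {R : realType}.
Local Notation normc := (@ComplexField.Normc.normc R).
Variables (p : nat -> R) (m : R) (d mu : nat) (q : nat -> nat -> R) (c : nat -> R).
Hypothesis pl : offspring_law p.
Hypothesis p_lt1 : forall j, p j < 1.
Hypothesis pm : offspring_mean p m.
Hypothesis m1 : 1 < m.
Hypothesis schroeder : 0 < p 0%N + p 1%N.
Hypothesis d_span : span_gcd p d.
Hypothesis mu_min : min_support p mu.
Hypothesis hq : forall n k, (fun K => (iter_gf p K n)`_k) @ \oo --> q n k.
Hypothesis c0 : c 0%N = 1.
Hypothesis cS : forall n, c n < c n.+1 /\ c n.+1 <= m * c n.
Hypothesis tight : forall e, 0 < e -> exists2 X : R, 0 < X &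
  forall n, exists N : nat, N%:R <= X * c n /\ 1 - e <= \sum_(0 <= k < N) q n k.
Hypothesis window : forall x y : R, 0 < x -> x < y -> exists e n0, 0 < e /\
  forall n, (n0 <= n)%N -> exists N N' : nat,
    [/\ x * c n <= N%:R, N'%:R <= y * c n & e <= \sum_(N <= k < N') q n k].

Let F K n := iter_gf p K n.
Let F0 K n : nneg_poly (F K n). Proof. exact: nneg_iter_gf. Qed.
Let ca_gt0 := scale_gt0 c0 cS.

Lemma sum_geometric_rev_le (lam : R) a : 0 <= lam < 1 ->
  \sum_(b < a.+1) lam ^+ (a - b) <= (1 - lam)^-1.
Proof.
move=> l01; rewrite (reindex_inj rev_ord_inj) /=.
rewrite (eq_bigr (fun b : 'I_a.+1 => lam ^+ b)); first exact: sum_geometric_le.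
by move=> b _; rewrite subSS subKn // -ltnS.
Qed.

Lemma ltn_double_succ n k : (n <= k)%N -> (n < k.*2.+1)%N.
Proof. by move=> nk; rewrite ltnS -addnn (leq_trans nk) // leq_addl. Qed.

(** In [sum_steps_le] the weight c_b of range b meets its length 4 m / c_b, which leaves the
    geometric series of [lam]. For a difference, the ranges with a - b >= J use the factor 2 and
    contribute O(lam^J); on the others c_a <= m^J c_b, and |t| |l - l'| is small. *)
Lemma law_smooth : exists v B : R, [/\ 0 < v,
  forall a l, (0 < a)%N -> l%:R * q a l * expR (- (v / c a)) ^+ l <= B &
  forall e, 0 < e -> exists2 eta : R, 0 < eta & forall a l l', (0 < a)%N ->
    l = mu %[mod d] -> l' = mu %[mod d] -> `|l%:R - l'%:R| <= eta * c a ->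
    `|l%:R * q a l * expR (- (v / c a)) ^+ l - l'%:R * q a l' * expR (- (v / c a)) ^+ l'| <= e].
Proof.
have [v [C [lam [v0 C0 lam01 Hkey]]]] :=
  key_bound pl p_lt1 pm m1 d_span hq c0 cS tight window.
have [lam0 lam1] := andP lam01.
have m0 : 0 < m by exact: lt_trans m1.
have [d0 _] := d_span.
have p2 := @pi_gt0 R.
have dp0 : 0 < d%:R / pi :> R by rewrite divr_gt0 // ltr0n.
pose w a b := C * c b * lam ^+ (a - b).
have w0 a b : 0 <= w a b by rewrite !mulr_ge0 ?exprn_ge0 // ltW.
pose X b := 4 * m / c b.
have X0 b : 0 <= X b by rewrite divr_ge0 ?mulr_ge0 // ltW.
have wX a b : w a b * X b = 4 * m * C * lam ^+ (a - b).
  by rewrite /w /X; field; rewrite lt0r_neq0.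
have mC0 : 0 <= 4 * m * C by rewrite !mulr_ge0 // ltW.
have cvgG a l : (fun K => l%:R * (F K a)`_l * expR (- (v / c a)) ^+ l) @ \oo -->
    l%:R * q a l * expR (- (v / c a)) ^+ l.
  apply: cvgM; last exact: cvg_cst.
  by apply: cvgM; [exact: cvg_cst|exact: hq].
have alg (D N' P S : R) : P != 0 -> 2 * (D * N' / (2 * P) * S) = N' * (D / P * S).
  by move=> P0; field.
pose B := C + d%:R / pi * (4 * m * C * (1 - lam)^-1).
have B0 : 0 <= B.
  by rewrite addr_ge0 // mulr_ge0 ?(ltW dp0) // mulr_ge0 // invr_ge0 subr_ge0 ltW.
exists v, B; split=> //.
  move=> a l a0; apply: (cvgn_le_cst (cvgG a l)).
  have [K1 HK1] := Hkey a; exists K1 => K /HK1 /= [Hb Hs].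
  set r := expR (- (v / c a)) in Hb Hs *.
  have r0 : 0 <= r by exact: expR_ge0.
  have [->|Fl] := eqVneq (F K a)`_l 0; first by rewrite mulr0 mul0r.
  have Fmod k := @iter_gf_mod R p pl d mu d_span mu_min schroeder K a k a0.
  (* The summand [Num.bound (c a)] makes N >= c_a, so that the sample at argument 0, of size at most
     C c_a, is at most C after division by N. *)
  pose M := (size (F K a) + l + Num.bound (c a))%N; set N := M.*2.+1.
  have N0 : 0 < N%:R :> R by rewrite ltr0n.
  have NcA : c a <= N%:R.
    apply: (le_trans (ltW (archi_boundP (ltW (ca_gt0 a))))).
    by rewrite ler_nat ltnW // ltn_double_succ // leq_addl.
  have Ms : (size (F K a) < N)%N by rewrite ltn_double_succ // /M -addnA leq_addr.
  have Ml : (l < N)%N by rewrite ltn_double_succ // /M addnAC leq_addl.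
  have four := @coef_fourier R (F K a) r d mu l M d0 Fmod (Fmod l Fl) (ltnW Ms) Ml.
  rewrite -/N in four.
  have steps := @sum_steps_le R (fun t => r * normc (ceval (F K a)^`() (polar r t))) d M a.+1
    (w a) X d0 (w0 a) X0 Hs.
  rewrite -/N in steps.
  rewrite -(@ler_pM2l _ N%:R) // four.
  apply: (@le_trans _ _ (C * c a + 2 * (d%:R * N%:R / (2 * pi) * (4 * m * C * (1 - lam)^-1)))).
    apply: lerD.
      exact: (le_trans (ler_norm _) (le_trans (shifted_cosum_le _ _ _ r0) (Hb 0))).
    rewrite ler_wpM2l //.
    apply: le_trans (le_trans steps _).
      apply: ler_sum => i _; apply: (le_trans (ler_norm _)); exact: shifted_cosum_le.
    rewrite ler_wpM2l //; first by rewrite divr_ge0 ?mulr_ge0 // ltW.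
    under eq_bigr do rewrite wX.
    by rewrite -mulr_sumr ler_wpM2l // sum_geometric_rev_le.
  rewrite /B [leRHS]mulrDr; apply: lerD; first by rewrite mulrC ler_wpM2r.
  by rewrite alg // lt0r_neq0.
move=> e e0.
pose S := d%:R / pi * (4 * m * C) * (1 - lam)^-1.
have S0 : 0 <= S.
  by rewrite mulr_ge0 // ?invr_ge0 ?subr_ge0 ?(ltW lam1) // mulr_ge0 // ltW.
have [J HJ] : exists J, 2 * lam ^+ J * S <= e / 2.
  have : geometric (2 * S) lam @ \oo --> (0 : R).
    by apply: cvg_geometric; rewrite ger0_norm.
  move=> /cvgn_distP/(_ (e / 2) ltac:(lra))[J /(_ J (leqnn _))].
  by rewrite subr0 => /ltr_normlW /ltW H; exists J; rewrite mulrAC.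
pose eta := (e / 2) / (4 * m * m ^+ J * (S + 1)).
have den0 : 0 < 4 * m * m ^+ J * (S + 1).
  by rewrite !mulr_gt0 ?exprn_gt0 // ltr_wpDl.
have eta0 : 0 < eta by rewrite divr_gt0 // divr_gt0.
have mJ0 : 0 < 4 * m * m ^+ J by rewrite mulr_gt0 ?exprn_gt0 // mulr_gt0.
exists eta => // a l l' a0 lmu l'mu ll'.
apply: (@cvgn_le_cst _ (fun K => `|l%:R * (F K a)`_l * expR (- (v / c a)) ^+ l -
   l'%:R * (F K a)`_l' * expR (- (v / c a)) ^+ l'|)).
  by apply: cvg_norm; apply: cvgB.
have [K1 HK1] := Hkey a; exists K1 => K /HK1 /= [Hb Hs].
set r := expR (- (v / c a)) in Hb Hs *.
have r0 : 0 <= r by exact: expR_ge0.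
have Fmod k := @iter_gf_mod R p pl d mu d_span mu_min schroeder K a k a0.
pose M := (size (F K a) + l + l')%N; set N := M.*2.+1.
have N0 : 0 < N%:R :> R by rewrite ltr0n.
have Ms : (size (F K a) < N)%N by rewrite ltn_double_succ // /M -addnA leq_addr.
have Ml : (l < N)%N by rewrite ltn_double_succ // /M addnAC leq_addl.
have Ml' : (l' < N)%N by rewrite ltn_double_succ // leq_addl.
have four := @coef_fourier R (F K a) r d mu l M d0 Fmod lmu (ltnW Ms) Ml.
have four' := @coef_fourier R (F K a) r d mu l' M d0 Fmod l'mu (ltnW Ms) Ml'.
rewrite -/N in four four'.
pose D := `|l%:R - l'%:R| : R.
have D0 : 0 <= D by exact: normr_ge0.
pose w' b := w a b * Num.min 2 (X b * D).
have w'0 b : 0 <= w' b by rewrite mulr_ge0 // le_min ler0n mulr_ge0.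
have Hs' t : 0 < t -> t <= pi / d%:R ->
    Num.min 2 (`|t| * D) * (r * normc (ceval (F K a)^`() (polar r t))) <=
    \sum_(b < a.+1) w' b * (t <= X b)%R%:R.
  move=> t0 td; have mn : 0 <= Num.min 2 (`|t| * D) by rewrite le_min ler0n mulr_ge0.
  apply: le_trans (ler_wpM2l mn (Hs t t0 td)) _; rewrite mulr_sumr; apply: ler_sum => b _.
  rewrite -/(w a b) -/(X b) /w' -mulrA mulrCA ler_wpM2l //.
  have [tX|tX] := leP t (X b); last by rewrite !mulr0.
  rewrite !mulr1 le_min !ge_min lexx /=; apply/orP; right.
  by rewrite ger0_norm ?(ltW t0) // ler_wpM2r.
have steps := @sum_steps_le R (fun t => Num.min 2 (`|t| * D) *
    (r * normc (ceval (F K a)^`() (polar r t)))) d M a.+1 w' X d0 w'0 X0 Hs'.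
rewrite -/N in steps.
rewrite -(@ler_pM2l _ N%:R) // -[N%:R in leLHS](gtr0_norm N0) -normrM mulrBr four four'.
(* The sample at argument 0 does not depend on l and cancels. *)
have -> : shifted_cosum (F K a) r l 0 = shifted_cosum (F K a) r l' 0.
  by apply: eq_bigr => k _; rewrite !mul0r.
rewrite opprD addrACA subrr add0r -mulrBr -sumrB normrM ger0_norm //.
apply: (@le_trans _ _ (2 * (d%:R * N%:R / (2 * pi) * \sum_(b < a.+1) w' b * X b))).
  rewrite ler_wpM2l //; apply: le_trans steps.
  apply: (le_trans (ler_norm_sum _ _ _)); apply: ler_sum => i _.
  exact: shifted_cosum_sub_le.
have -> : 2 * (d%:R * N%:R / (2 * pi) * \sum_(b < a.+1) w' b * X b) =
    N%:R * (d%:R / pi * \sum_(b < a.+1) w' b * X b) :> R.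
  by rewrite alg // lt0r_neq0.
rewrite ler_wpM2l ?(ltW N0) //.
have termle b : (b < a.+1)%N -> w' b * X b <=
    4 * m * C * (lam ^+ (a - b) * (4 * m * m ^+ J * eta + 2 * lam ^+ J * 0)) +
    4 * m * C * (2 * lam ^+ J * (lam ^+ (a - b - J) * (J <= a - b)%N%:R)).
  move=> ba; rewrite /w' mulrAC wX mulr0 addr0.
  have [Jab|Jab] := leqP J (a - b).
    apply: (@le_trans _ _ (4 * m * C * lam ^+ (a - b) * 2)).
      by rewrite ler_wpM2l ?ge_min ?lexx // mulr_ge0 // exprn_ge0.
    rewrite mulr1 -{1}(subnK Jab) exprD.
    rewrite [leLHS](_ : _ = 4 * m * C * (2 * lam ^+ J * lam ^+ (a - b - J))); last by ring.
    by rewrite lerDr mulr_ge0 // mulr_ge0 ?exprn_ge0 // mulr_ge0 // ltW.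
  rewrite mulr0 !mulr0 addr0 -[leLHS]mulrA ler_wpM2l // ler_wpM2l ?exprn_ge0 //.
  apply: (@le_trans _ _ (X b * D)); first by rewrite ge_min lexx orbT.
  have cab : c a <= m ^+ J * c b.
    apply: le_trans (scale_le_exp m1 cS (ba : (b <= a)%N)) _.
    rewrite ler_wpM2r ?(ltW (ca_gt0 _)) //; apply: ler_weXn2l; [exact: ltW|exact: ltnW].
  rewrite /X mulrAC ler_pdivrMr //.
  apply: (@le_trans _ _ (4 * m * (eta * (m ^+ J * c b)))).
    rewrite ler_wpM2l ?mulr_ge0 ?(ltW m0) //; apply: (le_trans ll').
    by rewrite ler_wpM2l // ltW.
  by rewrite le_eqVlt; apply/orP; left; apply/eqP; ring.
apply: (@le_trans _ _ (d%:R / pi * (4 * m * C * ((1 - lam)^-1 * (4 * m * m ^+ J * eta)) +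
    4 * m * C * (2 * lam ^+ J * (1 - lam)^-1)))).
  rewrite ler_wpM2l ?(ltW dp0) //.
  apply: (le_trans (ler_sum (index_enum 'I_a.+1) (fun b _ => termle b (ltn_ord b)))).
  rewrite big_split /= -!mulr_sumr; apply: lerD.
    rewrite ler_wpM2l // mulr0 addr0 -mulr_suml ler_wpM2r ?sum_geometric_rev_le //.
    by rewrite mulr_ge0 // ltW.
  rewrite ler_wpM2l // ler_wpM2l ?mulr_ge0 ?exprn_ge0 //.
  have [aJ|Ja] := ltnP a J.
    rewrite big1 ?invr_ge0 ?subr_ge0 ?(ltW lam1) // => b _.
    by rewrite leqNgt (leq_ltn_trans (leq_subr _ _) aJ) mulr0.
  apply: le_trans (sum_geometric_rev_le (a - J) lam01).
  have sJ : ((a - J).+1 <= a.+1)%N by rewrite ltnS leq_subr.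
  rewrite (big_ord_widen a.+1 (fun b => lam ^+ (a - J - b)) sJ) [leRHS]big_mkcond.
  apply: ler_sum => b _; have -> : (b < (a - J).+1)%N = (J <= a - b)%N.
    have ba : (b <= a)%N by rewrite -ltnS.
    by rewrite ltnS (leq_subRL _ Ja) (leq_subRL _ ba) addnC.
  case: leqP => H; last by rewrite mulr0.
  by rewrite mulr1 subnAC.
have HetaE : S * (4 * m * m ^+ J * eta) <= e / 2.
  have S1 : 0 < S + 1 by rewrite ltr_wpDl.
  have -> : 4 * m * m ^+ J * eta = e / 2 / (S + 1).
    rewrite /eta [_ * (S + 1)]mulrC; move: mJ0 S1; generalize (4 * m * m ^+ J) (S + 1) => k z k0 z0.
    by field; rewrite !lt0r_neq0.
  rewrite mulrCA ler_piMr //; first by rewrite divr_ge0 // ltW.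
  by rewrite ler_pdivrMr // mul1r lerDl.
have := lerD HetaE HJ; rewrite /S => Hsum.
rewrite [leLHS](_ : _ = S * (4 * m * m ^+ J * eta) + 2 * lam ^+ J * S); last by rewrite /S; ring.
by rewrite /S; move: Hsum; forget_after v; lra.
Qed.
End Smoothness.

(** * The law of the process and its scaling limit *)

Section UniformContinuity.
Context {R : realType}.

(** Compactness of [a, b]. Only x is confined to it; y may lie outside, which avoids edge cases for
    intervals that overlap the ends. *)
Lemma uniform_continuity_itv (f : R -> R) (a b : R) :
  (forall x, a <= x <= b -> {for x, continuous f}) -> forall e, 0 < e ->
  exists2 delta, 0 < delta & forall x y, a <= x <= b -> `|x - y| < delta -> `|f x - f y| < e.
Proof.
move=> cf e e0.
have /compact_near_coveringP cpt := @segment_compact R a b.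
have := @cpt R 0^'+ (fun delta x => forall y, `|x - y| < delta -> `|f x - f y| < e) _.
move=> H; have {H} : \forall delta \near 0^'+, forall x, `[a, b]%classic x ->
    forall y, `|x - y| < delta -> `|f x - f y| < e.
  apply: H => x /=; rewrite in_itv /= => xab.
  have /cvgrPdist_lt/(_ (e / 2)) := cf x xab; rewrite divr_gt0 // => /(_ isT).
  move=> /nbhs_ballP[r /= r0 Hr].
  exists (ball x (r / 2), [set delta | delta < r / 2]) => /=.
    split; first by apply: nbhsx_ballx; rewrite divr_gt0.
    by apply: nbhs_right_lt; rewrite divr_gt0.
  move=> [x' delta] /= [xx' dr] y x'y.
  rewrite /ball /= in xx'.
  have h1 : `|f x - f x'| < e / 2 by apply: Hr; rewrite /ball /=; have := r0; lra.
  have h2 : `|f x - f y| < e / 2.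
    apply: Hr; rewrite /ball /=.
    have -> : x - y = (x - x') + (x' - y) by ring.
    by apply: le_lt_trans (ler_normD _ _) _; lra.
  have -> : f x' - f y = - (f x - f x') + (f x - f y) by ring.
  by apply: le_lt_trans (ler_normD _ _) _; rewrite normrN; lra.
move=> H; have [delta [d0 Hd]] : exists delta : R, 0 < delta /\ forall x, `[a, b]%classic x ->
    forall y, `|x - y| < delta -> `|f x - f y| < e.
  near (0 : R)^'+ => delta; exists delta; split; near: delta; last exact: H.
  exact: nbhs_right_gt.
exists delta => // x y xab; apply: Hd; by rewrite /= in_itv.
Unshelve. all: by end_near. Qed.

Lemma continuous_at_of_within (w : R -> R) x : {within `]0, +oo[, continuous w} -> 0 < x ->
  {for x, continuous w}.
Proof.
move=> cw x0; have := cw; rewrite continuous_open_subspace; last exact: interval_open.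
by apply; rewrite inE /= in_itv /= x0.
Qed.
End UniformContinuity.

Section RealProbability.
Context {R : realType} {dT : measure_display} {T : measurableType dT}.
Variable P : probability T R.
Implicit Types (A B : set T).

Definition pr A : R := fine (P A).

Lemma prE A : measurable A -> P A = (pr A)%:E.
Proof. by move=> mA; rewrite /pr fineK //; exact: fin_num_measure. Qed.

Lemma pr_ge0 A : 0 <= pr A.
Proof. exact/fine_ge0/measure_ge0. Qed.

Lemma pr_setT : pr setT = 1.
Proof. by rewrite /pr probability_setT. Qed.

Lemma pr_set0 : pr set0 = 0.
Proof. by rewrite /pr measure0. Qed.

Lemma pr_le A B : measurable A -> measurable B -> A `<=` B -> pr A <= pr B.
Proof.
move=> mA mB AB; rewrite -lee_fin -!prE //.
by apply: le_measure => //; rewrite inE.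
Qed.

Lemma pr_le1 A : measurable A -> pr A <= 1.
Proof. by move=> mA; rewrite -pr_setT; apply: pr_le. Qed.

Lemma pr_setU_le A B : measurable A -> measurable B -> pr (A `|` B) <= pr A + pr B.
Proof.
move=> mA mB; rewrite -lee_fin EFinD -!prE //; last exact: measurableU.
by apply: measureU2.
Qed.

Lemma pr_setU A B : measurable A -> measurable B -> A `&` B = set0 ->
  pr (A `|` B) = pr A + pr B.
Proof.
move=> mA mB AB; apply/EFin_inj; rewrite EFinD -!prE //; last exact: measurableU.
exact: measureU.
Qed.

Lemma pr_bigcup (F : nat -> set T) : (forall i, measurable (F i)) -> trivIset setT F ->
  series (pr \o F) @ \oo --> pr (\bigcup_i F i).
Proof.
move=> mF tF; have mU : measurable (\bigcup_i F i) by exact: bigcup_measurable.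
have : (fun n => \sum_(0 <= i < n) P (F i))%E @ \oo --> (pr (\bigcup_i F i))%:E.
  by rewrite -prE //; exact: measure_semi_sigma_additive.
move=> /fine_cvg H; rewrite (_ : series _ = fine \o (fun n => \sum_(0 <= i < n) P (F i))%E) //.
apply/funext => n; rewrite /series /= -sum_fine // => i _.
exact: fin_num_measure.
Qed.

Lemma pr_decreasing (F : nat -> set T) : (forall i, measurable (F i)) ->
  (forall i j, (i <= j)%N -> F j `<=` F i) -> \bigcap_i F i = set0 ->
  pr \o F @ \oo --> (0 : R).
Proof.
move=> mF dF F0; have mI : measurable (\bigcap_i F i) by rewrite F0.
have : P \o F @ \oo --> P (\bigcap_i F i).
  apply: nonincreasing_cvg_mu => //.
    by apply: (@le_lt_trans _ _ 1%E); [exact: probability_le1|exact: ltry].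
  by move=> i j ij; apply/subsetPset; exact: dF.
by rewrite F0 measure0 => /fine_cvg.
Qed.

Lemma pr_range (Y : T -> nat) (N N' : nat) : (forall k, measurable [set t | Y t = k]) ->
  pr [set t | (N <= Y t < N')%N] = \sum_(N <= k < N') pr [set t | Y t = k].
Proof.
move=> mY; elim: N' => [|N' IH].
  rewrite big_geq // (_ : [set t | _] = set0) ?pr_set0 //.
  by rewrite -subset0 => t /=; rewrite ltn0 andbF.
have mR a b : measurable [set t | (a <= Y t < b)%N].
  rewrite (_ : mkset _ = \bigcup_(k in [set k | (a <= k < b)%N]) [set t | Y t = k]).
    by apply: bigcup_measurable.
  by apply/seteqP; split => [t /= H|t /= [k /= H ->]//]; exists (Y t).
have [NN'|N'N] := leqP N N'; last first.
  rewrite big_geq // (_ : [set t | _] = set0) ?pr_set0 //.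
  by rewrite -subset0 => t /= /andP[a b]; have := leq_ltn_trans a b; rewrite ltnS leqNgt N'N.
rewrite big_nat_recr //= -IH -pr_setU //.
  congr pr; apply/seteqP; split=> t /=.
    move=> /andP[NY]; rewrite ltnS leq_eqVlt => /predU1P[->|YN']; [by right|left].
    by rewrite NY.
  by case=> [/andP[NY YN']|YE]; [rewrite NY ltnS ltnW|rewrite YE NN' ltnS leqnn].
by rewrite -subset0 => t /= [/andP[_ YN] YE]; rewrite YE ltnn in YN.
Qed.
End RealProbability.

(** * Markov recursion for the law of the process *)

Section ProcessLaw.
Context {R : realType} {dT : measure_display} {T : measurableType dT}.
Variables (P : probability T R) (p : nat -> R) (Z : nat -> T -> nat).
Hypothesis pl : offspring_law p.
Hypothesis GW : GW_process P p Z.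

Definition law n k : R := pr P [set t | Z n t = k].

Let mZ n k : measurable [set t | Z n t = k]. Proof. by case: GW => H _; exact: H. Qed.

Lemma law_ge0 n k : 0 <= law n k.
Proof. exact: pr_ge0. Qed.

Lemma law_cvg1 n : series (law n) @ \oo --> (1 : R).
Proof.
rewrite -(pr_setT P) (_ : setT = \bigcup_k [set t | Z n t = k]).
  apply: pr_bigcup => // i j _ _ [t /= []]; by move=> <- <-.
by apply/seteqP; split=> // t _; exists (Z n t).
Qed.

Lemma law0 k : law 0 k = (k == 1%N)%:R.
Proof.
have [_ [H _]] := GW; have l1 : law 0 1%N = 1 by rewrite /law /pr H.
have [->//|k1] := eqVneq k 1%N.
apply/eqP; rewrite eq_le law_ge0 andbT.
have := pr_le1 P (measurableU _ _ (mZ 0 k) (mZ 0 1)).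
rewrite pr_setU //; first by rewrite -/(law 0 k) -/(law 0 1) l1 gerDr.
by rewrite -subset0 => t /= [-> /eqP]; rewrite (negbTE k1).
Qed.

Let path (i n : nat) (x : nat -> nat) := [set t | forall l, (i <= l <= n)%N -> Z l t = x l].

Let path_measurable i n x : measurable (path i n x).
Proof.
rewrite (_ : path i n x = \bigcap_(l in [set l | (i <= l <= n)%N]) [set t | Z l t = x l]).
  exact: bigcap_measurableType.
by apply/seteqP; split=> t /= H l; exact: H.
Qed.

(* The past is summed out one generation at a time. *)
Let path_step i n x : (i <= n)%N ->
  pr P (path i n.+1 x) = pr P (path i n x) * conv_pow p (x n) (x n.+1).
Proof.
elim: i x => [|i IH] x in_.
  have [_ [_ H]] := GW; have := H n x.
  have E k : [set t | forall i, (i <= k)%N -> Z i t = x i] = path 0 k x.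
    by apply/seteqP; split=> t /= K i; [move=> /andP[_]; exact: K | move=> ik; apply: K].
  by rewrite !E => Hx; rewrite /pr Hx (prE P (path_measurable 0 n x)) -EFinM.
pose y v l := if l == i then v else x l.
have E k : (i <= k)%N -> path i.+1 k x = \bigcup_v path i k (y v).
  move=> ik; apply/seteqP; split=> [t /= H|t /= [v _ H] l /andP[il lk]].
    exists (Z i t) => // l /andP[il lk]; rewrite /y; case: eqP => [->//|/eqP li].
    by apply: H; rewrite lk andbT ltn_neqAle eq_sym li.
  by rewrite H /y ?(gtn_eqF il) // (ltnW il).
have tr k : (i <= k)%N -> trivIset setT (fun v => path i k (y v)).
  move=> ik v v' _ _ [t /= [H1 H2]].
  have ii : (i <= i <= k)%N by rewrite leqnn.
  by have := H1 i ii; rewrite (H2 i ii) /y eqxx.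
have in1 : (i <= n)%N by exact: ltnW.
have := pr_bigcup (P := P) (fun v => path_measurable i n.+1 (y v)) (tr _ (leqW in1)).
have := pr_bigcup (P := P) (fun v => path_measurable i n (y v)) (tr _ in1).
rewrite -!E ?(leqW in1) // => c1 c2.
have c3 : series (pr P \o (fun v => path i n.+1 (y v))) @ \oo -->
    pr P (path i.+1 n x) * conv_pow p (x n) (x n.+1).
  rewrite (_ : series _ = (fun N => series (pr P \o (fun v => path i n (y v))) N *
      conv_pow p (x n) (x n.+1))).
    by apply: cvgM => //; exact: cvg_cst.
  apply/funext => N; rewrite /series /= mulr_suml; apply: eq_bigr => v _.
  by rewrite IH // /y !gtn_eqF // ltnW.
exact: cvg_unique c2 c3.
Qed.

(** Partition according to Z_n = j; [path_step] with i = n is the one-step Markov property. *)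
Lemma law_rec n k : series (fun j => law n j * conv_pow p j k) @ \oo --> law n.+1 k.
Proof.
pose x j l := if l == n then j else k.
have : series (pr P \o (fun j => path n n.+1 (x j))) @ \oo --> pr P (\bigcup_j path n n.+1 (x j)).
  apply: pr_bigcup => // j j' _ _ [t /= [H1 H2]].
  have nn : (n <= n <= n.+1)%N by rewrite leqnn leqnSn.
  by have := H1 n nn; rewrite (H2 n nn) /x eqxx.
have -> : \bigcup_j path n n.+1 (x j) = [set t | Z n.+1 t = k].
  apply/seteqP; split=> t /=.
    by case=> j _ H; rewrite H ?leqnn ?leqnSn // /x gtn_eqF.
  move=> Hk; exists (Z n t) => // l /andP[nl ln]; rewrite /x; case: eqP => [->//|/eqP H].
  have -> // : l = n.+1.
  by apply/eqP; rewrite eqn_leq ln ltn_neqAle eq_sym H nl.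
move=> Hc; rewrite (_ : series _ = series (pr P \o (fun j => path n n.+1 (x j)))) //.
apply/funext => N; rewrite /series /=.
apply: eq_bigr => j _; rewrite path_step // /x eqxx gtn_eqF //; congr (_ * _).
rewrite /law; congr pr; apply/seteqP; split=> t /=.
  by move=> H l; rewrite -eqn_leq => /eqP <-; rewrite eqxx.
by move=> H; rewrite H ?leqnn // eqxx.
Qed.

Lemma law_range n N N' :
  pr P [set t | (N <= Z n t < N')%N] = \sum_(N <= k < N') law n k.
Proof. by rewrite pr_range. Qed.
End ProcessLaw.

(** * Consequences of the almost sure convergence to W *)

Section LimitLaw.
Context {R : realType} {dT : measure_display} {T : measurableType dT}.
Variables (P : probability T R) (p : nat -> R) (Z : nat -> T -> nat) (c : nat -> R).
Variables (W : {RV P >-> R}) (w : R -> R).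
Hypothesis pl : offspring_law p.
Hypothesis GW : GW_process P p Z.
Hypothesis c_ge1 : forall n, 1 <= c n.
Hypothesis c_infty : forall X : R, exists n0, forall n, (n0 <= n)%N -> X <= c n.
Hypothesis ZW : {ae P, forall t, (fun n => (Z n t)%:R / c n) @ \oo --> W t}.
Hypothesis w_gt0 : forall x : R, 0 < x -> 0 < w x.
Hypothesis w_cont : {within `]0, +oo[, continuous w}.
Hypothesis w_density : forall A : set R, measurable A -> A `<=` `]0, +oo[ ->
  P (W @^-1` A) = (\int[lebesgue_measure]_(x in A) (w x)%:E)%E.

Let mZ n k : measurable [set t | Z n t = k]. Proof. by case: GW => H _; exact: H. Qed.
Let c_gt0 n : 0 < c n. Proof. exact: lt_le_trans (c_ge1 n). Qed.

Definition normalized n t : R := (Z n t)%:R / c n.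

Let measurable_Zrange n (D : set nat) : measurable [set t | D (Z n t)].
Proof.
rewrite (_ : mkset _ = \bigcup_(k in D) [set t | Z n t = k]); first exact: bigcup_measurable.
by apply/seteqP; split=> [t /= H|t /= [k /= H ->]//]; exists (Z n t).
Qed.

Let measurable_normalized n : measurable_fun setT (normalized n).
Proof.
move=> _ Y mY; rewrite setTI.
exact: (@measurable_Zrange n [set k | Y (k%:R / c n)]).
Qed.

Let mW (I : interval R) : measurable [set t | [set` I] (W t)].
Proof.
rewrite (_ : mkset _ = setT `&` W @^-1` [set` I]); last by rewrite setTI.
exact: (measurable_funPT W).
Qed.

Let mW_itv (I : interval R) (S : set T) : (forall t, S t <-> W t \in I) -> measurable S.
Proof.
by move=> H; rewrite (_ : S = [set t | [set` I] (W t)]) //; apply/seteqP; split=> t /H.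
Qed.

Definition gap n eps := [set t | eps <= `|normalized n t - W t|].

Let measurable_gap n eps : measurable (gap n eps).
Proof.
have mf : measurable_fun setT (fun t => `|normalized n t - W t|).
  apply: measurableT_comp => //; apply: measurable_funB.
    exact: measurable_normalized.
  exact: (measurable_funPT W).
rewrite (_ : gap _ _ = setT `&` (fun t => `|normalized n t - W t|) @^-1` `[eps, +oo[%classic).
  exact: mf.
by rewrite setTI; apply/seteqP; split=> t /=; rewrite in_itv /= andbT.
Qed.

(** Egorov's theorem: the convergence is uniform off an event of probability at most e. *)
Lemma convergence_in_probability eps e : 0 < eps -> 0 < e ->
  exists N, forall n, (N <= n)%N -> pr P (gap n eps) <= e.
Proof.
move=> eps0 e0.
have mP : (P setT < +oo)%E by rewrite probability_setT ltry.
have aeT : {ae P, forall t, setT t -> (fun n => normalized n t) @ \oo --> W t}.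
  by apply: filterS ZW => t H _; exact: H.
have [B [mB PB unif]] := ae_pointwise_almost_uniform measurable_normalized
  (measurable_funPT W) (@measurableT _ T) mP aeT e0.
have [N _ HN] : \forall n \near \oo, forall t, (setT `\` B) t -> `|W t - normalized n t| < eps.
  have := unif [set h | forall t, (setT `\` B) t -> `|W t - h t| < eps]; apply.
  apply/uniform_nbhs; exists [set xy | ball xy.1 eps xy.2]; split=> //.
  by rewrite -entourage_ballE; exists eps.
exists N => n nN; apply: (@le_trans _ _ (pr P B)).
  apply: pr_le => // t; rewrite /gap /= distrC => H; apply: contrapT => nB.
  by have := HN n nN t (conj I nB); rewrite ltNge H.
by rewrite -lee_fin -prE //; exact: ltW.
Qed.

Let measurable_density a b : 0 < a -> measurable_fun (`[a, b]%classic : set R) (fun x => (w x)%:E).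
Proof.
move=> a0.
have mw : measurable_fun (`]0, +oo[%classic : set R) w.
  exact: subspace_continuous_measurable_fun.
have mw' : measurable_fun (`[a, b]%classic : set R) w.
  apply: measurable_funS mw => // x /=; rewrite !in_itv /= andbT => /andP[ax _].
  exact: lt_le_trans ax.
exact/measurable_EFinP.
Qed.

Let mass_itv a b : 0 < a -> measurable [set t | a <= W t <= b] /\
  (pr P [set t | a <= W t <= b])%:E = (\int[lebesgue_measure]_(x in `[a, b]) (w x)%:E)%E.
Proof.
move=> a0; have m1 : measurable [set t | a <= W t <= b].
  by apply: (mW_itv (I := `[a, b])) => t; rewrite in_itv.
split=> //; rewrite -prE // -w_density //.
by move=> x /=; rewrite !in_itv /= andbT => /andP[ax _]; exact: lt_le_trans ax.
Qed.

Let int_cst_itv (a b U : R) : a <= b ->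
  (\int[lebesgue_measure]_(x in `[a, b]) (cst U%:E x))%E = (U * (b - a))%:E.
Proof.
move=> ab; rewrite integral_cst //= lebesgue_measure_itv /= lte_fin.
case: (ltP a b) => [ab'|ba]; first by rewrite EFinM.
have -> : a = b by apply/eqP; rewrite eq_le ab.
by rewrite subrr mulr0 mule0.
Qed.

Lemma mass_le a b U : 0 < a -> a <= b -> (forall x, a <= x <= b -> w x <= U) ->
  pr P [set t | a <= W t <= b] <= U * (b - a).
Proof.
move=> a0 ab wU; have [_ H] := mass_itv b a0.
rewrite -lee_fin H -int_cst_itv //; apply: ge0_le_integral => //.
- by move=> x /=; rewrite in_itv /= => /andP[ax _]; rewrite lee_fin ltW // w_gt0 // (lt_le_trans a0).
- exact: measurable_density.
Qed.

Lemma mass_ge a b L : 0 < a -> a <= b -> (forall x, a <= x <= b -> L <= w x) ->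
  L * (b - a) <= pr P [set t | a <= W t <= b].
Proof.
move=> a0 ab wL; have [_ H] := mass_itv b a0.
have [L0|L0] := ltP L 0; first by rewrite (le_trans _ (pr_ge0 _ _)) // nmulr_rle0 // subr_ge0.
rewrite -lee_fin H -int_cst_itv //; apply: ge0_le_integral => //.
- exact: measurable_density.
Qed.

Lemma density_continuous x : 0 < x -> {for x, continuous w}.
Proof. exact: continuous_at_of_within. Qed.

Lemma density_within a b : 0 < a -> {within `[a, b], continuous w}.
Proof.
move=> a0; apply: continuous_subspaceW w_cont => x /=.
by rewrite !in_itv /= andbT => /andP[ax _]; exact: lt_le_trans ax.
Qed.

Lemma density_bounded a b : 0 < a -> exists2 U, 0 < U & forall x, a <= x <= b -> w x <= U.
Proof.
move=> a0; have [ab|ba] := leP a b; last first.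
  by exists 1 => // x /andP[ax xb]; have := le_trans ax xb; rewrite leNgt ba.
have [x xab H] := EVT_max ab (density_within a0).
exists (w x); first by apply: w_gt0; move: xab; rewrite in_itv /= => /andP[ax _]; exact: lt_le_trans ax.
by move=> y yab; apply: H; rewrite in_itv.
Qed.

Lemma mass_gt0 a b : 0 < a -> a < b -> 0 < pr P [set t | a <= W t <= b].
Proof.
move=> a0 ab; have [x xab H] := EVT_min (ltW ab) (density_within a0).
apply: (@lt_le_trans _ _ (w x * (b - a))).
  rewrite mulr_gt0 ?subr_gt0 // w_gt0 //.
  by move: xab; rewrite in_itv /= => /andP[ax _]; exact: lt_le_trans ax.
by apply: mass_ge => //; exact: ltW.
Qed.

Let measurable_abs X : measurable [set t | X < `|W t|].
Proof.
have mf : measurable_fun setT (fun t => `|W t|).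
  by apply: measurableT_comp => //; exact: (measurable_funPT W).
rewrite (_ : mkset _ = setT `&` (fun t => `|W t|) @^-1` `]X, +oo[%classic); first exact: mf.
by rewrite setTI; apply/seteqP; split=> t /=; rewrite in_itv /= andbT.
Qed.

Lemma limit_tight e : 0 < e -> exists2 X, 0 < X & pr P [set t | X < `|W t|] <= e.
Proof.
move=> e0; pose A n := [set t | n%:R < `|W t|].
have : pr P \o A @ \oo --> (0 : R).
  apply: pr_decreasing => [i|i j ij t|]; first exact: measurable_abs.
    by rewrite /A /=; apply: le_lt_trans; rewrite ler_nat.
  rewrite -subset0 => t H; have := H (Num.bound (W t)) I; rewrite /A /=.
  have := archi_boundP (normr_ge0 (W t)).
  have -> : Num.bound `|W t| = Num.bound (W t) by rewrite /Num.bound normr_id.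
  by move=> a b; have := lt_trans a b; rewrite ltxx.
move=> /cvgn_distP/(_ e e0)[N HN]; exists N.+1%:R => //.
by have := HN N.+1 (leqnSn _); rewrite subr0 ger0_norm ?pr_ge0 // => /ltW.
Qed.

Let measurable_pos y : measurable [set t | 0 < W t < y].
Proof. by apply: (mW_itv (I := `]0, y[)) => t; rewrite in_itv. Qed.

Let measurable_pos_le y : measurable [set t | 0 < W t <= y].
Proof. by apply: (mW_itv (I := `]0, y])) => t; rewrite in_itv. Qed.

Lemma limit_small e : 0 < e -> exists2 y, 0 < y & pr P [set t | 0 < W t <= y] <= e.
Proof.
move=> e0; pose A n := [set t | 0 < W t <= n.+1%:R^-1].
have : pr P \o A @ \oo --> (0 : R).
  apply: pr_decreasing => [i|i j ij t|]; first exact: measurable_pos_le.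
    rewrite /A /= => /andP[-> /le_trans]; apply.
    by rewrite lef_pV2 ?posrE // ler_nat ltnS.
  rewrite -subset0 => t H; have /andP[Wt _] := H 0%N I.
  have /andP[_] := H (Num.bound (W t)^-1) I.
  rewrite leNgt => /negP; apply.
  rewrite invf_plt ?posrE //; apply: lt_trans (archi_boundP _) _; first by rewrite invr_ge0 ltW.
  by rewrite ltr_nat.
move=> /cvgn_distP/(_ e e0)[N HN]; exists N.+1%:R^-1 => //.
by have := HN N (leqnn _); rewrite subr0 ger0_norm ?pr_ge0 // => /ltW.
Qed.

Let near_law n eps t : ~ gap n eps t -> `|normalized n t - W t| < eps.
Proof. by rewrite /gap /= => /negP; rewrite -ltNge. Qed.

Let measurable_range n N N' : measurable [set t | (N <= Z n t < N')%N].
Proof. exact: (@measurable_Zrange n [set k | (N <= k < N')%N]). Qed.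

Lemma law_tight e : 0 < e -> exists2 X : R, 0 < X &
  forall n, exists N : nat, N%:R <= X * c n /\ 1 - e <= \sum_(0 <= k < N) law P Z n k.
Proof.
move=> e0; have e20 : 0 < e / 2 by rewrite divr_gt0.
have [X X0 HX] := limit_tight e20.
have [n0 Hn0] := convergence_in_probability ltr01 e20.
have /choice[M HM] n : exists N, 1 - e <= \sum_(0 <= k < N) law P Z n k.
  have /cvgn_distP/(_ e e0)[N /(_ N (leqnn _))] := law_cvg1 GW n.
  by rewrite distrC => /ltr_normlW H; exists N; rewrite -/(series _ _); move: H; rewrite /series /=; lra.
(* Off the exceptional events Z_n / c_n is below X + 1; one more unit absorbs rounding up, since c_n
   >= 1, and the maximum covers the finitely many n < n0. *)
pose X' := X + 2 + (\max_(i < n0) M i)%:R.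
have mx0 : 0 <= (\max_(i < n0) M i)%:R :> R by exact: ler0n.
have X'0 : 0 < X' by rewrite /X'; lra.
exists X' => // n; have [nn0|n0n] := ltnP n n0.
  exists (M n); split=> //; apply: (@le_trans _ _ X'); last by rewrite ler_peMr // ltW.
  have : (M n)%:R <= (\max_(i < n0) M i)%:R :> R.
    by rewrite ler_nat; exact: (leq_bigmax (Ordinal nn0)).
  by rewrite /X'; lra.
have X1 : 0 <= (X + 1) * c n by rewrite mulr_ge0 ?ltW //; lra.
have /andP[tr1 tr2] := truncn_itv X1.
exists (Num.truncn ((X + 1) * c n)).+1; split.
  rewrite -natr1; apply: (@le_trans _ _ ((X + 1) * c n + c n)); first by rewrite lerD.
  by rewrite -[X in _ + X]mul1r -mulrDl ler_wpM2r ?(ltW (c_gt0 _)) // /X'; lra.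
set N := _.+1; rewrite -(law_range GW).
have sub : setT `<=` ([set t | (0 <= Z n t < N)%N] `|` (gap n 1 `|` [set t | X < `|W t|])).
  move=> t _; apply: contrapT => /not_orP[H1 /not_orP[/near_law H2 H3]].
  apply: H1; rewrite /= ltnNge; apply/negP => NZ.
  have H4 : `|W t| <= X by rewrite leNgt; apply/negP.
  have : (X + 1) * c n < (Z n t)%:R by apply: lt_le_trans tr2 _; rewrite ler_nat.
  rewrite -ltr_pdivlMr //.
  have := ler_norm (W t); have := ltr_normlW H2; rewrite /normalized; lra.
have mg := measurable_gap n 1; have ma := measurable_abs X; have mr := measurable_range n 0 N.
have := pr_le P measurableT (measurableU _ _ mr (measurableU _ _ mg ma)) sub.
rewrite pr_setT; have := pr_setU_le P mr (measurableU _ _ mg ma).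
have := pr_setU_le P mg ma; have := Hn0 n n0n; have := HX.
by lra.
Qed.

Lemma law_window x y : 0 < x -> x < y -> exists e n0, 0 < e /\
  forall n, (n0 <= n)%N -> exists N N' : nat,
    [/\ x * c n <= N%:R, N'%:R <= y * c n & e <= \sum_(N <= k < N') law P Z n k].
Proof.
(* On either side one [del] absorbs the deviation of Z_n / c_n from W and one the rounding to
   integers; the remaining fifth carries positive mass of W. *)
move=> x0 xy; pose del := (y - x) / 5.
have del0 : 0 < del by rewrite divr_gt0 // subr_gt0.
pose m := pr P [set t | x + 2 * del <= W t <= y - 2 * del].
have yE : y = x + 5 * del by rewrite /del; field.
have m0 : 0 < m by apply: mass_gt0; lra.
have [n1 Hn1] := convergence_in_probability del0 (ltac:(lra) : 0 < m / 2).
have [n2 Hn2] := c_infty del^-1.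
exists (m / 2), (maxn n1 n2); split; first by rewrite divr_gt0.
move=> n; rewrite geq_max => /andP[/Hn1 g /Hn2 cd].
have cdel : 1 <= del * c n by rewrite mulrC -ler_pdivrMr // mul1r.
have xc0 : 0 <= x * c n by rewrite mulr_ge0 // ltW.
have yc0 : 0 <= y * c n by rewrite mulr_ge0 // ltW // (lt_trans x0).
have /andP[a1 a2] := truncn_itv xc0; have /andP[b1 b2] := truncn_itv yc0.
pose N := (Num.truncn (x * c n)).+1; pose N' := Num.truncn (y * c n).
exists N, N'; split=> //; first exact: ltW.
rewrite -(law_range GW).
have [ms _] := @mass_itv (x + 2 * del) (y - 2 * del) (ltac:(lra)).
have mg := measurable_gap n del; have mr := measurable_range n N N'.
have sub : [set t | x + 2 * del <= W t <= y - 2 * del] `<=`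
    [set t | (N <= Z n t < N')%N] `|` gap n del.
  move=> t /= /andP[w1 w2]; apply: contrapT => /not_orP[H1 /near_law H2].
  move: H2; rewrite ltr_norml /normalized => /andP[z1 z2]; apply: H1.
  have z3 : (x + del) * c n <= (Z n t)%:R by rewrite -ler_pdivlMr //; lra.
  have z4 : (Z n t)%:R <= (y - del) * c n by rewrite -ler_pdivrMr //; lra.
  apply/andP; split.
    by rewrite -(ler_nat R) /N -natr1; lra.
  by rewrite -(ltr_nat R) /N'; move: b2; rewrite -natr1; lra.
have := pr_le P ms (measurableU _ _ mr mg) sub; have := pr_setU_le P mr mg.
by rewrite -/m; lra.
Qed.

(** The error is small relative to the cell width [eta]: w is nearly constant on a cell, and the
    tolerance [del] in the convergence to W is a small fraction of [eta], so that the ends of the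
    cell contribute little. Hence n0 depends on [eta], whereas [eta0] does not depend on n. *)
Lemma law_cell A B e : 0 < A -> A <= B -> 0 < e -> exists2 eta0, 0 < eta0 &
  forall eta, 0 < eta -> eta <= eta0 -> exists n0, forall n, (n0 <= n)%N ->
  forall N N' : nat, A * c n <= N%:R -> N%:R <= B * c n ->
  eta / 2 * c n <= N'%:R - N%:R -> N'%:R - N%:R <= eta * c n ->
  `|\sum_(N <= k < N') law P Z n k - (N'%:R - N%:R) / c n * w (N%:R / c n)| <= e * eta.
Proof.
move=> A0 AB e0.
have A20 : 0 < A / 2 by rewrite divr_gt0.
have [U U0 HU] := density_bounded (B + 1) A20.
have e40 : 0 < e / 4 by rewrite divr_gt0.
have [|du du0 Hdu] := @uniform_continuity_itv _ w (A / 2) (B + 1) _ (e / 4) e40.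
  by move=> x /andP[x1 _]; apply: density_continuous; exact: lt_le_trans x1.
pose eta0 := Num.min (Num.min (A / 4) (1 / 2)) (du / 2).
have eta00 : 0 < eta0 by rewrite !lt_min !divr_gt0.
exists eta0 => // eta et0 ete.
have [eA e1 edu] : [/\ eta <= A / 4, eta <= 1 / 2 & eta <= du / 2].
  by move: ete; rewrite !le_min => /andP[/andP[-> ->] ->].
(* The bound 1 / 4 keeps the cell nonempty when it is shrunk by [del] at both ends; the other one
   bounds the cost of the end strips by a fraction of e * eta. *)
pose kap := Num.min (1 / 4) (e / (8 * (U + e))).
have Ue : 0 < U + e by rewrite addr_gt0.
have kap0 : 0 < kap by rewrite lt_min !divr_gt0 // mulr_gt0.
have kap4 : kap <= 1 / 4 by rewrite ge_min lexx.
have kapU : kap * (U + e) <= e / 8.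
  have : kap <= e / (8 * (U + e)) by rewrite ge_min lexx orbT.
  rewrite ler_pdivlMr ?mulr_gt0 // => H; lra.
pose del := kap * eta.
have del0 : 0 < del by rewrite mulr_gt0.
have del4 : del <= eta / 4 by rewrite /del mulrC; have := ler_wpM2l (ltW et0) kap4; lra.
have delU : del * (U + e) <= e * eta / 8.
  by rewrite /del mulrAC; have := ler_wpM2r (ltW et0) kapU; lra.
have [n0 Hn0] := convergence_in_probability del0 (ltac:(rewrite mulr_gt0 //) : 0 < e / 4 * eta).
exists n0 => n /Hn0 g N N' AN NB h1 h2.
have cn := c_gt0 n.
set x := N%:R / c n; set h := (N'%:R - N%:R) / c n.
have xA : A <= x by rewrite ler_pdivlMr.
have xB : x <= B by rewrite ler_pdivrMr.
have hl : eta / 2 <= h by rewrite ler_pdivlMr.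
have hu : h <= eta by rewrite ler_pdivrMr.
have xN' : x + h = N'%:R / c n by rewrite -mulrDl addrC subrK.
have wx y : x - del <= y <= x + h + del -> w x - e / 4 <= w y <= w x + e / 4.
  move=> /andP[y1 y2].
  have xin : A / 2 <= x <= B + 1 by move: xA xB A0; forget_after A; apply/andP; split; lra.
  have : `|x - y| < du.
    by move: y1 y2 hu del4 edu du0 et0; forget_after A; rewrite ltr_norml; apply/andP; split; lra.
  by move=> /(Hdu x y xin); rewrite ltr_norml => /andP[]; forget_after A; apply/andP; split; lra.
have wU : w x <= U by apply: HU; move: xA xB A0; forget_after A; apply/andP; split; lra.
have w0 : 0 < w x by exact/w_gt0/(lt_le_trans A0).
rewrite -(law_range GW).
have mg := measurable_gap n del; have mr := measurable_range n N N'.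
have xd0 : 0 < x + del by rewrite addr_gt0 // (lt_le_trans A0).
have dx0 : 0 < x - del by move: xA A0 del4 eA; forget_after A; lra.
have xh1 : x + del <= x + h - del by move: del4 hl; forget_after A; lra.
have xh2 : x - del <= x + h + del by move: del0 hl et0; forget_after A; lra.
have wl y : x + del <= y <= x + h - del -> w x - e / 4 <= w y.
  move=> /andP[y1 y2]; have /wx/andP[//] : x - del <= y <= x + h + del.
  by move: y1 y2 del0; forget_after A; apply/andP; split; lra.
have low : pr P [set t | x + del <= W t <= x + h - del] <=
    pr P [set t | (N <= Z n t < N')%N] + pr P (gap n del).
  have [ms _] := @mass_itv (x + del) (x + h - del) xd0.
  apply: (le_trans _ (pr_setU_le P mr mg)); apply: pr_le => //; first exact: measurableU.
  move=> t /= /andP[w1 w2]; apply: contrapT => /not_orP[H1 /near_law H2].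
  move: H2; rewrite ltr_norml /normalized => /andP[z1 z2]; apply: H1.
  apply/andP; split.
    rewrite -(ler_nat R) -(@ler_pM2r _ (c n)^-1) ?invr_gt0 // -/x.
    by move: w1 z1 z2; forget_after A; lra.
  rewrite -(ltr_nat R) -(@ltr_pM2r _ (c n)^-1) ?invr_gt0 // -xN'.
  by move: w2 z1 z2; forget_after A; lra.
have upp : pr P [set t | (N <= Z n t < N')%N] <=
    pr P [set t | x - del <= W t <= x + h + del] + pr P (gap n del).
  have [ms _] := @mass_itv (x - del) (x + h + del) dx0.
  apply: (le_trans _ (pr_setU_le P ms mg)); apply: pr_le => //; first exact: measurableU.
  move=> t /= /andP[NZ ZN]; apply: contrapT => /not_orP[H1 /near_law H2].
  move: H2; rewrite ltr_norml /normalized => /andP[z1 z2]; apply: H1.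
  have u1 : x <= (Z n t)%:R / c n by rewrite ler_pM2r ?invr_gt0 // ler_nat.
  have u2 : (Z n t)%:R / c n <= x + h by rewrite xN' ler_pM2r ?invr_gt0 // ler_nat ltnW.
  by move: u1 u2 z1 z2; forget_after A; apply/andP; split; lra.
have L1 := @mass_ge (x + del) (x + h - del) (w x - e / 4) xd0 xh1 wl.
have L2 := @mass_le (x - del) (x + h + del) (w x + e / 4) dx0 xh2
  (fun y hy => proj2 (andP (wx y hy))).
set S := pr P [set t | (N <= Z n t < N')%N] in low upp *.
have d1 : del * w x <= del * U by rewrite ler_wpM2l // ltW.
have he : h * e <= eta * e by rewrite ler_wpM2r // ltW.
have de : 0 <= del * e by rewrite mulr_ge0 // ltW.
have {}L1 := le_trans L1 low; have {}L2 := le_trans upp (lerD L2 (lexx _)).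
have dU : del * U + del * e <= e * eta / 8 by rewrite -mulrDr.
by move: L1 L2 g d1 he de dU; forget_after A; rewrite ler_norml; apply/andP; split; lra.
Qed.

Definition cdf_pos y := pr P [set t | 0 < W t < y].

Lemma cdf_pos_lip A B : 0 < A -> exists2 U, 0 < U & forall x y, A <= x -> x <= y -> y <= B ->
  cdf_pos x <= cdf_pos y <= cdf_pos x + U * (y - x).
Proof.
move=> A0; have [U U0 HU] := density_bounded B A0; exists U => // x y Ax xy yB.
have x0 : 0 < x by exact: lt_le_trans Ax.
apply/andP; split.
  apply: pr_le => // t /= /andP[-> /lt_le_trans]; exact.
have [ms _] := @mass_itv x y x0.
apply: (@le_trans _ _ (cdf_pos x + pr P [set t | x <= W t <= y])).
  apply: (le_trans _ (pr_setU_le P (measurable_pos x) ms)); apply: pr_le => //.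
    exact: measurableU.
  move=> t /= /andP[-> Wy]; have [Wx|xW] := ltP (W t) x; [by left|right].
  by rewrite (ltW Wy).
rewrite lerD2l; apply: mass_le => // z /andP[z1 z2]; apply: HU.
by rewrite (le_trans Ax z1) (le_trans z2 yB).
Qed.

Lemma cdf_pos_gt0 y : 0 < y -> 0 < cdf_pos y.
Proof.
move=> y0; apply: (@lt_le_trans _ _ (pr P [set t | y / 3 <= W t <= y / 2])).
  by apply: mass_gt0; lra.
have [ms _] := @mass_itv (y / 3) (y / 2) (ltac:(lra)).
by apply: pr_le => // t /= /andP[w1 w2]; apply/andP; split; lra.
Qed.

(** Convergence to W alone does not separate small positive values of Z_n / c_n from extinction;
    hence the hypothesis on the mass of 1 <= Z_n <= eta c_n, which the sandwich supplies later.
    Small positive values of W are covered by [limit_small]. *)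
Lemma law_cdf A B e : 0 < A -> A <= B -> 0 < e ->
  (forall e', 0 < e' -> exists eta n0, 0 < eta /\ forall n N, (n0 <= n)%N -> N%:R <= eta * c n ->
     \sum_(1 <= k < N.+1) law P Z n k <= e') ->
  exists n0, forall n k, (n0 <= n)%N -> A * c n <= k%:R -> k%:R <= B * c n ->
  `|\sum_(1 <= l < k.+1) law P Z n l - cdf_pos (k%:R / c n)| <= e.
Proof.
move=> A0 AB e0 small; have e50 : 0 < e / 5 by rewrite divr_gt0.
have [eta [n1 [eta0 Hs]]] := small _ e50.
have [y0 y00 Hy0] := limit_small e50.
pose eps := Num.min (Num.min (eta / 2) y0) (A / 2).
have eps0 : 0 < eps by rewrite !lt_min !divr_gt0 //= y00.
have [ea [eb ec]] : eps <= eta / 2 /\ eps <= y0 /\ eps <= A / 2.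
  by have := lexx eps; rewrite {2}/eps !le_min => /andP[/andP[-> ->] ->].
have A20 : 0 < A / 2 by rewrite divr_gt0.
have [U U0 HU] := density_bounded (B + A) A20.
pose del := Num.min (eps / 2) (e / (5 * U)).
have del0 : 0 < del by rewrite lt_min !divr_gt0 // mulr_gt0.
have de : del <= eps / 2 by rewrite ge_min lexx.
have dU : U * del <= e / 5.
  have : del <= e / (5 * U) by rewrite ge_min lexx orbT.
  by rewrite ler_pdivlMr ?mulr_gt0 // => H; lra.
have [n2 Hn2] := convergence_in_probability del0 e50.
exists (maxn n1 n2) => n k; rewrite geq_max => /andP[nn1 /Hn2 g] Ak kB.
have cn := c_gt0 n; set y := k%:R / c n.
have yA : A <= y by rewrite ler_pdivlMr.
have yB : y <= B by rewrite ler_pdivrMr.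
have ec0 : 0 <= eps * c n by rewrite mulr_ge0 // ltW.
have /andP[t1 t2] := truncn_itv ec0; set N := Num.truncn _ in t1 t2.
have sN : \sum_(1 <= l < N.+1) law P Z n l <= e / 5.
  by apply: Hs => //; apply: (le_trans t1); rewrite ler_wpM2r ?(ltW cn) //; lra.
rewrite -!(law_range GW) in sN *.
have mg := measurable_gap n del; have mr M := measurable_range n 1 M.
have yp : 0 < y by exact: lt_le_trans yA.
have dA : del <= A / 4 by move: de ec; forget_after A; lra.
have yd0 : 0 < y - del by move: yA A0 dA; forget_after A; lra.
have yd1 : y <= y + del by rewrite lerDl ltW.
have yd2 : y - del <= y by rewrite gerBl ltW.
have HU' z : y - del <= z <= y + del -> w z <= U.
  by move=> /andP[z1 z2]; apply: HU; move: z1 z2 yA yB dA A0; forget_after A; apply/andP; split; lra.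
have [m1 _] := @mass_itv y (y + del) yp.
have [m2 _] := @mass_itv (y - del) y yd0.
have M1 : pr P [set t | y <= W t <= y + del] <= U * (y + del - y).
  by apply: (mass_le yp yd1) => z /andP[z1 z2]; apply: HU'; rewrite z2 (le_trans yd2).
have M2 : pr P [set t | y - del <= W t <= y] <= U * (y - (y - del)).
  by apply: (mass_le yd0 yd2) => z /andP[z1 z2]; apply: HU'; rewrite z1 (le_trans z2).
have sub1 : [set t | (1 <= Z n t < k.+1)%N] `<=` [set t | (1 <= Z n t < N.+1)%N] `|`
   ([set t | 0 < W t < y] `|` ([set t | y <= W t <= y + del] `|` gap n del)).
  move=> t /= /andP[Z1 Zk]; apply: contrapT => /not_orP[H1 /not_orP[H2 /not_orP[H3 /near_law]]].
  rewrite ltr_norml /normalized => /andP[z1 z2].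
  have ZN : (N < Z n t)%N by rewrite ltnNge; apply/negP => ZN; apply: H1; rewrite Z1 ltnS.
  have z3 : eps < (Z n t)%:R / c n.
    by rewrite ltr_pdivlMr //; apply: (lt_le_trans t2); rewrite ler_nat.
  have z4 : (Z n t)%:R / c n <= y by rewrite ler_pM2r ?invr_gt0 // ler_nat -ltnS.
  have [Wy|yW] := ltP (W t) y; first apply: H2.
    by rewrite Wy andbT; move: z1 z2 z3 de eps0; forget_after A; lra.
  by apply: H3; rewrite yW /=; move: z1 z2 z4; forget_after A; lra.
have sub2 : [set t | 0 < W t < y] `<=` [set t | 0 < W t <= y0] `|`
   ([set t | (1 <= Z n t < k.+1)%N] `|` ([set t | y - del <= W t <= y] `|` gap n del)).
  move=> t /= /andP[W0 Wy]; apply: contrapT => /not_orP[H1 /not_orP[H2 /not_orP[H3 /near_law]]].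
  rewrite ltr_norml /normalized => /andP[z1 z2].
  have Wy0 : y0 < W t by rewrite ltNge; apply/negP => Wy0; apply: H1; rewrite W0.
  have Wyd : W t < y - del by rewrite ltNge; apply/negP => Wyd; apply: H3; rewrite Wyd ltW.
  apply: H2; apply/andP; split.
    rewrite lt0n; apply/eqP => Z0; rewrite Z0 mul0r in z1.
    by move: z1 Wy0 de eb y00; forget_after A; lra.
  rewrite ltnS -(ler_nat R) -(@ler_pM2r _ (c n)^-1) ?invr_gt0 // -/y.
  by move: z1 z2 Wyd; forget_after A; lra.
have U1 := pr_le P (mr _) (measurableU _ _ (mr _) (measurableU _ _ (measurable_pos y)
  (measurableU _ _ m1 mg))) sub1.
have U2 := pr_le P (measurable_pos y) (measurableU _ _ (measurable_pos_le y0)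
  (measurableU _ _ (mr _) (measurableU _ _ m2 mg))) sub2.
have V1 := pr_setU_le P (mr N.+1) (measurableU _ _ (measurable_pos y) (measurableU _ _ m1 mg)).
have V2 := pr_setU_le P (measurable_pos y) (measurableU _ _ m1 mg).
have V3 := pr_setU_le P m1 mg.
have V4 := pr_setU_le P (measurable_pos_le y0) (measurableU _ _ (mr k.+1) (measurableU _ _ m2 mg)).
have V5 := pr_setU_le P (mr k.+1) (measurableU _ _ m2 mg).
have V6 := pr_setU_le P m2 mg.
rewrite /cdf_pos.
have D1 : y + del - y = del by ring.
have D2 : y - (y - del) = del by ring.
rewrite D1 in M1; rewrite D2 in M2.
move: V1 V2 V3 V4 V5 V6 U1 U2 sN g M1 M2 Hy0 dU; forget_after A.
by rewrite ler_norml; apply/andP; split; lra.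
Qed.
End LimitLaw.

(** * Local limit theorem *)

Section LocalLimit.
Context {R : realType}.
Variables (q : nat -> nat -> R) (c : nat -> R) (w : R -> R) (d mu : nat) (v B0 : R).
Hypothesis d_gt0 : (0 < d)%N.
Hypothesis q_ge0 : forall n k, 0 <= q n k.
Hypothesis q_mod : forall n k, (0 < n)%N -> k != mu %[mod d] -> q n k = 0.
Hypothesis c_ge1 : forall n, 1 <= c n.
Hypothesis c_infty : forall X : R, exists n0, forall n, (n0 <= n)%N -> X <= c n.
Hypothesis v_gt0 : 0 < v.
Let G n l := l%:R * q n l * expR (- (v / c n)) ^+ l.
Hypothesis G_smooth : forall e, 0 < e -> exists2 eta : R, 0 < eta & forall n l l', (0 < n)%N ->
  l = mu %[mod d] -> l' = mu %[mod d] -> `|l%:R - l'%:R| <= eta * c n -> `|G n l - G n l'| <= e.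
Hypothesis w_gt0 : forall x : R, 0 < x -> 0 < w x.
Hypothesis w_bounded : forall a b, 0 < a -> exists2 U, 0 < U & forall x, a <= x <= b -> w x <= U.
Hypothesis cell : forall A B e, 0 < A -> A <= B -> 0 < e -> exists2 eta0, 0 < eta0 &
  forall eta, 0 < eta -> eta <= eta0 -> exists n0, forall n, (n0 <= n)%N ->
  forall N N' : nat, A * c n <= N%:R -> N%:R <= B * c n ->
  eta / 2 * c n <= N'%:R - N%:R -> N'%:R - N%:R <= eta * c n ->
  `|\sum_(N <= k < N') q n k - (N'%:R - N%:R) / c n * w (N%:R / c n)| <= e * eta.

Lemma sum_residue n k I : (0 < n)%N -> k = mu %[mod d] ->
  \sum_(k <= l < k + d * I) q n l = \sum_(i < I) q n (k + d * i).
Proof.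
move=> n0 kmu; elim: I => [|I IH]; first by rewrite muln0 addn0 big_geq // big_ord0.
rewrite (big_cat_nat (n := (k + d * I)%N)) ?leq_addr //=; last first.
  by rewrite leq_add2l leq_mul2l leqnSn orbT.
rewrite IH big_ord_recr /=; congr (_ + _).
rewrite big_ltn; last by rewrite ltn_add2l ltn_mul2l d_gt0 ltnSn.
rewrite big1_seq ?addr0 // => l /andP[_]; rewrite mem_index_iota => /andP[l1 l2].
apply: q_mod => //; apply/negP => /eqP lmu.
have kl : (k + d * I <= l)%N by exact: ltnW.
have : (d %| l - (k + d * I))%N.
  by rewrite -eqn_mod_dvd // lmu -kmu addnC mulnC modnMDl.
move=> /dvdnP[j jE].
have j0 : (0 < j)%N by move: l1; rewrite -subn_gt0 jE muln_gt0 => /andP[].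
have : (l < (k + d * I) + d)%N by rewrite -addnA [(d * I + d)%N]addnC -mulnS.
by rewrite -ltn_subLR // jE ltnNge leq_pmull.
Qed.

(** By [cell], the average of c_n q_n over I consecutive sites of the residue class is close to d
    w(x). [G_smooth] compares G at these sites with its value at the first one, and G is c_n q_n
    times the function y exp (- v y) of y = l / c_n, which is nearly constant over the cell and at
    least [al] on [A, B]. *)
Lemma local_limit A B e : 0 < A -> A <= B -> 0 < e -> exists n0, forall n k, (n0 <= n)%N ->
  k = mu %[mod d] -> A * c n <= k%:R -> k%:R <= B * c n ->
  `|c n * q n k - d%:R * w (k%:R / c n)| <= e.
Proof.
move=> A0 AB e0; have [U U0 HU] := w_bounded B A0.
have d0 : 0 < d%:R :> R by rewrite ltr0n.
pose al := A * expR (- (v * B)).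
have al0 : 0 < al by rewrite mulr_gt0 // expR_gt0.
have e10 : 0 < al * (e / 4) by rewrite mulr_gt0 // divr_gt0.
have e20 : 0 < e / (8 * d%:R) by rewrite divr_gt0 // mulr_gt0.
have [eta1 eta10 Hsm] := G_smooth e10.
have [eta2 eta20 Hcell] := cell A0 AB e20.
pose S0 := d%:R * U + e.
have S00 : 0 < S0 by rewrite addr_gt0 // mulr_gt0.
have vA : 0 < v + A^-1 by rewrite addr_gt0 // invr_gt0.
(* The three bounds serve [G_smooth], [cell] and the variation of y exp (- v y) across the cell. *)
pose eta := Num.min (Num.min eta1 eta2) (e / (4 * S0 * (v + A^-1))).
have eta0 : 0 < eta by rewrite !lt_min eta10 eta20 /= divr_gt0 // !mulr_gt0.
have [et1 [et2 et3]] : eta <= eta1 /\ eta <= eta2 /\ eta <= e / (4 * S0 * (v + A^-1)).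
  by have := lexx eta; rewrite {2}/eta !le_min => /andP[/andP[-> ->] ->].
have etS : S0 * (eta * (v + A^-1)) <= e / 4.
  by move: et3; rewrite ler_pdivlMr ?mulr_gt0 // => H; lra.
have [n1 Hn1] := Hcell eta eta0 et2.
have [n2 Hn2] := c_infty (2 * d%:R / eta).
exists (maxn (maxn n1 n2) 1) => n k; rewrite !geq_max => /andP[/andP[/Hn1{}Hn1 /Hn2 cl] npos] kmu Ak kB.
have cn : 0 < c n by exact: lt_le_trans (c_ge1 n).
have cl' : 2 * d%:R <= eta * c n by rewrite [leRHS]mulrC -ler_pdivrMr.
have q0 : 0 <= eta * c n / d%:R by rewrite !mulr_ge0 ?invr_ge0 // ltW.
have /andP[] := truncn_itv q0; set I := Num.truncn _; rewrite -natr1 => t1 t2.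
have dI1 : d%:R * I%:R <= eta * c n by rewrite mulrC -ler_pdivlMr.
have dI2 : eta * c n < d%:R * I%:R + d%:R by move: t2; rewrite ltr_pdivrMr //; forget_after A; lra.
have dI3 : eta / 2 * c n <= d%:R * I%:R by move: dI2 cl'; forget_after A; lra.
have I0 : 0 < I%:R :> R by rewrite -(pmulr_rgt0 _ d0); apply: lt_le_trans dI3; rewrite !mulr_gt0.
have NE : (k + d * I)%:R - k%:R = d%:R * I%:R :> R by rewrite natrD natrM addrAC subrr add0r.
have := Hn1 k (k + d * I)%N Ak kB; rewrite NE sum_residue // => /(_ dI3 dI1).
set x := k%:R / c n; set S := \sum_(i < I) q n _.
have xA : A <= x by rewrite ler_pdivlMr.
have xB : x <= B by rewrite ler_pdivrMr.
have x0 : 0 < x by exact: lt_le_trans xA.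
have wU : w x <= U by apply: HU; rewrite xA xB.
have w0 := w_gt0 x0.
have S_ge0 : 0 <= S by apply: sumr_ge0.
move=> Hcl.
have {Hcl} : `|c n * S / I%:R - d%:R * w x| <= e / 4.
  have -> : c n * S / I%:R - d%:R * w x = (S - d%:R * I%:R / c n * w x) * (c n / I%:R).
    by field; rewrite !lt0r_neq0.
  rewrite normrM [X in _ * X]gtr0_norm ?divr_gt0 //.
  apply: (@le_trans _ _ (e / (8 * d%:R) * eta * (c n / I%:R))).
    by rewrite ler_wpM2r // divr_ge0 // ltW.
  have -> : e / (8 * d%:R) * eta * (c n / I%:R) = (e / 4) * ((eta / 2 * c n) / (d%:R * I%:R)).
    by field; rewrite !lt0r_neq0.
  by rewrite ler_piMr ?divr_ge0 ?(ltW e0) // ler_pdivrMr ?mul1r // mulr_gt0.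
set s := c n * S / I%:R => Hs; set u := c n * q n k.
have s0 : 0 <= s by rewrite !mulr_ge0 ?invr_ge0 // ltW.
have sS : s <= S0.
  have : d%:R * w x <= d%:R * U by rewrite ler_wpM2l // ltW.
  by move: Hs; rewrite ler_norml /S0 => /andP[_]; move: e0; forget_after A; lra.
pose g := x * expR (- (v * x)).
have g0 : 0 < g by rewrite mulr_gt0 // expR_gt0.
have alg : al <= g.
  apply: ler_pM; rewrite ?expR_ge0 ?(ltW A0) // ler_expR lerN2.
  by rewrite ler_wpM2l // ltW.
have GE l : G n l = c n * q n l * ((l%:R / c n) * expR (- (v * (l%:R / c n)))).
  have -> : expR (- (v * (l%:R / c n))) = expR (- (v / c n)) ^+ l.
    by rewrite -expRM_natl; congr expR; field; rewrite lt0r_neq0.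
  by rewrite /G; field; rewrite lt0r_neq0.
have Gk : G n k = u * g by rewrite GE.
have Gi i : (i < I)%N -> [/\ `|G n (k + d * i) - u * g| <= al * (e / 4),
    c n * q n (k + d * i) * (g * expR (- (v * eta))) <= G n (k + d * i) &
    G n (k + d * i) <= c n * q n (k + d * i) * (g * (1 + eta / A))].
  move=> iI.
  have lE : (k + d * i)%:R / c n = x + d%:R * i%:R / c n by rewrite natrD natrM mulrDl.
  have di0 : 0 <= d%:R * i%:R / c n by rewrite !mulr_ge0 ?invr_ge0 // ltW.
  have dil : d%:R * i%:R <= eta * c n.
    by apply: (le_trans _ dI1); rewrite ler_wpM2l ?(ltW d0) // ler_nat ltnW.
  have di1 : d%:R * i%:R / c n <= eta by rewrite ler_pdivrMr.
  have cq0 : 0 <= c n * q n (k + d * i) by rewrite mulr_ge0 // ltW.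
  split.
  - rewrite -Gk; apply: Hsm => //; first by rewrite addnC mulnC modnMDl.
    rewrite natrD natrM addrAC subrr add0r ger0_norm ?mulr_ge0 ?(ltW d0) //.
    by apply: (le_trans dil); rewrite ler_wpM2r // ltW.
  - rewrite GE lE ler_wpM2l // /g -mulrA -expRD; apply: ler_pM; rewrite ?expR_ge0 ?(ltW x0) //.
      by rewrite lerDl.
    by rewrite ler_expR -opprD lerN2 -mulrDr ler_wpM2l ?(ltW v_gt0) // lerD2l.
  - rewrite GE lE ler_wpM2l // /g [leRHS]mulrAC; apply: ler_pM; rewrite ?expR_ge0 //.
    + exact: addr_ge0 (ltW x0) di0.
    + rewrite mulrDr mulr1 lerD2l; apply: (le_trans di1).
      by rewrite mulrCA ler_peMr ?(ltW eta0) // ler_pdivlMr // mul1r.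
    + by rewrite ler_expR lerN2 ler_wpM2l ?(ltW v_gt0) // lerDl.
have sumE (z : R) : \sum_(i < I) c n * q n (k + d * i) * z = I%:R * (s * z).
  rewrite -mulr_suml -mulr_sumr -/S /s; field; rewrite lt0r_neq0 //.
have sum_cst (z : R) : \sum_(i < I) z = I%:R * z by rewrite sumr_const card_ord mulr_natl.
have lo : s * (g * expR (- (v * eta))) <= u * g + al * (e / 4).
  rewrite -(ler_pM2l I0) -sumE -sum_cst; apply: ler_sum => i _.
  have [h1 h2 _] := Gi i (ltn_ord i); apply: (le_trans h2).
  by move: h1; rewrite ler_norml => /andP[_]; forget_after A; lra.
have up : u * g - al * (e / 4) <= s * (g * (1 + eta / A)).
  rewrite -(ler_pM2l I0) -sumE -sum_cst; apply: ler_sum => i _.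
  have [h1 _ h2] := Gi i (ltn_ord i); apply: (le_trans _ h2).
  by move: h1; rewrite ler_norml => /andP[+ _]; forget_after A; lra.
have ale : al * (e / 4) <= g * (e / 4) by rewrite ler_wpM2r // divr_ge0 // ltW.
have lo' : s * (1 - v * eta) <= u + e / 4.
  rewrite -(ler_pM2l g0); apply: (@le_trans _ _ (s * (g * expR (- (v * eta))))).
    by rewrite mulrCA ler_wpM2l // ler_wpM2l ?(ltW g0) // (le_trans _ (expR_ge1Dx _)).
  by apply: (le_trans lo); move: ale; forget_after A; lra.
have up' : u <= s * (1 + eta / A) + e / 4.
  rewrite -(ler_pM2l g0).
  have -> : g * (s * (1 + eta / A) + e / 4) = s * (g * (1 + eta / A)) + g * (e / 4) by ring.
  by move: up ale; forget_after A; lra.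
have b1 : s * (v * eta) <= S0 * (v * eta) by rewrite ler_wpM2r // mulr_ge0 // ltW.
have b2 : s * (eta / A) <= S0 * (eta / A) by rewrite ler_wpM2r // mulr_ge0 ?invr_ge0 // ltW.
have b3 : 0 <= S0 * (v * eta) by rewrite !mulr_ge0 // ltW.
have b4 : 0 <= S0 * (eta / A) by rewrite !mulr_ge0 ?invr_ge0 // ltW.
have etS' : S0 * (v * eta) + S0 * (eta / A) <= e / 4 by move: etS; rewrite mulrDr mulrDr [eta * v]mulrC.
move: Hs; rewrite !ler_norml => /andP[h1 h2].
by move: h1 h2 lo' up' b1 b2 b3 b4 etS'; forget_after A; apply/andP; split; lra.
Qed.
End LocalLimit.

(** * Lower deviations *)

Section SandwichAsymptotics.
Context {R : realType}.
Variables (c : nat -> R) (m : R) (d mu : nat).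
Hypothesis d_gt0 : (0 < d)%N.
Hypothesis m1 : 1 < m.
Hypothesis c_ge1 : forall n, 1 <= c n.
Hypothesis c_infty : forall X : R, exists n0, forall n, (n0 <= n)%N -> X <= c n.

(** The lower limit is c_a / (2 m) and not c_a / m, so that x = 1 / m can be approximated by k / c_a
    from below. *)
Definition admissible a k := k = mu %[mod d] /\ c a / (2 * m) <= k%:R <= c a.

Lemma admissible_approx x del a1 : m^-1 <= x <= 1 -> 0 < del ->
  exists a k, [/\ (a1 <= a)%N, admissible a k & `|k%:R / c a - x| < del].
Proof.
move=> /andP[x1 x2] del0.
have m0 : 0 < m by exact: lt_trans m1.
have x0 : 0 < x by apply: lt_le_trans x1; rewrite invr_gt0.
pose D : R := d.+1%:R.
have D0 : 0 < D by rewrite ltr0n.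
have [n1 H1] := c_infty (D / del + 1); have [n2 H2] := c_infty (2 * m * D).
have [n3 H3] := c_infty (m * mu.+1%:R).
pose a := maxn a1 (maxn n1 (maxn n2 n3)).
have ca1 : D / del + 1 <= c a by apply: H1; rewrite /a !leq_max leqnn !orbT.
have ca2 : 2 * m * D <= c a by apply: H2; rewrite /a !leq_max leqnn !orbT.
have ca3 : m * mu.+1%:R <= c a by apply: H3; rewrite /a !leq_max leqnn !orbT.
have cn : 0 < c a by exact: lt_le_trans (c_ge1 a).
have xc0 : 0 <= x * c a by rewrite mulr_ge0 // ltW.
have /andP[t1 t2] := truncn_itv xc0; set n0 := Num.truncn _ in t1 t2.
have xc1 : m^-1 * c a <= x * c a by rewrite ler_wpM2r // ltW.
have xc2 : x * c a <= c a by rewrite ler_piMl // ltW.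
have mun : (mu <= n0)%N.
  rewrite -ltnS -(ltr_nat R); apply: le_lt_trans t2.
  apply: le_trans xc1; rewrite ler_pdivlMl //; apply: (le_trans _ ca3).
  by rewrite ler_wpM2l ?(ltW m0) // ler_nat.
(* Lowers n0 to the residue class of mu, by less than d. *)
pose k := (n0 - (n0 - mu) %% d)%N.
have rd : ((n0 - mu) %% d < d)%N by rewrite ltn_pmod.
have rn : ((n0 - mu) %% d <= n0 - mu)%N by exact: leq_mod.
have kE : (k + (n0 - mu) %% d = n0)%N by rewrite subnK // (leq_trans rn) // leq_subr.
have kmu : k = mu %[mod d].
  apply/eqP; rewrite eqn_mod_dvd.
    have -> : (k - mu = (n0 - mu) %/ d * d)%N.
      by rewrite /k subnAC {1}(divn_eq (n0 - mu) d) addnK.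
    exact: dvdn_mull.
  by rewrite /k leq_subRL ?(leq_trans rn) ?leq_subr // addnC -leq_subRL.
have k1 : k%:R <= x * c a by apply: (le_trans _ t1); rewrite ler_nat leq_subr.
have k2 : x * c a < k%:R + D.
  apply: (lt_le_trans t2); rewrite -natrD ler_nat -kE addnS ltnS leq_add2l; exact: ltnW.
exists a, k; split; first by rewrite leq_max leqnn.
  split=> //; rewrite (le_trans k1 xc2) andbT.
  have : D <= c a / (2 * m) by rewrite ler_pdivlMr ?mulr_gt0 // mulrC.
  have -> : c a / (2 * m) = m^-1 * c a / 2 by field; rewrite lt0r_neq0.
  by lra.
rewrite distrC ger0_norm; last by rewrite subr_ge0 ler_pdivrMr.
rewrite ltrBlDr -(@ltr_pM2r _ (c a)) // mulrDl divfK ?lt0r_neq0 //.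
have : D < del * c a.
  have : D / del < c a by lra.
  by rewrite ltr_pdivrMr // mulrC.
by lra.
Qed.

Variables (X : nat -> nat -> nat -> R) (V : nat -> R -> R) (psi : nat -> R) (C B del0 : R) (a0 : nat).
Hypothesis C_ge0 : 0 <= C.
Hypothesis psi_mono : forall r r', (0 < r)%N -> (r <= r')%N -> psi r <= psi r'.
Hypothesis psi_le : forall r, (0 < r)%N -> psi r <= B.
Hypothesis X_sandwich : forall a k r r', (a0 <= a)%N -> admissible a k -> (0 < r)%N ->
  (r <= r')%N -> X r a k <= X r' a k /\ X r' a k <= X r a k + C * (psi r' - psi r).
Hypothesis X_limit : forall r e, (0 < r)%N -> 0 < e -> exists a1, forall a k, (a1 <= a)%N ->
  admissible a k -> `|X r a k - V r (k%:R / c a)| <= e.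
Hypothesis V_cont : forall r x e, (0 < r)%N -> 0 < x -> 0 < e -> exists2 del, 0 < del &
  forall y, 0 < y -> `|y - x| < del -> `|V r y - V r x| <= e.
Hypothesis del0_gt0 : 0 < del0.
Hypothesis V_ge : forall x, m^-1 <= x <= 1 -> del0 <= V 1 x.

(* Approximate [x] by [k / c a] with [k] admissible and let [a] tend to infinity. *)
Lemma limit_sandwich r r' x : (0 < r)%N -> (r <= r')%N -> m^-1 <= x <= 1 ->
  V r x <= V r' x /\ V r' x <= V r x + C * (psi r' - psi r).
Proof.
move=> r0 rr' x01; have r'0 : (0 < r')%N by exact: leq_trans rr'.
have m0 : 0 < m by exact: lt_trans m1.
have x0 : 0 < x by case/andP: x01 => + _; apply: lt_le_trans; rewrite invr_gt0.
have approx e : 0 < e -> exists y y', [/\ `|y - V r x| <= e, `|y' - V r' x| <= e, y <= y' &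
    y' <= y + C * (psi r' - psi r)].
  move=> e0; have e20 : 0 < e / 2 by rewrite divr_gt0.
  have [n1 H1] := X_limit r0 e20; have [n2 H2] := X_limit r'0 e20.
  have [d1 d10 G1] := V_cont r0 x0 e20; have [d2 d20 G2] := V_cont r'0 x0 e20.
  have dd : 0 < Num.min d1 d2 by rewrite lt_min d10.
  have [a [k [aa adm]]] := admissible_approx (maxn a0 (maxn n1 n2)) x01 dd.
  rewrite lt_min => /andP[g1 g2].
  move: aa; rewrite !geq_max => /andP[aa0 /andP[an1 an2]].
  have cn : 0 < c a by exact: lt_le_trans (c_ge1 a).
  have y0 : 0 < k%:R / c a.
    rewrite divr_gt0 //; have [_ /andP[h _]] := adm; apply: lt_le_trans h.
    by rewrite divr_gt0 // mulr_gt0.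
  have [s1 s2] := X_sandwich aa0 adm r0 rr'.
  exists (X r a k), (X r' a k); split=> //.
    have := H1 a k an1 adm; have := G1 _ y0 g1; rewrite !ler_norml => /andP[u1 u2] /andP[u3 u4].
    by move: u1 u2 u3 u4; forget_after r; apply/andP; split; lra.
  have := H2 a k an2 adm; have := G2 _ y0 g2; rewrite !ler_norml => /andP[u1 u2] /andP[u3 u4].
  by move: u1 u2 u3 u4; forget_after r; apply/andP; split; lra.
split; apply/ler_addgt0Pr => e e0; have e20 : 0 < e / 2 by rewrite divr_gt0.
  have [y [y' [h1 h2 h3 h4]]] := approx _ e20; move: h1 h2.
  by rewrite !ler_norml => /andP[? ?] /andP[? ?]; lra.
have [y [y' [h1 h2 h3 h4]]] := approx _ e20; move: h1 h2.
by rewrite !ler_norml => /andP[? ?] /andP[? ?]; lra.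
Qed.

(** From a fixed large generation on, X and V each move by at most C times the increment of psi, and
    at that generation they are close for large a; hence A0 does not depend on r. The error becomes
    relative because V_r >= V_1 >= del0. *)
Lemma sandwich_asymptotics e : 0 < e -> exists R0 A0, (0 < R0)%N /\ forall r a k, (R0 <= r)%N ->
  (A0 <= a)%N -> admissible a k -> c a / m <= k%:R ->
  `|X r a k - V r (k%:R / c a)| <= e * V r (k%:R / c a).
Proof.
move=> e0; pose e1 := e * del0 / 2.
have e10 : 0 < e1 by rewrite divr_gt0 // mulr_gt0.
have [l Hl] : exists l : R, (fun n => psi n.+1) @ \oo --> l.
  by apply: (@monotone_bounded_cvg _ _ B) => [n n' nn|n]; [exact: psi_mono|exact: psi_le].
have C10 : 0 < C + 1 by rewrite ltr_wpDl.
have [R0 HR] : exists R0, forall r, (R0.+1 <= r)%N -> C * (psi r - psi R0.+1) <= e1.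
  have eC : 0 < e1 / (C + 1) / 2 by rewrite divr_gt0 // divr_gt0.
  move/cvgn_distP: Hl => /(_ _ eC)[N HN]; exists N => r Nr.
  have r0 : (0 < r)%N by exact: leq_trans Nr.
  have h1 := HN N (leqnn _); have := HN r.-1; rewrite prednK // => /(_ _) h2.
  have {}h2 : `|psi r - l| < e1 / (C + 1) / 2 by apply: h2; rewrite -ltnS prednK.
  have h3 : psi r - psi N.+1 <= e1 / (C + 1).
    move: h1 h2; rewrite !ltr_norml => /andP[? ?] /andP[? ?]; lra.
  apply: (@le_trans _ _ (C * (e1 / (C + 1)))); first by rewrite ler_wpM2l.
  by rewrite mulrA ler_pdivrMr // mulrC ler_wpM2l ?(ltW e10) // lerDl.
have [a1 Ha1] := @X_limit R0.+1 e1 isT e10.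
exists R0.+1, (maxn a0 a1); split=> // r a k Rr; rewrite geq_max => /andP[aa0 aa1] adm kl.
have m0 : 0 < m by exact: lt_trans m1.
have cn : 0 < c a by exact: lt_le_trans (c_ge1 a).
have x01 : m^-1 <= k%:R / c a <= 1.
  rewrite ler_pdivlMr // ler_pdivrMr // mul1r mulrC kl /=.
  by case: adm => _ /andP[].
have [s1 s2] := X_sandwich aa0 adm (isT : (0 < R0.+1)%N) Rr.
have [t1 t2] := limit_sandwich (isT : (0 < R0.+1)%N) Rr x01.
have [u1 _] := limit_sandwich (isT : (0 < 1)%N) (leq_trans (isT : (1 <= R0.+1)%N) Rr) x01.
have Vr : del0 <= V r (k%:R / c a) by apply: le_trans (V_ge x01) u1.
have b1 := HR r Rr; have := Ha1 a k aa1 adm; rewrite ler_norml => /andP[b2 b3].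
have b4 : e * del0 <= e * V r (k%:R / c a) by rewrite ler_wpM2l // ltW.
have e1E : e1 = e * del0 / 2 by [].
by rewrite ler_norml; apply/andP; split; lra.
Qed.
End SandwichAsymptotics.

(** * Growth of the normalising constants *)

Section ScaleRatio.
Context {R : realType}.
Variables (c : nat -> R) (m : R).
Hypothesis m1 : 1 < m.
Hypothesis c0 : c 0%N = 1.
Hypothesis cS : forall n, c n < c n.+1 /\ c n.+1 <= m * c n.
Hypothesis cL : exists L : R -> R, slowly_varying L /\ forall n, c n = m ^+ n * L (m ^+ n).

Let m0 : 0 < m. Proof. exact: lt_trans m1. Qed.

Lemma expr_pinfty : (fun n => m ^+ n) @ \oo --> +oo.
Proof.
apply/cvgryPge => A; have d0 : 0 < m - 1 by rewrite subr_gt0.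
have bern n : n%:R * (m - 1) <= m ^+ n.
  elim: n => [|n IH]; first by rewrite mul0r expr0 ler01.
  rewrite -natr1 mulrDl mul1r exprS.
  have mn : 1 <= m ^+ n by rewrite exprn_ege1 // ltW.
  have := ler_wpM2l (ltW d0) mn; lra.
exists (Num.bound (A / (m - 1))) => // n /= Hn.
apply: le_trans (bern n); rewrite -ler_pdivrMr //.
apply: (le_trans (ler_norm _)); apply: (@le_trans _ _ (Num.bound (A / (m - 1)))%:R).
  have -> : Num.bound (A / (m - 1)) = Num.bound `|A / (m - 1)| by rewrite /Num.bound normr_id.
  exact: ltW (archi_boundP (normr_ge0 _)).
by rewrite ler_nat.
Qed.

(** Slow variation with dilation m, along the points m^n. *)
Lemma scale_ratio : (fun n => c n.+1 / c n) @ \oo --> m.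
Proof.
have [L [[_ [_ Llim]] cE]] := cL.
have H : (fun n => L (m * m ^+ n) / L (m ^+ n)) @ \oo --> (1 : R).
  exact: (cvg_comp _ _ expr_pinfty (Llim m m0)).
have -> : (fun n => c n.+1 / c n) = (fun n => m * (L (m * m ^+ n) / L (m ^+ n))).
  apply/funext => n.
  have := scale_gt0 c0 cS n; rewrite !cE !exprS => cn.
  have mn : m ^+ n != 0 by rewrite expf_neq0 // lt0r_neq0.
  have Ln : L (m ^+ n) != 0 by apply: contraTneq cn => ->; rewrite mulr0 ltxx.
  by field; rewrite Ln mn.
by rewrite -[m in X in _ --> X]mulr1; apply: cvgM => //; exact: cvg_cst.
Qed.

Lemma scale_ratio_iter r : (fun a => c (r + a)%N / c a) @ \oo --> m ^+ r.
Proof.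
have cn n := scale_gt0 c0 cS n.
elim: r => [|r IH].
  rewrite expr0 (_ : (fun a => _) = fun=> 1); first exact: cvg_cst.
  by apply/funext => a; rewrite add0n divff // lt0r_neq0.
have -> : (fun a => c (r.+1 + a)%N / c a) = (fun a => c (r + a).+1 / c (r + a)%N * (c (r + a)%N / c a)).
  by apply/funext => a; rewrite addSn mulrA divfK // lt0r_neq0.
rewrite exprS; apply: cvgM => //.
have := scale_ratio; move/cvgn_distP => H; apply/cvgn_distP => e /H[N HN].
by exists N => a Na; apply: HN; rewrite (leq_trans Na) // leq_addl.
Qed.

(** A bounded nondecreasing sequence of terms at least 1 would have consecutive ratios tending to 1,
    contrary to [scale_ratio]. *)
Lemma scale_infty X : exists n0, forall n, (n0 <= n)%N -> X <= c n.
Proof.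
apply: contrapT => H.
have bnd n : c n <= X.
  rewrite leNgt; apply/negP => Xn; apply: H; exists n => n' nn'.
  by apply: (le_trans (ltW Xn)); exact: (scale_le cS).
have [l Hl] := monotone_bounded_cvg (fun n n' => @scale_le _ _ _ cS n n') bnd.
have l1 : 1 <= l by apply: (cvgn_ge_cst Hl); exists 0%N => n _; exact: (scale_ge1 c0 cS).
have l0 : l != 0 by rewrite lt0r_neq0 // (lt_le_trans ltr01).
have Hl' : (fun n => c n.+1) @ \oo --> l.
  move/cvgn_distP: Hl => Hl; apply/cvgn_distP => e /Hl[N HN].
  by exists N => n Nn; apply: HN; exact: leqW.
have : (fun n => c n.+1 / c n) @ \oo --> l / l by apply: cvgM => //; exact: cvgV.
rewrite divff // => H1; have E : 1 = m by exact: cvg_unique H1 scale_ratio.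
by have := m1; lra.
Qed.
End ScaleRatio.

(** * Geometric decay in the number of ancestors *)

Section ExpBounds.
Context {R : realType}.
Variables (P : {poly R}) (theta s B : R) (k : nat).
Hypothesis P0 : nneg_poly P.
Hypothesis theta_s : theta < s.
Hypothesis Ptheta : \sum_(l < k.+1) P`_l <= theta.

Let theta0 : 0 <= theta.
Proof. by apply: le_trans Ptheta; apply: sumr_ge0. Qed.

Lemma exp_coef_sum_le j : (0 < k)%N -> \sum_(1 <= l < k.+1) (P ^+ j)`_l <= s ^+ j.
Proof.
move=> k0; apply: (@le_trans _ _ (\sum_(l < k.+1) (P ^+ j)`_l)).
  rewrite -(big_mkord xpredT (fun l => (P ^+ j)`_l)) [leRHS]big_ltn // lerDr.
  exact: nneg_poly_exp.
apply: (le_trans (coef_exp_sum_le j k P0)).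
apply: (@le_trans _ _ (theta ^+ j)).
  by rewrite lerXn2r ?nnegrE // sumr_ge0.
by rewrite lerXn2r ?nnegrE ?(le_trans theta0) // ltW.
Qed.

(** By [coef_exp_deriv], k (P^j)_k is at most j B theta^(j-1), and convexity of x^j bounds j
    theta^(j-1) by s^j / (s - theta). For P = f_a and k <= c_a one can take theta < 1, because only
    the event Z_a <= k counts. *)
Lemma exp_coef_le j : (forall l, (l <= k)%N -> l%:R * P`_l <= B) -> (0 < j)%N ->
  k%:R * (P ^+ j)`_k <= B / (s - theta) * s ^+ j.
Proof.
move=> HB j0; have st : 0 < s - theta by rewrite subr_gt0.
have B0 : 0 <= B by apply: le_trans (HB 0%N _) => //; rewrite mul0r.
have sum1 : \sum_(l < k.+1) (l%:R * P`_l) * (P ^+ j.-1)`_(k - l) <= B * theta ^+ j.-1.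
  apply: (@le_trans _ _ (\sum_(l < k.+1) B * (P ^+ j.-1)`_(k - l))).
    apply: ler_sum => l _; apply: ler_wpM2r; first exact: nneg_poly_exp.
    by apply: HB; rewrite -ltnS.
  rewrite -mulr_sumr ler_wpM2l //.
  rewrite (reindex_inj rev_ord_inj) /=.
  rewrite (eq_bigr (fun l : 'I_k.+1 => (P ^+ j.-1)`_l)); last first.
    by move=> l _; rewrite subSS subKn // -ltnS.
  apply: (le_trans (coef_exp_sum_le j.-1 k P0)).
  by rewrite lerXn2r ?nnegrE // sumr_ge0.
have bern : j%:R * theta ^+ j.-1 <= (s - theta)^-1 * s ^+ j.
  rewrite ler_pdivlMl //.
  have nX : nneg_poly ('X^j : {poly R}) by apply: nneg_poly_exp; exact: nneg_polyX.
  have := horner_sub_ge nX theta0 (ltW theta_s).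
  rewrite derivXn hornerMn !hornerXn mulr_natl => /le_trans; apply.
  by rewrite gerBl exprn_ge0.
rewrite coef_exp_deriv -mulrA.
apply: (@le_trans _ _ (j%:R * (B * theta ^+ j.-1))); first by rewrite ler_wpM2l.
by rewrite mulrCA ler_wpM2l.
Qed.
End ExpBounds.

(** * Both asymptotics, uniformly in the splitting generation *)

Section LowerDeviations.
Context {R : realType} {dT : measure_display} {T : measurableType dT}.
Variables (P : probability T R) (p : nat -> R) (m : R) (d mu : nat).
Variables (Z : nat -> T -> nat) (c : nat -> R) (W : {RV P >-> R}) (w : R -> R).
Hypothesis pl : offspring_law p.
Hypothesis p_lt1 : forall j, p j < 1.
Hypothesis pm : offspring_mean p m.
Hypothesis m1 : 1 < m.
Hypothesis schroeder : 0 < p 0%N + p 1%N.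
Hypothesis d_span : span_gcd p d.
Hypothesis mu_min : min_support p mu.
Hypothesis GW : GW_process P p Z.
Hypothesis c0 : c 0%N = 1.
Hypothesis cS : forall n, c n < c n.+1 /\ c n.+1 <= m * c n.
Hypothesis cL : exists L : R -> R, slowly_varying L /\ forall n, c n = m ^+ n * L (m ^+ n).
Hypothesis ZW : {ae P, forall t, (fun n => (Z n t)%:R / c n) @ \oo --> W t}.
Hypothesis w_gt0 : forall x : R, 0 < x -> 0 < w x.
Hypothesis w_cont : {within `]0, +oo[, continuous w}.
Hypothesis w_density : forall A : set R, measurable A -> A `<=` `]0, +oo[ ->
  P (W @^-1` A) = (\int[lebesgue_measure]_(x in A) (w x)%:E)%E.

Let q := law P Z.
Let m0 : 0 < m. Proof. exact: lt_trans m1. Qed.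
Let d0 : (0 < d)%N. Proof. by case: d_span. Qed.
Let dr0 : 0 < d%:R :> R. Proof. by rewrite ltr0n. Qed.
Let cge1 := scale_ge1 c0 cS.
Let cgt0 := scale_gt0 c0 cS.
Let cinf := scale_infty m1 c0 cS cL.
Let tight := law_tight GW cge1 ZW.
Let window := law_window GW cge1 cinf ZW w_gt0 w_cont w_density.
Let hq : forall n k, (fun K => (iter_gf p K n)`_k) @ \oo --> q n k.
Proof. exact: coef_iter_gf_cvg pl (law0 GW) (law_ge0 P Z) (law_rec GW). Qed.
Let hle K n k : (iter_gf p K n)`_k <= q n k.
Proof. exact: (coef_iter_gf_le pl (law0 GW) (law_ge0 P Z) (law_rec GW)). Qed.
Let q_ge0 n k : 0 <= q n k. Proof. exact: law_ge0. Qed.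
Let w_bounded := density_bounded w_gt0 w_cont.

Let scaled_range r a k : admissible c m d mu a k ->
  [/\ (2 * m * m ^+ r)^-1 * c (r + a)%N <= k%:R, k%:R <= 1 * c (r + a)%N,
      0 < k%:R :> R & (2 * m)^-1 <= k%:R / c a <= 1].
Proof.
move=> [_ /andP[k1 k2]]; have ca := cgt0 a; have mr0 : 0 < m ^+ r by rewrite exprn_gt0.
have k1' : (2 * m)^-1 * c a <= k%:R by rewrite mulrC.
have kpos : 0 < k%:R :> R by apply: lt_le_trans k1; rewrite divr_gt0 // mulr_gt0.
split=> //.
- apply: le_trans k1'; rewrite invfM -mulrA ler_wpM2l ?invr_ge0 ?mulr_ge0 ?(ltW m0) //.
  rewrite ler_pdivrMl //; have := scale_le_exp m1 cS (leq_addl r a).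
  by rewrite addnK.
- by rewrite mul1r (le_trans k2) // (scale_le cS) // leq_addl.
- by rewrite ler_pdivlMr // k1' ler_pdivrMr // mul1r.
Qed.

Let ratio_close r e : 0 < e -> exists a1, forall a, (a1 <= a)%N ->
  `|c a / c (r + a)%N - (m ^+ r)^-1| <= e.
Proof.
move=> e0; have mr0 : 0 < m ^+ r by rewrite exprn_gt0.
have : (fun a => (c (r + a)%N / c a)^-1) @ \oo --> (m ^+ r)^-1.
  by apply: cvgV; [rewrite lt0r_neq0|exact: (scale_ratio_iter m1 c0 cS cL)].
move=> /cvgn_distP/(_ e e0)[N HN]; exists N => a /HN.
by rewrite invf_div => /ltW.
Qed.

Let ratio_le1 r a : 0 < c a / c (r + a)%N <= 1.
Proof.
by rewrite divr_gt0 //= ler_pdivrMr // mul1r (scale_le cS) // leq_addl.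
Qed.

Let scaled_pair r a k : admissible c m d mu a k ->
  let rho := c a / c (r + a)%N in let x := k%:R / c a in
  [/\ k%:R / c (r + a)%N = x * rho, (2 * m * m ^+ r)^-1 <= x * rho <= 1,
      (2 * m * m ^+ r)^-1 <= x / m ^+ r <= 1 & `|x * rho - x / m ^+ r| <= `|rho - (m ^+ r)^-1|].
Proof.
move=> adm rho x; have [h1 h2 h3 /andP[h4 h5]] := scaled_range r adm.
have mr0 : 0 < m ^+ r by rewrite exprn_gt0.
have mr1 : 1 <= m ^+ r by rewrite exprn_ege1 // ltW.
have E : k%:R / c (r + a)%N = x * rho.
  by rewrite /x /rho; field; rewrite !lt0r_neq0.
have x0 : 0 < x by rewrite divr_gt0.
split=> //.
- by rewrite -E ler_pdivlMr // h1 ler_pdivrMr.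
- rewrite invfM ler_wpM2r ?invr_ge0 ?(ltW mr0) //= ler_pdivrMr // mul1r (le_trans h5) //.
- by rewrite -mulrBr normrM ler_piMl // gtr0_norm.
Qed.

(** For fixed r this is the local limit theorem at generation r + a, with c_(r+a) replaced by m^r
    c_a. *)
Let point_mass_limit r e : 0 < e -> exists a1, forall a k, (a1 <= a)%N ->
  admissible c m d mu a k ->
  `|c a * q (r + a) k - d%:R / m ^+ r * w (k%:R / c a / m ^+ r)| <= e.
Proof.
move=> e0; have e30 : 0 < e / 3 by rewrite divr_gt0.
have mr0 : 0 < m ^+ r by rewrite exprn_gt0.
pose A := (2 * m * m ^+ r)^-1.
have A0 : 0 < A by rewrite invr_gt0 !mulr_gt0.
have A1 : A <= 1.
  rewrite invf_le1 ?mulr_gt0 //; have : 1 <= m ^+ r by rewrite exprn_ege1 // ltW.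
  by have := m1; nra.
have [v [B [v0 HB Hsm]]] := law_smooth pl p_lt1 pm m1 schroeder d_span mu_min hq c0 cS tight window.
have qmod n k : (0 < n)%N -> k != mu %[mod d] -> q n k = 0.
  exact: (law_mod pl (law0 GW) (law_ge0 P Z) (law_rec GW) d_span mu_min schroeder).
have cell := law_cell GW cge1 ZW w_gt0 w_cont w_density.
have [n0 Hn0] := local_limit d0 q_ge0 qmod cge1 cinf v0 Hsm w_gt0 w_bounded cell A0 A1 e30.
have [U U0 HU] := w_bounded 1 A0.
have wA x : A <= x <= 1 -> {for x, continuous w}.
  by move=> /andP[x1 _]; apply: (continuous_at_of_within w_cont); exact: lt_le_trans x1.
have ed0 : 0 < e / 3 / d%:R by rewrite divr_gt0.
have [del del0 Hdel] := uniform_continuity_itv wA ed0.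
have em0 : 0 < Num.min (del / 2) (e / 3 / (d%:R * U)).
  by rewrite lt_min !divr_gt0 // mulr_gt0.
have [a2 Ha2] := ratio_close r em0.
exists (maxn n0 a2) => a k; rewrite geq_max => /andP[an0 /Ha2] + adm.
rewrite le_min => /andP[rc1 rc2].
have [h1 h2 h3 _] := scaled_range r adm.
have [E xr xm xd] := scaled_pair r adm.
have := Hn0 (r + a)%N k (leq_trans an0 (leq_addl _ _)) (proj1 adm) h1 h2.
rewrite {}E; set rho := c a / c (r + a)%N in xr xd rc1 rc2 *; set x := k%:R / c a in xr xm xd *.
have /andP[rho0 rho1] : 0 < rho <= 1 by exact: ratio_le1.
set z := c (r + a)%N * q (r + a)%N k => Hz.
have -> : c a * q (r + a)%N k = rho * z by rewrite /rho /z; field; rewrite lt0r_neq0.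
have Hw : `|w (x * rho) - w (x / m ^+ r)| <= e / 3 / d%:R.
  apply: ltW; apply: Hdel => //; apply: (le_lt_trans xd); apply: (le_lt_trans rc1).
  by rewrite ltr_pdivrMr // ltr_pMr // ltr1n.
(* The three errors: the local limit theorem, the continuity of w, and c_a / c_(r+a) against
   m^(-r). *)
have -> : rho * z - d%:R / m ^+ r * w (x / m ^+ r) = rho * (z - d%:R * w (x * rho)) +
   (rho * (d%:R * (w (x * rho) - w (x / m ^+ r))) + d%:R * (rho - (m ^+ r)^-1) * w (x / m ^+ r)).
  by ring.
have -> : e = e / 3 + (e / 3 + e / 3) by field.
apply: (le_trans (ler_normD _ _)); apply: lerD.
  by rewrite normrM gtr0_norm // (le_trans _ Hz) // ler_piMl.
apply: (le_trans (ler_normD _ _)); apply: lerD.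
  rewrite normrM gtr0_norm // (@le_trans _ _ `|d%:R * (w (x * rho) - w (x / m ^+ r))|) //.
    by rewrite ler_piMl.
  by rewrite normrM gtr0_norm // mulrC -ler_pdivlMr.
have w0 : 0 < w (x / m ^+ r) by apply: w_gt0; case/andP: xm => + _; exact: lt_le_trans.
rewrite 2!normrM (gtr0_norm dr0) (gtr0_norm w0) mulrAC.
move: rc2; rewrite ler_pdivlMr ?mulr_gt0 // => rc2; apply: le_trans rc2.
rewrite [leRHS]mulrC ler_wpM2r // ler_wpM2l ?(ltW dr0) //; exact: HU.
Qed.

Let cdf_lip A B : 0 < A -> exists2 U, 0 < U & forall x y, A <= x <= B -> A <= y <= B ->
  `|cdf_pos W x - cdf_pos W y| <= U * `|x - y|.
Proof.
move=> A0; have [U U0 HU] := cdf_pos_lip w_gt0 w_cont w_density B A0; exists U => // x y.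
wlog yx : x y / y <= x.
  move=> H x1 y1; have [yx|/ltW xy] := leP y x; first exact: H.
  by rewrite distrC [`|x - y|]distrC; exact: H.
move=> /andP[x1 x2] /andP[y1 y2]; have /andP[u1 u2] := HU y x y1 yx x2.
by rewrite !ger0_norm ?subr_ge0 // lerBlDl.
Qed.

Let cumulative_limit r e :
  (forall e', 0 < e' -> exists eta n0, 0 < eta /\ forall n N, (n0 <= n)%N -> N%:R <= eta * c n ->
     \sum_(1 <= k < N.+1) q n k <= e') ->
  0 < e -> exists a1, forall a k, (a1 <= a)%N -> admissible c m d mu a k ->
  `|\sum_(1 <= l < k.+1) q (r + a)%N l - cdf_pos W (k%:R / c a / m ^+ r)| <= e.
Proof.
move=> small e0; have e20 : 0 < e / 2 by rewrite divr_gt0.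
have mr0 : 0 < m ^+ r by rewrite exprn_gt0.
pose A := (2 * m * m ^+ r)^-1.
have A0 : 0 < A by rewrite invr_gt0 !mulr_gt0.
have A1 : A <= 1.
  rewrite invf_le1 ?mulr_gt0 //; have : 1 <= m ^+ r by rewrite exprn_ege1 // ltW.
  by have := m1; nra.
have [n0 Hn0] := law_cdf GW cge1 ZW w_gt0 w_cont w_density A0 A1 e20 small.
have [U U0 HU] := cdf_lip 1 A0.
have em0 : 0 < e / 2 / U by rewrite divr_gt0.
have [a2 Ha2] := ratio_close r em0.
exists (maxn n0 a2) => a k; rewrite geq_max => /andP[an0 /Ha2 rc] adm.
have [h1 h2 h3 _] := scaled_range r adm.
have [E xr xm xd] := scaled_pair r adm.
have := Hn0 (r + a)%N k (leq_trans an0 (leq_addl _ _)) h1 h2.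
rewrite {}E; set rho := c a / c (r + a)%N in xr xd rc *; set x := k%:R / c a in xr xm xd *.
move=> Hz.
have Hc : `|cdf_pos W (x * rho) - cdf_pos W (x / m ^+ r)| <= e / 2.
  apply: (le_trans (HU _ _ xr xm)); rewrite mulrC -ler_pdivlMr //.
  exact: (le_trans xd rc).
apply: (le_trans (ler_distD (cdf_pos W (x * rho)) _ _)).
by rewrite (splitr e) lerD.
Qed.

(** W charges the interval from 2 to 3, so Z_a >= 2 c_a has probability at least e for large a; this
    keeps [theta] below 1. *)
Let law_survival_bound : exists theta n0, [/\ 0 <= theta, theta < 1 &
  forall a k, (n0 <= a)%N -> k%:R <= c a -> \sum_(0 <= l < k.+1) q a l <= theta].
Proof.
have [e [n0 [e0 H]]] := @window 2 3 (ltr0n _ _) (ltac:(lra)).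
have le1 a k : (n0 <= a)%N -> k%:R <= c a -> \sum_(0 <= l < k.+1) q a l <= 1 - e.
  move=> na ka; have [N [N' [NN NN' S]]] := H a na.
  have ca := cgt0 a.
  have kN : (k < N)%N by rewrite -(ltr_nat R); lra.
  have mr : measurable [set t | (0 <= Z a t < N + N')%N].
    case: GW => mZ _; rewrite (_ : mkset _ = \bigcup_(k in [set k | (k < N + N')%N]) [set t | Z a t = k]).
      exact: bigcup_measurable.
    by apply/seteqP; split=> [t /= Ht|t /= [j /= Hj ->]//]; exists (Z a t).
  have := pr_le1 P mr; rewrite (law_range GW).
  rewrite (big_cat_nat (n := k.+1)) //=; last by rewrite (leq_trans kN) // leq_addr.
  have : \sum_(N <= l < N') q a l <= \sum_(k.+1 <= l < N + N') q a l.
    have [N'N|NN'l] := leqP N' N; first by rewrite [leLHS]big_geq // sumr_ge0.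
    rewrite [leRHS](big_cat_nat (n := N)) ?leq_addr //=.
    rewrite [X in _ + X](big_cat_nat (n := N')) ?leq_addl //=; last exact: ltnW.
    by rewrite addrCA lerDl addr_ge0 // sumr_ge0.
  by rewrite -/q; lra.
exists (1 - e), n0; split=> //; last by lra.
apply: le_trans (le1 n0 0%N (leqnn _) _); first by rewrite sumr_ge0.
exact: ltW.
Qed.

(* With [n = r + a], the factor [m ^+ r * c a] is the normalisation [m ^ (n - a_n) c_(a_n)]. *)
Lemma lower_deviations e : 0 < e -> exists R0 A0, (0 < R0)%N /\ forall r a k, (R0 <= r)%N ->
  (A0 <= a)%N -> admissible c m d mu a k -> c a / m <= k%:R ->
  let x := k%:R / c a / m ^+ r in
  `|q (r + a) k - d%:R / (m ^+ r * c a) * w x| <= e * (d%:R / (m ^+ r * c a) * w x) /\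
  `|\sum_(1 <= l < k.+1) q (r + a) l - cdf_pos W x| <= e * cdf_pos W x.
Proof.
move=> e0.
have [theta [n0 [th0 th1 Hth]]] := law_survival_bound.
have [s [kap [K0 [ths hs]]]] := contracts_exists pl pm m1 th1.
have [s_0 s_1 kap0 _] := hs.
have [g [psi [B [G [g0 psiB gG psim sw]]]]] := survival_sandwich pl pm m1 schroeder hs hq.
have [rho0 rho1] := contracts_rate pl hs; set rho := 1 - kap in rho0 rho1 gG.
have [v [Bv [v0 HB _]]] := law_smooth pl p_lt1 pm m1 schroeder d_span mu_min hq c0 cS tight window.
have Fn K a : nneg_poly (iter_gf p K a) := nneg_iter_gf pl K a.
have Fth K a k : (n0 <= a)%N -> k%:R <= c a -> \sum_(l < k.+1) (iter_gf p K a)`_l <= theta.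
  move=> na ka; apply: le_trans (Hth a k na ka); rewrite big_mkord.
  by apply: ler_sum => l _; exact: hle.
(* 2 m comes from 1 / k <= 2 m / c_a, and [expR v] from undoing the radial weight at l <= c_a. *)
pose C1 := 2 * m * (Bv * expR v / (s - theta)).
have Bv0 : 0 <= Bv by apply: le_trans (HB 1%N 0%N isT); rewrite !mul0r.
have st0 : 0 < s - theta by rewrite subr_gt0.
have C10 : 0 <= C1.
  by rewrite !mulr_ge0 ?invr_ge0 ?expR_ge0 ?(ltW m0) ?(ltW st0).
have point a k : (maxn n0 1 <= a)%N -> admissible c m d mu a k ->
    exists K1, forall K, (K1 <= K)%N -> forall j, (0 < j)%N ->
      \sum_(k <= l < k.+1) (iter_gf p K a ^+ j)`_l <= C1 / c a * s ^+ j.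
  rewrite geq_max => /andP[na a1] adm; exists 0%N => K _ j j0; rewrite big_nat1.
  have [_ /andP[k1 k2]] := adm; have [_ _ kpos _] := scaled_range 0 adm.
  have ca := cgt0 a.
  have coefB l : (l <= k)%N -> l%:R * (iter_gf p K a)`_l <= Bv * expR v.
    move=> lk; apply: (@le_trans _ _ (l%:R * q a l)); first by rewrite ler_wpM2l.
    have := HB a l a1; rewrite -expRM_natl => H.
    have lc : l%:R <= c a by rewrite (le_trans _ k2) // ler_nat.
    have E : expR (l%:R * - (v / c a)) * expR v >= 1.
      rewrite -expRD (le_trans _ (expR_ge1Dx _)) // lerDl; have : l%:R * (v / c a) <= v.
        by rewrite mulrCA ler_piMr ?(ltW v0) // ler_pdivrMr // mul1r.
      by rewrite mulrN; lra.
    apply: (@le_trans _ _ (l%:R * q a l * expR (l%:R * - (v / c a)) * expR v)).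
      by rewrite -[leRHS]mulrA ler_peMr // mulr_ge0.
    by rewrite ler_wpM2r // expR_ge0.
  have := exp_coef_le (Fn K a) ths (Fth K a k na k2) coefB j0.
  rewrite mulrC -ler_pdivlMr // => /le_trans; apply.
  have kca : k%:R^-1 <= 2 * m / c a.
    by rewrite -[2 * m / c a]invf_div lef_pV2 ?posrE // divr_gt0 // mulr_gt0.
  have pos : 0 <= Bv * expR v / (s - theta) * s ^+ j.
    by rewrite !mulr_ge0 ?invr_ge0 ?expR_ge0 ?exprn_ge0 ?(ltW st0) ?(ltW s_0).
  apply: le_trans (ler_wpM2l pos kca) _.
  by rewrite /C1 le_eqVlt; apply/orP; left; apply/eqP; ring.
clearbody C1.
have cumul a k : (n0 <= a)%N -> k%:R <= c a -> (0 < k)%N ->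
    exists K1, forall K, (K1 <= K)%N -> forall j, (0 < j)%N ->
      \sum_(1 <= l < k.+1) (iter_gf p K a ^+ j)`_l <= 1 * s ^+ j.
  move=> na ka k0; exists 0%N => K _ j _; rewrite mul1r.
  exact: (exp_coef_sum_le (Fn K a) ths (Fth K a k na ka)).
have kpos a k : admissible c m d mu a k -> (0 < k)%N.
  by move=> adm; have [_ _ + _] := scaled_range 0 adm; rewrite ltr0n.
(* The third inequality of the sandwich with C = 1 bounds the mass of 1 <= Z_n <= c_(n-r) by psi_r
   g_r, hence by a multiple of rho^r; [eta] = m^(-r) ensures eta c_n <= c_(n-r). *)
have small e' : 0 < e' -> exists eta n0, 0 < eta /\ forall n N, (n0 <= n)%N ->
    N%:R <= eta * c n -> \sum_(1 <= k < N.+1) q n k <= e'.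
  move=> e'0.
  have : geometric (`|B| * `|G|) rho @ \oo --> (0 : R).
    by apply: cvg_geometric; rewrite ger0_norm // ltW.
  move=> /cvgn_distP/(_ e' e'0)[r /(_ r.+1 (leqnSn _))]; rewrite subr0 => /ltr_normlW Hr.
  have mr0 : 0 < m ^+ r.+1 by rewrite exprn_gt0.
  exists (m ^+ r.+1)^-1, (n0 + r.+1)%N; split; first by rewrite invr_gt0.
  move=> n N nn Nc.
  have rn : (r.+1 <= n)%N by rewrite (leq_trans _ nn) // leq_addl.
  case: (posnP N) => [->|N0]; first by rewrite big_geq // ltW.
  have na : (n0 <= n - r.+1)%N by rewrite leq_subRL // addnC.
  have Nca : N%:R <= c (n - r.+1)%N.
    apply: (le_trans Nc); rewrite ler_pdivrMl //.
    have := scale_le_exp m1 cS (leq_subr r.+1 n).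
    by rewrite subKn.
  have [_ _] := sw (n - r.+1)%N 1%N N.+1 1 isT ler01 (cumul _ _ na Nca N0) r.+1 r.+1 isT (leqnn _).
  rewrite subnKC // mul1r ler_pdivrMr ?g0 // => /le_trans; apply.
  apply: (@le_trans _ _ (`|B| * (`|G| * rho ^+ r.+1))); last by rewrite mulrA ltW.
  apply: (@le_trans _ _ (`|B| * g r.+1)).
    by rewrite ler_wpM2r ?(ltW (g0 _ _)) // (le_trans (psiB _ _)) // ler_norm.
  rewrite ler_wpM2l //; apply: (le_trans (gG r.+1 isT)).
  by rewrite ler_wpM2r ?ler_norm // exprn_ge0 // ltW.
have wx x r : 0 < x -> 0 < x / m ^+ r by move=> x0; rewrite divr_gt0 // exprn_gt0.
(* Division by g_r makes the sandwich applicable and keeps the limits bounded below as r grows; g_r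
   cancels from the relative errors at the end. *)
pose X1 r a k := c a * q (r + a)%N k / g r.
pose V1 r x := d%:R / m ^+ r * w (x / m ^+ r) / g r.
pose X2 r a k := (\sum_(1 <= l < k.+1) q (r + a)%N l) / g r.
pose V2 r x := cdf_pos W (x / m ^+ r) / g r.
have [R1 [A1 [R10 H1]]] : exists R0 A0, (0 < R0)%N /\ forall r a k, (R0 <= r)%N ->
  (A0 <= a)%N -> admissible c m d mu a k -> c a / m <= k%:R ->
  `|X1 r a k - V1 r (k%:R / c a)| <= e * V1 r (k%:R / c a).
  have V1w x : 0 < x -> V1 1%N x > 0.
    move=> x0; apply: divr_gt0; last exact: g0.
    apply: mulr_gt0; first by rewrite divr_gt0 // exprn_gt0.
    exact: w_gt0 (wx _ _ x0).
  have wc r x : 0 < x -> {for x, continuous (V1 r)}.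
    move=> x0; rewrite /V1; apply: cvgM; last exact: cvg_cst.
    apply: cvgM; first exact: cvg_cst.
    apply: (@cvg_comp _ _ _ (fun y => y / m ^+ r) w); last first.
      by apply: (continuous_at_of_within w_cont); exact: wx.
    by apply: cvgM; [exact: cvg_id|exact: cvg_cst].
  have mi0 : m^-1 <= 1 by rewrite invf_le1 // ltW.
  have mi1 : 0 < m^-1 by rewrite invr_gt0.
  (* The lower bound [del0] is the minimum of the continuous positive function [V1 1] over
     [1 / m, 1]. *)
  have [|xm xm1 Hxm] := @EVT_min _ (V1 1%N) m^-1 1 mi0.
    apply: continuous_in_subspaceT => x; rewrite inE /= in_itv /= => /andP[x1 _].
    by apply: wc; exact: lt_le_trans x1.
  apply: (sandwich_asymptotics d0 m1 cge1 cinf (X := X1) (V := V1) (psi := psi)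
     (C := C1) (B := B) (del0 := V1 1%N xm) (a0 := maxn n0 1) C10 psim psiB) => //.
  - move=> a k r r' aa adm r0 rr'.
    have C1c : 0 <= C1 / c a by rewrite divr_ge0 // ltW.
    have [s1 s2 _] := sw a k k.+1 (C1 / c a) (kpos _ _ adm) C1c (point _ _ aa adm) r r' r0 rr'.
    rewrite !big_nat1 in s1 s2; have ca := cgt0 a.
    have t1 := ler_wpM2l (ltW ca) s1; have t2 := ler_wpM2l (ltW ca) s2.
    rewrite /X1; split; first by rewrite -!mulrA.
    rewrite -[leLHS]mulrA; apply: (le_trans t2).
    have := g0 r r0 => gr; rewrite le_eqVlt; apply/orP; left; apply/eqP.
    by field; rewrite !lt0r_neq0.
  - move=> r e1 r0 e10; have gr := g0 r r0.
    have [a1 Ha1] := point_mass_limit r (mulr_gt0 e10 gr).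
    exists a1 => a k aa adm; rewrite /X1 /V1 -mulrBl normrM [X in _ * X]gtr0_norm ?invr_gt0 //.
    by rewrite ler_pdivrMr // Ha1.
  - move=> r x e1 r0 x0 e10; have /cvgrPdist_le/(_ e1 e10)/nbhs_ballP[del /= del0 Hdel] := wc r x x0.
    exists del => // y y0 yx; rewrite distrC; apply: Hdel.
    by rewrite /ball /= distrC.
  - apply: V1w; move: xm1; rewrite in_itv /= => /andP[+ _]; exact: lt_le_trans.
have [R2 [A2 [R20 H2]]] : exists R0 A0, (0 < R0)%N /\ forall r a k, (R0 <= r)%N ->
  (A0 <= a)%N -> admissible c m d mu a k -> c a / m <= k%:R ->
  `|X2 r a k - V2 r (k%:R / c a)| <= e * V2 r (k%:R / c a).
  have mi1 : 0 < m^-1 by rewrite invr_gt0.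
  have cdf0 := cdf_pos_gt0 w_gt0 w_cont w_density.
  apply: (sandwich_asymptotics d0 m1 cge1 cinf (X := X2) (V := V2) (psi := psi)
     (C := 1) (B := B) (del0 := V2 1%N m^-1) (a0 := n0) ler01 psim psiB) => //.
  - move=> a k r r' aa adm r0 rr'; have [_ /andP[_ k2]] := adm.
    have [s1 s2 _] := sw a 1%N k.+1 1 isT ler01 (cumul _ _ aa k2 (kpos _ _ adm)) r r' r0 rr'.
    by split.
  - move=> r e1 r0 e10; have gr := g0 r r0.
    have [a1 Ha1] := cumulative_limit r small (mulr_gt0 e10 gr).
    exists a1 => a k aa adm; rewrite /X2 /V2 -mulrBl normrM [X in _ * X]gtr0_norm ?invr_gt0 //.
    by rewrite ler_pdivrMr // Ha1.
  - move=> r x e1 r0 x0 e10; have gr := g0 r r0; have mr0 : 0 < m ^+ r by rewrite exprn_gt0.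
    have x20 : 0 < x / 2 / m ^+ r by rewrite !divr_gt0.
    have [U U0 HU] := cdf_lip (2 * x / m ^+ r) x20.
    exists (Num.min (x / 2) (e1 * g r * m ^+ r / U)).
      by rewrite lt_min !divr_gt0 // !mulr_gt0.
    move=> y y0; rewrite lt_min => /andP[yx1 yx2].
    rewrite /V2 -mulrBl normrM [X in _ * X]gtr0_norm ?invr_gt0 // ler_pdivrMr //.
    have bnd z : `|z - x| < x / 2 -> x / 2 / m ^+ r <= z / m ^+ r <= 2 * x / m ^+ r.
      rewrite ltr_norml => /andP[z1 z2]; rewrite !ler_pM2r ?invr_gt0 //.
      by move: z1 z2; forget_after e; apply/andP; split; lra.
    have xx : `|x - x| < x / 2 by rewrite subrr normr0 divr_gt0.
    apply: (le_trans (HU _ _ (bnd y yx1) (bnd x xx))).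
    rewrite -mulrBl normrM [X in _ * (_ * X)]gtr0_norm ?invr_gt0 //.
    by rewrite mulrA ler_pdivrMr // mulrC -ler_pdivlMr // ltW.
  - by rewrite /V2 divr_gt0 ?g0 // cdf0 // wx.
  - move=> x /andP[x1 x2]; rewrite /V2 ler_wpM2r ?invr_ge0 ?(ltW (g0 _ _)) //.
    have xm0 : 0 < m^-1 / m ^+ 1 by exact: wx.
    have [U U0 HU] := cdf_pos_lip w_gt0 w_cont w_density (x / m ^+ 1) xm0.
    have xx : m^-1 / m ^+ 1 <= x / m ^+ 1 by rewrite ler_wpM2r // invr_ge0 exprn_ge0 // ltW.
    by have /andP[] := HU _ _ (lexx _) xx (lexx _).
exists (maxn R1 R2), (maxn A1 A2); split; first by rewrite leq_max R10.
move=> r a k; rewrite !geq_max => /andP[r1 r2] /andP[a1 a2] adm ka x.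
have r0 : (0 < r)%N by exact: leq_trans r1.
have gr := g0 r r0; have ca := cgt0 a; have mr0 : 0 < m ^+ r by rewrite exprn_gt0.
have := H1 r a k r1 a1 adm ka; have := H2 r a k r2 a2 adm ka.
rewrite /X1 /V1 /X2 /V2 -/x -!mulrBl !normrM (gtr0_norm (_ : 0 < (g r)^-1)) ?invr_gt0 //.
rewrite !mulrA !ler_pM2r ?invr_gt0 // => h2 h1; split=> //.
have -> : q (r + a)%N k - d%:R / (m ^+ r * c a) * w x =
    (c a * q (r + a)%N k - d%:R / m ^+ r * w x) / c a by field; rewrite !lt0r_neq0.
rewrite normrM (gtr0_norm (_ : 0 < (c a)^-1)) ?invr_gt0 // ler_pdivrMr //.
apply: (le_trans h1); rewrite le_eqVlt; apply/orP; left; apply/eqP.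
by field; rewrite !lt0r_neq0.
Qed.
End LowerDeviations.

(** * Deduction of the theorem *)

Section Conclusion.
Context {R : realType}.

Lemma asymp_eq_of_rel (x y : nat -> R) :
  (forall e, 0 < e -> exists N, forall n, (N <= n)%N -> 0 < y n /\ `|x n - y n| <= e * y n) ->
  asymp_eq x y.
Proof.
move=> H; exists (fun n => x n / y n - 1); split.
  apply/cvgn_distP => e e0; have e20 : 0 < e / 2 by rewrite divr_gt0.
  have [N HN] := H _ e20; exists N => n /HN[y0 xy]; rewrite subr0.
  have -> : x n / y n - 1 = (x n - y n) / y n by rewrite mulrBl divff // lt0r_neq0.
  rewrite normrM [X in _ * X]gtr0_norm ?invr_gt0 // ltr_pdivrMr //.
  by apply: (le_lt_trans xy); rewrite ltr_pM2r // ltr_pdivrMr // ltr_pMr // ltr1n.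
have [N HN] := H 1 ltr01; exists N => // n /= /HN[y0 _].
by rewrite addrC subrK mulrC divfK // lt0r_neq0.
Qed.

Variables (m : R) (d mu : nat) (c : nat -> R).
Hypothesis m1 : 1 < m.
Hypothesis c0 : c 0%N = 1.
Hypothesis cS : forall n, c n < c n.+1 /\ c n.+1 <= m * c n.
Variables (k : nat -> int) (a : nat -> nat).
Hypothesis k_mod : forall n, (k n = mu%:Z %[mod d%:Z])%Z.
Hypothesis k_infty : (fun n => (k n)%:~R : R) @ \oo --> +oo.
Hypothesis k_small : (fun n => (k n)%:~R / c n) @ \oo --> (0 : R).
Hypothesis k_exceed : forall n, is_first_exceed c (k n)%:~R (a n).

(** Minimality of a = a_n gives c_(a-1) < k <= c_a <= m c_(a-1), hence c_a / m <= k. It only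
    compares indices at least 1, so a >= 2 is needed, which k >= c_1 + 1 provides. That k tends to
    infinity makes a large, and k = o(c_n) makes n - a large. *)
Lemma first_exceed_eventually R0 A0 : exists N, forall n, (N <= n)%N -> exists r kk : nat,
  [/\ k n = kk%:Z, (r + a n)%N = n, (R0 <= r)%N, (A0 <= a n)%N &
      admissible c m d mu (a n) kk /\ c (a n) / m <= kk%:R].
Proof.
have m0 : 0 < m by exact: lt_trans m1.
have cgt0 := scale_gt0 c0 cS.
have Kge (A : R) : exists N, forall n, (N <= n)%N -> A <= (k n)%:~R.
  by move/cvgryPge: k_infty => /(_ A)[N _ HN]; exists N.
have [N1 H1] := Kge 1; have [N2 H2] := Kge (c 1%N + 1).
have [N3 H3] := Kge (c A0 + 1).
(* If n < R0 + a_n, then c_n <= m^R0 c_(a_n) <= m^(R0+1) k, which contradicts this bound on k /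
   c_n. *)
have e0 : 0 < (m ^+ R0.+1)^-1 by rewrite invr_gt0 exprn_gt0.
have [N4 H4] : exists N, forall n, (N <= n)%N -> (k n)%:~R / c n < (m ^+ R0.+1)^-1.
  move/cvgn_distP: k_small => /(_ _ e0)[N HN]; exists N => n /HN; rewrite subr0.
  exact: ltr_normlW.
exists (maxn (maxn N1 N2) (maxn N3 N4)) => n; rewrite !geq_max.
move=> /andP[/andP[/H1{}H1 /H2{}H2] /andP[/H3{}H3 /H4{}H4]].
have [a1 [kc amin]] := k_exceed n; have kmod := k_mod n.
have kpos : 0 <= k n by rewrite -(ler0z R); lra.
have [kk kE] : exists kk : nat, k n = kk%:Z by exists `|k n|%N; rewrite gez0_abs.
rewrite kE -?pmulrn in H1 H2 H3 H4 kc amin kmod *.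
have monoc i : c i + 1 <= kk%:R -> (i < a n)%N.
  move=> ik; rewrite ltnNge; apply/negP => ai.
  by have := scale_le cS ai; lra.
have an1 := monoc _ H2; have anA := monoc _ H3.
have prev : c (a n).-1 < kk%:R.
  rewrite ltNge; apply/negP => H.
  have a2 : (0 < (a n).-1)%N by rewrite -ltnS prednK.
  by have := amin _ a2 H; rewrite -ltnS prednK // ltnn.
have cm : c (a n) <= m * c (a n).-1.
  by have [_] := cS (a n).-1; rewrite prednK.
have ck : c (a n) <= m * kk%:R by apply: (le_trans cm); rewrite ler_wpM2l ?ltW.
have ran : (R0 + a n <= n)%N.
  rewrite leqNgt; apply/negP => nR; move: H4; rewrite ltNge => /negP; apply.
  rewrite ler_pdivlMr // mulrC ler_pdivrMr ?exprn_gt0 //.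
  have := scale_le cS (ltnW nR) => h1.
  have := scale_le_exp m1 cS (leq_addl R0 (a n)); rewrite addnK => h2.
  apply: (le_trans h1); apply: (le_trans h2); rewrite exprSr [leRHS]mulrC -mulrA.
  by rewrite ler_wpM2l // exprn_ge0 // ltW.
exists (n - a n)%N, kk; split=> //.
- by rewrite subnK // (leq_trans _ ran) // leq_addl.
- by rewrite leq_subRL ?(leq_trans (leq_addl R0 _) ran) // addnC.
- exact: ltnW.
have ckm : c (a n) / m <= kk%:R by rewrite ler_pdivrMr // mulrC.
split=> //; split; first by move: kmod; rewrite !modz_nat => -[].
rewrite kc andbT; apply: le_trans ckm; rewrite ler_wpM2l ?(ltW (cgt0 _)) //.
by rewrite lef_pV2 ?posrE ?mulr_gt0 // ler_peMl // ?ler1n // ltW.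
Qed.
End Conclusion.

Theorem mainTheorem1 (R : realType) (dT : measure_display) (T : measurableType dT)
  (P : probability T R) (p : nat -> R) (m : R) (d mu : nat)
  (Z : nat -> T -> nat) (c : nat -> R) (W : {RV P >-> R}) (w : R -> R) :
  offspring_law p ->
  (forall j, p j < 1) ->
  offspring_mean p m -> 1 < m ->
  0 < p 0%N + p 1%N ->
  span_gcd p d -> min_support p mu ->
  GW_process P p Z ->
  (* normalizing constants *)
  c 0%N = 1 ->
  (forall n, c n < c n.+1 /\ c n.+1 <= m * c n) ->
  (exists L : R -> R, slowly_varying L /\ forall n, c n = m ^+ n * L (m ^+ n)) ->
  (cvg (series (fun j => j%:R * ln j%:R * p j) @ \oo) -> forall n, c n = m ^+ n) ->
  (* c_n^{-1} Z_n -> W a.s., W non-degenerate *)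
  {ae P, forall t, (fun n => (Z n t)%:R / c n) @ \oo --> W t} ->
  ~ (exists x : R, P [set t | W t = x] = 1%E) ->
  (* positive continuous density w of W on (0, oo) *)
  (forall x : R, 0 < x -> 0 < w x) ->
  {within `]0, +oo[, continuous w} ->
  (forall A : set R, measurable A -> A `<=` `]0, +oo[ ->
     P (W @^-1` A) = (\int[lebesgue_measure]_(x in A) (w x)%:E)%E) ->
  forall (k : nat -> int) (a : nat -> nat),
    (forall n, (k n = mu%:Z %[mod d%:Z])%Z) ->
    (fun n => (k n)%:~R : R) @ \oo --> +oo ->
    (fun n => (k n)%:~R / c n) @ \oo --> (0 : R) ->
    (forall n, is_first_exceed c (k n)%:~R (a n)) ->
    let D n := m ^ (n%:Z - (a n)%:Z) * c (a n) in
    asymp_eq (fun n => fine (P [set t | (Z n t)%:Z = k n]))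
             (fun n => d%:R / D n * w ((k n)%:~R / D n)) /\
    asymp_eq (fun n => fine (P [set t | 0 < (Z n t)%:Z <= k n]))
             (fun n => fine (P [set t | 0 < W t < (k n)%:~R / D n])).
Proof.
move=> pl p_lt1 pm m1 schroeder d_span mu_min GW c0 cS cL _ ZW _ w_gt0 w_cont w_density.
move=> k a k_mod k_infty k_small k_exceed D.
have m0 : 0 < m by exact: lt_trans m1.
have main e : 0 < e -> exists N, forall n, (N <= n)%N -> exists kk : nat,
    [/\ k n = kk%:Z, 0 < D n, 0 < kk%:R / D n :> R,
      `|law P Z n kk - d%:R / D n * w (kk%:R / D n)| <= e * (d%:R / D n * w (kk%:R / D n)) &
      `|\sum_(1 <= l < kk.+1) law P Z n l - cdf_pos W (kk%:R / D n)| <=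
        e * cdf_pos W (kk%:R / D n)].
  move=> e0.
  have [R0 [A0 [_ H]]] := lower_deviations pl p_lt1 pm m1 schroeder d_span mu_min GW c0 cS cL ZW
    w_gt0 w_cont w_density e0.
  have [N HN] := first_exceed_eventually m1 c0 cS k_mod k_infty k_small k_exceed R0 A0.
  exists N => n /HN[r [kk [kE rn Rr Aa [adm ck]]]]; exists kk.
  have ca := scale_gt0 c0 cS (a n).
  have DE : D n = m ^+ r * c (a n).
    rewrite /D; congr (_ * _); rewrite -{1}rn PoszD addrK; by [].
  have D0 : 0 < D n by rewrite DE mulr_gt0 // exprn_gt0.
  have kk0 : 0 < kk%:R :> R by apply: lt_le_trans ck; rewrite divr_gt0.
  have xE : kk%:R / c (a n) / m ^+ r = kk%:R / D n.
    by rewrite DE invfM mulrA mulrAC.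
  have [h1 h2] := H r (a n) kk Rr Aa adm ck.
  by rewrite rn -DE xE in h1 h2; split=> //; rewrite divr_gt0.
have d0 : 0 < d%:R :> R by rewrite ltr0n; case: d_span.
split; apply: asymp_eq_of_rel => e e0; have [N HN] := main e e0; exists N => n.
  move=> /HN[kk [kE D0 x0 h _]]; rewrite kE -pmulrn.
  rewrite (_ : fine _ = law P Z n kk); first by split=> //; rewrite mulr_gt0 ?divr_gt0 // w_gt0.
  by rewrite /law /pr; congr (fine (P _)); apply/seteqP; split=> t /=; [case|move=> ->].
move=> /HN[kk [kE D0 x0 _ h]]; rewrite kE -pmulrn.
rewrite (_ : fine (P [set t | 0 < (Z n t)%:Z <= _]) = \sum_(1 <= l < kk.+1) law P Z n l).
  by split=> //; exact: (cdf_pos_gt0 w_gt0 w_cont w_density).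
by rewrite -(law_range GW).
Qed.
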